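(* Let $L_1,\dots,L_M\in\mathbb{N}$ and $q_1,\dots,q_M\in\mathbb{R}[x]$ with $\deg q_j<2L_j$, $q_j(0)=0$, and let $P(x,y)=\prod_{j=1}^M(y+q_j(x)+ix^{2L_j})$. Let $A=\tfrac12(P+\bar P)$, $B=\tfrac1{2i}(P-\bar P)$, and fix $t\in\mathbb{R}$. Then locally $A+tB$ has $M$ smooth branches $y=a_j(x;t)$, $j=1,\dots,M$, through $(0,0)$ with $a_j(\cdot;t)\in\mathbb{R}\{x\}$, and for $Q\in\mathbb{C}\{x,y\}$: $Q/P\in L^2_{loc}$ if and only if for each $j=1,\dots,M$, $$2\,\mathrm{Ord}\bigl(Q(x,a_j(x;t))\bigr)\ge\mathrm{Ord}\Bigl(B(x,a_j(x;t))\bigl(A_y(x,a_j(x;t))+tB_y(x,a_j(x;t))\bigr)\Bigr).$$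
   Context: $\bar P(x,y)=\overline{P(\bar x,\bar y)}$; subscript $y$ denotes $\partial/\partial y$. $\mathbb{C}\{x,y\}$ are convergent power series at the origin, $\mathbb{R}\{x\}$ convergent real-coefficient series in $x$. Ord is order of vanishing at $0$. $f\in L^{2}_{loc}$ means $f\in L^2(U)$ (Lebesgue measure) for some neighborhood $U$ of $(0,0)$ in $\mathbb{R}^2$. *)

(* Defs.v *)
From HB Require Import structures.
From mathcomp Require Import all_boot all_order all_algebra.
From mathcomp Require Import complex.
From mathcomp Require Import all_classical all_reals all_analysis.
Set Implicit Arguments. Unset Strict Implicit. Unset Printing Implicit Defensive.
Import Order.TTheory GRing.Theory Num.Theory.
Import numFieldNormedType.Exports.
Local Open Scope classical_set_scope.
Local Open Scope ring_scope.

Section Defs.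
Variable R : realType.
Local Notation C := R[i].

Definition iC : C := Complex 0 1.
Definition rC (r : R) : C := Complex r 0.

(* Bivariate polynomials over C: an element of {poly {poly C}} is
   sum_k p_k(x) y^k (outer variable y, inner variable x).
   Evaluation at (x, y). *)
Definition eval2 (p : {poly {poly C}}) (x y : C) : C := (p.[y%:P]).[x].

(* coefficientwise complex conjugation: Pbar(x,y) = conj (P(conj x, conj y)) *)
Definition conj2 (p : {poly {poly C}}) : {poly {poly C}} :=
  map_poly (map_poly Num.conj) p.

Definition polyRC (q : {poly R}) : {poly C} := map_poly rC q.

Definition Ppoly (M : nat) (q : 'I_M -> {poly R}) (L : 'I_M -> nat)
  : {poly {poly C}} :=
  \prod_(j < M) ('X + (polyRC (q j) + iC *: 'X^(2 * L j))%:P).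

Definition Apoly (P : {poly {poly C}}) : {poly {poly C}} :=
  (P + conj2 P) * ((2%:R : C)^-1)%:P%:P.
Definition Bpoly (P : {poly {poly C}}) : {poly {poly C}} :=
  (P - conj2 P) * ((2%:R * iC)^-1)%:P%:P.

Definition conv_series1 (b : nat -> R) : Prop :=
  exists r : R, 0 < r /\ exists K : R, forall n, `|b n| * r ^+ n <= K.
Definition limR (u : nat -> R) : R := lim (u @ \oo).
Definition eval_series1 (b : nat -> R) (x : R) : R :=
  lim ((fun N : nat => \sum_(k < N) b k * x ^+ k) @ \oo).

Definition conv_series2 (c : nat -> nat -> C) : Prop :=
  exists r : R, 0 < r /\ exists K : R,
    forall m n, `|c m n| * rC (r ^+ (m + n)) <= rC K.
Definition psum2 (c : nat -> nat -> C) (x y : C) (N : nat) : C :=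
  \sum_(m < N) \sum_(n < N) c m n * x ^+ m * y ^+ n.
Definition eval_series2 (c : nat -> nat -> C) (x y : C) : C :=
  Complex (limR (fun N : nat => complex.Re (psum2 c x y N)))
          (limR (fun N : nat => complex.Im (psum2 c x y N))).

(* order of vanishing at 0 of f : R -> C, in \bar R (= +oo iff f is
   O(|x|^n) for all n, e.g. f = 0 near 0) *)
Definition vanishes_to (f : R -> C) (n : nat) : Prop :=
  exists r : R, 0 < r /\ exists K : R,
    forall x : R, `|x| < r -> `|f x| <= rC (K * `|x| ^+ n).
Definition Ord (f : R -> C) : \bar R :=
  ereal_sup [set (n%:R : R)%:E | n in [set n : nat | vanishes_to f n]].

Definition sqnormC (z : C) : R := complex.Re z ^+ 2 + complex.Im z ^+ 2.
Definition L2_on (U : set (R * R)) (f : R * R -> C) : Prop :=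
  measurable U /\
  measurable_fun U (fun p => complex.Re (f p)) /\
  measurable_fun U (fun p => complex.Im (f p)) /\
  (\int[(@lebesgue_measure R \x @lebesgue_measure R)%E]_(p in U)
      (sqnormC (f p))%:E < +oo)%E.

(* f in L^2_loc: f in L^2(U) for some neighborhood U of (0,0); it suffices
   (equivalently) to take the open squares ]-e,e[ x ]-e,e[ *)
Definition L2loc (f : R * R -> C) : Prop :=
  exists e : R, 0 < e /\
    L2_on ([set p : R * R | `|p.1| < e /\ `|p.2| < e]) f.

End Defs.

(* Main.v *)
Require Import Defs.
From HB Require Import structures.
From mathcomp Require Import all_boot all_order all_algebra.
From mathcomp Require Import complex.
From mathcomp Require Import all_classical all_reals all_analysis measurable_realfun.
From mathcomp Require Import ring lra zify.
Set Implicit Arguments. Unset Strict Implicit. Unset Printing Implicit Defensive.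
Import Order.TTheory GRing.Theory Num.Theory.
Import numFieldNormedType.Exports.
Import Normc.
Local Open Scope classical_set_scope.
Local Open Scope ring_scope.

(* For fixed x <> 0, view P, A, B and F = A + t B as polynomials in y.  The
   roots of P lie in the lower half plane, so the roots a_j(x) of F are real and
   simple (Hermite-Biehler), and a splitting argument based on Hensel's lemma
   makes them analytic in x (Rellich).  On the real line the Wronskian
   W = B F_y - F B_y equals |P|^2 times a sum of M Poisson kernels, so that W / |P|^2
   has integral at most M pi; it is also \sum_j w_j (F / (y - a_j))^2 with
   w_j > 0, and on the branch y = a_j it reduces to B F_y.  Write Q = N + h F
   with N the Lagrange interpolation of Q at the roots of F; as F / P is
   bounded on the line, only N / P matters.

   By Cauchy-Schwarz, |N|^2 <= W \sum_j |Q(a_j)|^2 / W(a_j), so the integral of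
   |Q / P|^2 over the fiber is bounded in terms of the ratios |Q(a_j)|^2 / W(a_j).
   Conversely, N / P is holomorphic in the upper half plane and, after
   multiplication by 1 + i t, its real part on the line (for N real) is
   N F / |P|^2, which vanishes at a_j.  Averaging over half discs centered at a_j
   bounds N(a_j) / B(a_j) by the integral of |N F| / (|y - a_j| |P|^2), and the
   two formulas for W turn this into
   |Q(a_j)|^2 / W(a_j) <= C (1 + integral of |Q / P|^2 dy).
   If the order inequality holds on every branch, these ratios are bounded in x;
   if it fails on the branch a_j, the ratio there is at least c / |x|, which is
   not integrable. *)

(** * Germs of real analytic functions *)

Section GeometricBounds.
Variable R : realType.
Implicit Types (u : nat -> R) (q A K X Y : R).

Lemma sum_expr_le q n : 0 <= q < 1 -> \sum_(i < n) q ^+ i <= (1 - q)^-1.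
Proof.
move=> /andP[q0 q1]; have q1_gt0 : 0 < 1 - q by rewrite subr_gt0.
have -> : \sum_(i < n) q ^+ i = (1 - q ^+ n) / (1 - q).
  by rewrite -[1 - q ^+ n]opprB subrX1 -mulNr opprB mulrAC divff ?mul1r ?gt_eqF.
by rewrite ler_pdivrMr // mulVf ?gt_eqF // gerBl exprn_ge0.
Qed.

Lemma sum_expr_le2 q n : 0 <= q <= 2^-1 -> \sum_(i < n) q ^+ i <= 2.
Proof.
move=> /andP[q0 q_half]; apply: le_trans (sum_expr_le n _) _; first by lra.
by rewrite -[leRHS]invrK lef_pV2 ?posrE ?invr_gt0 //; lra.
Qed.

Lemma ler_add_geometric X Y A q : `|q| < 1 ->
  (forall n, X <= Y + A * q ^+ n) -> X <= Y.
Proof.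
move=> q1 XY; have cvgY : (fun n => Y + A * q ^+ n) @ \oo --> Y.
  by rewrite -[X in _ --> X]addr0; apply: cvgD; [exact: cvg_cst|exact: cvg_geometric].
rewrite -(cvg_lim _ cvgY) //; apply: limr_ge; first by apply: cvgP cvgY.
exact: nearW.
Qed.

Lemma geometric_cvg u A q : 0 <= q <= 2^-1 ->
  (forall n, `|u n.+1 - u n| <= A * q ^+ n) ->
  u @ \oo --> limR u /\ forall N, `|limR u - u N| <= 2 * A * q ^+ N.
Proof.
move=> q_half u_step; have /andP[q0 q2] := q_half.
have A0 : 0 <= A by rewrite -[A]mulr1 -(expr0 q); apply: le_trans (u_step 0%N).
have cvgu : cvgn u.
  have -> : u = (fun n => u 0%N + series (telescope u) n).
    by apply/funext => n; apply: eq_sum_telescope.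
  apply: is_cvgD; first exact: is_cvg_cst.
  apply: normed_cvg; apply: (@series_le_cvg _ _ (geometric A q)) => [n|n|n|].
  - exact: normr_ge0.
  - by rewrite /geometric /= mulr_ge0 // exprn_ge0.
  - exact: u_step.
  - by apply: is_cvg_geometric_series; rewrite ger0_norm //; lra.
split=> // N; have u_tail n : `|u (N + n)%N - u N| <= 2 * A * q ^+ N.
  have -> : u (N + n)%N - u N = \sum_(i < n) (u (N + i).+1 - u (N + i)%N).
    elim: n => [|n IH]; first by rewrite big_ord0 addn0 subrr.
    by rewrite big_ord_recr /= -IH addnS; ring.
  apply: le_trans (ler_norm_sum _ _ _) _.
  apply: (@le_trans _ _ (\sum_(i < n) A * q ^+ N * q ^+ i)).
    by apply: ler_sum => i _; rewrite -mulrA -exprD.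
  rewrite -mulr_sumr -[2 * A * _]mulrA [leRHS]mulrC.
  by rewrite ler_wpM2l ?mulr_ge0 ?exprn_ge0 // sum_expr_le2.
have cvg_tail : (fun n => `|u (N + n)%N - u N|) @ \oo --> `|limR u - u N|.
  apply: cvg_norm; apply: cvgB; last exact: cvg_cst.
  exact: (cvg_comp (addn N) u (cvg_addnl N) cvgu).
rewrite -(cvg_lim _ cvg_tail) //; apply: limr_le; first by apply: cvgP cvg_tail.
exact: nearW.
Qed.

End GeometricBounds.

Lemma near0_lt (R : realType) (e : R) : 0 < e -> \forall x \near (0 : R), `|x| < e.
Proof. exact: nbhs0_lt. Qed.

Lemma near0_ex_ball (R : realType) (P : R -> Prop) :
  (\forall x \near 0, P x) -> exists2 e, 0 < e & forall x, `|x| < e -> P x.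
Proof. by move=> /nbhs_norm0P [e /= e0 Pe]; exists e. Qed.

Lemma near0_forall (R : realType) (I : finType) (P : I -> R -> Prop) :
  (forall i, \forall x \near 0, P i x) -> \forall x \near 0, forall i, P i x.
Proof. exact: (@filter_forall _ _ P (nbhs (0 : R))). Qed.

Lemma near0_ex_sym (R : realType) (P : R -> Prop) :
  (\forall x \near 0, P x) -> exists2 x, 0 < x & P x /\ P (- x).
Proof.
move=> /near0_ex_ball [e e0 Pe]; exists (e / 2); first by rewrite divr_gt0.
by split; apply: Pe; rewrite ?normrN gtr0_norm ?divr_gt0 //; lra.
Qed.

Section Germs.
Variable R : realType.
Implicit Types (f g : R -> R) (b c : nat -> R) (r K x : R).

(* The remainder bounds say that [f] is the sum of the power series [b] near 0
   without mentioning limits. *)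
Definition germ_on f b r K := [/\ 0 < r, 0 <= K &
  forall N x, `|x| < r ->
    `|f x - \sum_(k < N) b k * x ^+ k| <= K * (`|x| / r) ^+ N].

Definition germ f b := exists r K, germ_on f b r K.

Lemma germ_on_weaken f b r r' K K' : 0 < r' -> r' <= r -> K <= K' ->
  germ_on f b r K -> germ_on f b r' K'.
Proof.
move=> r'0 r'r KK' [r0 K0 fb]; split=> // [|N x xr']; first exact: le_trans KK'.
apply: le_trans (fb N x (lt_le_trans xr' r'r)) _.
apply: ler_pM => //; first by rewrite exprn_ge0 // divr_ge0 // ltW.
apply: lerXn2r; rewrite ?nnegrE ?divr_ge0 ?(ltW r0) ?(ltW r'0) //.
by rewrite ler_wpM2l // lef_pV2 ?posrE.
Qed.

Lemma germ_on_common f g b c : germ f b -> germ g c ->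
  exists r K, germ_on f b r K /\ germ_on g c r K.
Proof.
move=> [r [K fb]] [r' [K' gc]]; have [[r0 K0 _] [r'0 K'0 _]] := (fb, gc).
exists (Num.min r r'), (Num.max K K').
by split; [apply: germ_on_weaken fb|apply: germ_on_weaken gc];
  rewrite ?lt_min ?r0 ?ge_min ?le_max ?lexx ?orbT.
Qed.

Lemma germ_on_coef_le f b r K n : germ_on f b r K -> `|b n| <= 2 * K / r ^+ n.
Proof.
move=> [r0 K0 fb]; pose x := r / 2; have x0 : 0 < x by rewrite divr_gt0.
have xr : `|x| < r by rewrite gtr0_norm // /x; lra.
have := fb n.+1 x xr; have := fb n x xr.
rewrite big_ord_recr /= (gtr0_norm x0); set S := \sum_(k < n) _ => fbn fbSn.
have xq : x / r = 2^-1 by rewrite /x; field; rewrite gt_eqF.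
have : `|b n * x ^+ n| <= K * (x / r) ^+ n + K * (x / r) ^+ n.+1.
  have -> : b n * x ^+ n = (f x - S) - (f x - (S + b n * x ^+ n)) by ring.
  exact: le_trans (ler_normB _ _) (lerD fbn fbSn).
rewrite normrM (gtr0_norm (exprn_gt0 n x0)) -ler_pdivlMr ?exprn_gt0 // => /le_trans; apply.
have -> : (K * (x / r) ^+ n + K * (x / r) ^+ n.+1) / x ^+ n = (3 / 2) * K / r ^+ n.
  rewrite exprS {2}xq [(x / r) ^+ n]exprMn exprVn.
  by field; rewrite !expf_neq0 ?gt_eqF.
by rewrite ler_wpM2r ?invr_ge0 ?exprn_ge0 ?(ltW r0) // ler_wpM2r //; lra.
Qed.

Lemma germ_on_le f b r K x : germ_on f b r K -> `|x| < r -> `|f x| <= K.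
Proof. by move=> [r0 K0 fb] /(fb 0%N); rewrite big_ord0 subr0 expr0 mulr1. Qed.

Lemma germ_near f g b : (\forall x \near 0, f x = g x) -> germ f b -> germ g b.
Proof.
move=> /nbhs_norm0P [e /= e0 fg] [r [K fb]]; have [r0 K0 _] := fb.
have [|||m0 _ fb'] := germ_on_weaken (r' := Num.min r e) (K' := K) _ _ _ fb;
  rewrite ?lt_min ?r0 ?ge_min ?lexx //.
exists (Num.min r e), K; split=> // N x x_min.
by rewrite -fg; [exact: fb'|move: x_min; rewrite /= lt_min => /andP[]].
Qed.

Lemma eq_germ f g b c : f =1 g -> b =1 c -> germ f b -> germ g c.
Proof. by move=> /funext -> /funext ->. Qed.

Lemma germ_cst a : germ (fun=> a) (fun k => if k == 0%N then a else 0).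
Proof.
exists 1, `|a|; split => // [[|N]] x _; first by rewrite big_ord0 subr0 expr0 mulr1.
rewrite big_ord_recl /= expr0 mulr1 big1 ?addr0 ?subrr ?normr0; last first.
  by move=> i _; rewrite mul0r.
by rewrite mulr_ge0 // exprn_ge0 // divr_ge0.
Qed.

Lemma germ_id : germ id (fun k => (k == 1%N)%:R).
Proof.
exists 1, 1; split => // [[|[|N]]] x x1.
- by rewrite big_ord0 subr0 expr0 mulr1 ltW.
- by rewrite big_ord_recl big_ord0 /= mul0r addr0 subr0 expr1 divr1 mul1r.
- rewrite !big_ord_recl /= mul0r mul1r big1 ?addr0 ?add0r ?expr1 ?mul1r ?subrr ?normr0.
    by rewrite divr1 exprn_ge0.
  by move=> i _; rewrite mul0r.
Qed.

Lemma germD f g b c : germ f b -> germ g c ->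
  germ (fun x => f x + g x) (fun k => b k + c k).
Proof.
move=> fb gc; have [r [K [[r0 K0 fbK] [_ _ gcK]]]] := germ_on_common fb gc.
exists r, (K + K); split => // [|N x xr]; first exact: addr_ge0.
under eq_bigr do rewrite mulrDl; rewrite big_split /= mulrDl.
set A := \sum_(i < N) _; set B := \sum_(i < N) _.
have -> : f x + g x - (A + B) = (f x - A) + (g x - B) by ring.
by apply: le_trans (ler_normD _ _) _; apply: lerD; [apply: fbK|apply: gcK].
Qed.

Lemma germZ a f b : germ f b -> germ (fun x => a * f x) (fun k => a * b k).
Proof.
move=> [r [K [r0 K0 fb]]]; exists r, (`|a| * K); split => // [|N x xr].
  exact: mulr_ge0.
under eq_bigr do rewrite -mulrA; rewrite -mulr_sumr -mulrBr normrM -mulrA.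
by rewrite ler_wpM2l // fb.
Qed.

Lemma germB f g b c : germ f b -> germ g c ->
  germ (fun x => f x - g x) (fun k => b k - c k).
Proof.
move=> fb gc; apply: eq_germ (germD fb (germZ (-1) gc)) => [x|k]; by rewrite mulN1r.
Qed.

Lemma germ_sum (I : Type) (s : seq I) (f : I -> R -> R) (b : I -> nat -> R) :
  (forall i, germ (f i) (b i)) ->
  germ (fun x => \sum_(i <- s) f i x) (fun k => \sum_(i <- s) b i k).
Proof.
move=> fb; elim: s => [|i s IH].
  by apply: eq_germ (germ_cst 0) => [x|k]; rewrite big_nil // if_same.
by apply: eq_germ (germD (fb i) IH) => [x|k]; rewrite big_cons.
Qed.

Definition cauchy_prod b c k := \sum_(i < k.+1) b i * c (k - i)%N.

Lemma cauchy_prod_psum b c N x :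
  \sum_(k < N) cauchy_prod b c k * x ^+ k =
  \sum_(i < N) b i * x ^+ i * \sum_(k < (N - i)%N) c k * x ^+ k.
Proof.
elim: N => [|N IH]; first by rewrite !big_ord0.
rewrite big_ord_recr /= IH [RHS]big_ord_recr /= subSnn big_ord_recr big_ord0 /= add0r.
rewrite /cauchy_prod big_ord_recr /= subnn.
under [X in _ = X + _]eq_bigr => i _.
  rewrite subSn ?[X in (_ <= X)%N]ltnW //; last exact: ltnW (ltn_ord i).
  rewrite big_ord_recr /= mulrDr; over.
rewrite big_split /= mulrDl mulr_suml -addrA expr0; congr (_ + (_ + _)); last by ring.
apply: eq_bigr => i _.
have -> : x ^+ N = x ^+ i * x ^+ (N - i) by rewrite -exprD subnKC // ltnW.
by ring.
Qed.

Lemma germ_on_cauchy_prod_tail f g b c r K N x :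
  germ_on f b r K -> germ_on g c r K -> `|x| < r ->
  `|\sum_(i < N) b i * x ^+ i * (g x - \sum_(k < (N - i)%N) c k * x ^+ k)|
    <= 2 * K * K * (`|x| / r) ^+ N *+ N.
Proof.
move=> fb [r0 K0 gc] xr; apply: le_trans (ler_norm_sum _ _ _) _.
rewrite -[X in _ *+ X]card_ord -sumr_const; apply: ler_sum => i _.
rewrite !normrM normrX; have qN : (`|x| / r) ^+ N = (`|x| / r) ^+ i * (`|x| / r) ^+ (N - i).
  by rewrite -exprD subnKC // ltnW.
have -> : 2 * K * K * (`|x| / r) ^+ N =
    2 * K / r ^+ i * `|x| ^+ i * (K * (`|x| / r) ^+ (N - i)).
  by rewrite qN exprMn exprVn; ring.
apply: ler_pM; rewrite ?mulr_ge0 ?exprn_ge0 //; last exact: gc.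
by rewrite ler_wpM2r ?exprn_ge0 //; apply: germ_on_coef_le fb.
Qed.

Lemma germM f g b c : germ f b -> germ g c ->
  germ (fun x => f x * g x) (cauchy_prod b c).
Proof.
move=> /germ_on_common /[apply] -[r [K [fb gc]]]; have [r0 K0 fbK] := fb.
exists (r / 2), (2 * K * K); split; rewrite ?divr_gt0 ?mulr_ge0 // => N x x_half.
have xr : `|x| < r by apply: lt_trans x_half _; lra.
rewrite cauchy_prod_psum; set q := `|x| / r.
have -> : f x * g x - \sum_(i < N) b i * x ^+ i * \sum_(k < (N - i)%N) c k * x ^+ k =
    (f x - \sum_(i < N) b i * x ^+ i) * g x +
    \sum_(i < N) b i * x ^+ i * (g x - \sum_(k < (N - i)%N) c k * x ^+ k).
  rewrite mulrBl -addrA; congr (_ + _); rewrite mulr_suml -sumrN -sumrN -big_split /=.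
  by apply: eq_bigr => i _; ring.
have head_le : `|(f x - \sum_(i < N) b i * x ^+ i) * g x| <= K * K * q ^+ N.
  rewrite normrM mulrAC; apply: ler_pM => //; first exact: fbK.
  exact: germ_on_le gc xr.
apply: le_trans (ler_normD _ _) _.
apply: le_trans (lerD head_le (germ_on_cauchy_prod_tail _ fb gc xr)) _.
have -> : `|x| / (r / 2) = 2 * q by rewrite /q; field; rewrite gt_eqF.
rewrite -mulr_natr [(2 * _) ^+ N]exprMn.
have N_le : N.+1%:R <= (2 : R) ^+ N by rewrite -natrX ler_nat ltn_expl.
have : 0 <= K * K * q ^+ N by rewrite !mulr_ge0 // exprn_ge0 // divr_ge0 // ltW.
by rewrite -natr1 in N_le; nra.
Qed.

Lemma germ0_eq0 f : germ f (fun=> 0) -> \forall x \near 0, f x = 0.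
Proof.
move=> [r [K [r0 K0 fK]]]; apply/nbhs_norm0P; exists r => //= x xr.
have q1 : `| `|x| / r| < 1 by rewrite ger0_norm ?divr_ge0 ?(ltW r0) // ltr_pdivrMr ?mul1r.
apply/eqP; rewrite -normr_le0; apply: (ler_add_geometric (A := K) q1) => N.
by have := fK N x xr; rewrite add0r big1 ?subr0 // => i _; rewrite mul0r.
Qed.

Lemma germ_at0 f b : germ f b -> f 0 = b 0%N.
Proof.
move=> [r [K [r0 K0 fb]]]; have := fb 1%N 0; rewrite normr0 r0 => /(_ isT).
by rewrite big_ord1 expr0 mulr1 mul0r expr1 mulr0 normr_le0 subr_eq0 => /eqP.
Qed.

Lemma germ_cvg0 f b : germ f b -> f x @[x --> 0] --> f 0.
Proof.
move=> fb; rewrite (germ_at0 fb); move: fb => [r [K [r0 K0 fb]]].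
apply/cvgrPdist_le => e e0; have d0 : 0 < e * r / (K + 1).
  by rewrite divr_gt0 ?mulr_gt0 // ltr_wpDl.
apply: filterS2 (near0_lt r0) (near0_lt d0) => x xr; rewrite distrC.
have := fb 1%N x xr; rewrite big_ord1 expr0 mulr1 expr1 => /le_trans fx.
rewrite ltr_pdivlMr ?ltr_wpDl // => x_le; apply: fx.
rewrite mulrA ler_pdivrMr //; apply: le_trans (ltW x_le).
by rewrite mulrDr mulr1 mulrC lerDl.
Qed.

Lemma germ_coef_eq0 f b m : germ f b ->
  (exists C : R, \forall x \near 0, x != 0 -> `|f x| <= C * `|x| ^+ m) ->
  forall k, (k < m)%N -> b k = 0.
Proof.
move=> [r [K [r0 K0 fb]]] [C fC] k; elim/ltn_ind: k => k IH km.
pose D : R := `|C| + K / r ^+ k.+1.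
have D0 : 0 <= D by rewrite addr_ge0 // divr_ge0 // exprn_ge0 // ltW.
have bk_le : \forall x \near (0 : R), x != 0 -> `|b k| <= D * `|x|.
  apply: filterS3 fC (near0_lt r0) (near0_lt ltr01) => x fx xr /ltW x1 x0.
  have := fb k.+1 x xr; rewrite big_ord_recr /= big1 ?add0r => [fbk|i _]; last first.
    by rewrite IH ?mul0r // (ltn_trans (ltn_ord i)).
  have : `|b k * x ^+ k| <= `|C| * `|x| ^+ k.+1 + K * (`|x| / r) ^+ k.+1.
    have -> : b k * x ^+ k = f x - (f x - b k * x ^+ k) by ring.
    apply: le_trans (ler_normB _ _) (lerD (le_trans (fx x0) _) fbk).
    apply: (@le_trans _ _ (`|C| * `|x| ^+ m)).
      by rewrite ler_wpM2r ?exprn_ge0 // ler_norm.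
    by rewrite ler_wpM2l // ler_wiXn2l.
  rewrite normrM normrX exprMn exprVn (mulrC (`|x| ^+ k.+1)) mulrA -mulrDl.
  by rewrite -/D [`|x| ^+ k.+1]exprS mulrA ler_pM2r // exprn_gt0 // normr_gt0.
apply/eqP; rewrite -normr_le0; apply/ler_addgt0Pr => e e0; rewrite add0r.
have d0 : 0 < e / (D + 1) by rewrite divr_gt0 // ltr_wpDl.
have [x x0 [[bkx /ltW xe] _]] := near0_ex_sym (filterI bk_le (near0_lt d0)).
apply: le_trans (bkx (lt0r_neq0 x0)) _.
move: xe; rewrite ler_pdivlMr ?ltr_wpDl //; apply: le_trans.
by rewrite mulrC ler_wpM2l // lerDl.
Qed.

Lemma germ_divX f b m : germ f b -> (forall k, (k < m)%N -> b k = 0) ->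
  exists2 g, germ g (fun k => b (m + k)%N) & \forall x \near 0, f x = x ^+ m * g x.
Proof.
move=> [r [K fb]] bm; have [r0 K0 fbK] := fb.
exists (fun x => if x == 0 then b m else f x / x ^+ m); last first.
  apply/nbhs_norm0P; exists r => // x /= xr; case: ifPn => [/eqP ->|x0].
    have := fbK m.+1 0; rewrite normr0 r0 => /(_ isT).
    rewrite big_ord_recr /= big1 ?add0r; last by move=> i _; rewrite bm ?mul0r.
    by rewrite mul0r exprS mul0r mulr0 normr_le0 subr_eq0 => /eqP ->; rewrite mulrC.
  by rewrite mulrC divfK // expf_neq0.
exists r, (2 * K / r ^+ m); split => // [|N x xr].
  by rewrite divr_ge0 ?mulr_ge0 // exprn_ge0 // ltW.
case: ifPn => [/eqP ->|x0].
  case: N => [|N]; first by rewrite big_ord0 subr0 expr0 mulr1; apply: germ_on_coef_le fb.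
  rewrite big_ord_recl /= addn0 expr0 mulr1 big1 ?addr0 ?subrr => [|i _].
    by rewrite normr0 mul0r exprS mul0r mulr0.
  by rewrite /bump /= exprS mul0r mulr0.
have xm : 0 < `|x| ^+ m by rewrite exprn_gt0 // normr_gt0.
have := fbK (m + N)%N x xr.
rewrite big_split_ord /= big1 ?add0r; last by move=> i _; rewrite bm ?mul0r.
have -> : f x - \sum_(i < N) b (m + i)%N * x ^+ (m + i) =
    x ^+ m * (f x / x ^+ m - \sum_(i < N) b (m + i)%N * x ^+ i).
  rewrite mulrBr mulrCA divff ?expf_neq0 // mulr1; congr (_ - _).
  by rewrite mulr_sumr; apply: eq_bigr => i _; rewrite exprD; ring.
rewrite normrM normrX exprD exprMn exprVn.
have -> : K * (`|x| ^+ m / r ^+ m * (`|x| / r) ^+ N) =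
    `|x| ^+ m * (K / r ^+ m * (`|x| / r) ^+ N) by ring.
rewrite ler_pM2l // => /le_trans; apply; rewrite ler_wpM2r ?exprn_ge0 ?divr_ge0 ?(ltW r0) //.
by rewrite ler_wpM2r ?invr_ge0 ?exprn_ge0 ?(ltW r0) // mulr_natl mulr2n lerDl.
Qed.

Lemma germ_conv_series1 f b : germ f b -> conv_series1 b.
Proof.
move=> [r [K fb]]; have [r0 _ _] := fb; exists r; split => //; exists (2 * K) => n.
by rewrite -ler_pdivlMr ?exprn_gt0 //; apply: germ_on_coef_le fb.
Qed.

Lemma germ_eval_series1 b : conv_series1 b -> germ (eval_series1 b) b.
Proof.
move=> [r [r0 [K bK]]].
have K0 : 0 <= K by apply: le_trans (bK 0%N); rewrite mulr_ge0 // exprn_ge0 // ltW.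
exists (r / 2), (2 * K); split; rewrite ?divr_gt0 ?mulr_ge0 // => N x x_half.
pose q := `|x| / r; have q_half : 0 <= q <= 2^-1.
  by rewrite divr_ge0 ?(ltW r0) //= ler_pdivrMr // mulrC ltW.
pose psum n := \sum_(k < n) b k * x ^+ k.
have psum_step n : `|psum n.+1 - psum n| <= K * q ^+ n.
  rewrite /psum big_ord_recr /= addrAC subrr add0r normrM normrX exprMn exprVn.
  by rewrite mulrCA [leLHS]mulrC ler_wpM2l ?exprn_ge0 // ler_pdivlMr ?exprn_gt0.
have [_ /(_ N)] := geometric_cvg q_half psum_step.
rewrite -/(psum N) => /le_trans; apply; rewrite ler_wpM2l ?mulr_ge0 //.
apply: lerXn2r; rewrite ?nnegrE ?divr_ge0 ?(ltW r0) //.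
by rewrite ler_wpM2l // lef_pV2 ?posrE ?divr_gt0 //; lra.
Qed.

Lemma germ_uniq f g b : germ f b -> germ g b -> \forall x \near 0, f x = g x.
Proof.
move=> fb gb; have /germ0_eq0 : germ (fun x => f x - g x) (fun=> 0).
  by apply: eq_germ (germB fb gb) => // k; rewrite subrr.
by apply: filterS => x /eqP; rewrite subr_eq0 => /eqP.
Qed.

Definition analytic f := exists b, germ f b.

Lemma analytic_near f g : (\forall x \near 0, f x = g x) -> analytic f -> analytic g.
Proof. by move=> fg [b fb]; exists b; apply: germ_near fb. Qed.

Lemma eq_analytic f g : f =1 g -> analytic f -> analytic g.
Proof. by move=> /funext ->. Qed.

Lemma analytic_cst a : analytic (fun=> a).
Proof. by eexists; apply: germ_cst. Qed.

Lemma analytic_id : analytic id.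
Proof. by eexists; apply: germ_id. Qed.

Lemma analyticD f g : analytic f -> analytic g -> analytic (fun x => f x + g x).
Proof. by move=> [b fb] [c gc]; eexists; apply: germD fb gc. Qed.

Lemma analyticB f g : analytic f -> analytic g -> analytic (fun x => f x - g x).
Proof. by move=> [b fb] [c gc]; eexists; apply: germB fb gc. Qed.

Lemma analyticM f g : analytic f -> analytic g -> analytic (fun x => f x * g x).
Proof. by move=> [b fb] [c gc]; eexists; apply: germM fb gc. Qed.

Lemma analyticX f n : analytic f -> analytic (fun x => f x ^+ n).
Proof.
move=> af; elim: n => [|n IH]; first exact: analytic_cst.
by apply: eq_analytic (analyticM af IH) => x; rewrite exprS.
Qed.

Lemma analytic_exprn n : analytic (fun x => x ^+ n).
Proof. exact: analyticX analytic_id. Qed.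

Lemma analytic_sum (I : Type) (s : seq I) (f : I -> R -> R) :
  (forall i, analytic (f i)) -> analytic (fun x => \sum_(i <- s) f i x).
Proof. by move=> /boolp.choice [b fb]; eexists; apply: germ_sum fb. Qed.

Lemma analytic_prod (I : Type) (s : seq I) (P : pred I) (f : I -> R -> R) :
  (forall i, analytic (f i)) -> analytic (fun x => \prod_(i <- s | P i) f i x).
Proof.
move=> af; elim: s => [|i s IH].
  by apply: eq_analytic (analytic_cst 1) => x; rewrite big_nil.
apply: (eq_analytic (f := fun x => (if P i then f i x else 1) * \prod_(i <- s | P i) f i x)).
  by move=> x; rewrite big_cons; case: (P i); rewrite ?mul1r.
by apply: analyticM IH; case: (P i); [apply: af|apply: analytic_cst].
Qed.

Lemma analytic_horner (p : {poly R}) : analytic (fun x => p.[x]).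
Proof.
apply: (eq_analytic (f := fun x => \sum_(i < size p) p`_i * x ^+ i)).
  by move=> x; rewrite horner_coef.
by apply: analytic_sum => i; apply: analyticM (analytic_cst _) (analytic_exprn _).
Qed.

Lemma analytic_cvg0 f : analytic f -> f x @[x --> 0] --> f 0.
Proof. by move=> [b]; apply: germ_cvg0. Qed.

Lemma analytic_near0_le f e : analytic f -> f 0 = 0 -> 0 < e ->
  \forall x \near 0, `|f x| <= e.
Proof.
move=> /analytic_cvg0/cvgrPdist_le cf f0 /cf; apply: filterS => x.
by rewrite f0 sub0r normrN.
Qed.

Lemma analytic_near0_norm f : analytic f -> f 0 != 0 ->
  \forall x \near 0, `|f 0| / 2 <= `|f x| <= 2 * `|f 0|.
Proof.
move=> /analytic_cvg0/cvgrPdist_le cf f0; have half0 : 0 < `|f 0| / 2.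
  by rewrite divr_gt0 // normr_gt0.
apply: filterS (cf _ half0) => x fx.
have := ler_normD (f 0 - f x) (f x); rewrite subrK.
have := ler_normB (f 0) (f 0 - f x); rewrite opprB addrCA subrr addr0.
lra.
Qed.

Lemma analytic_divX f m : analytic f ->
  (exists C : R, \forall x \near 0, x != 0 -> `|f x| <= C * `|x| ^+ m) ->
  exists2 g, analytic g & \forall x \near 0, f x = x ^+ m * g x.
Proof.
move=> [b fb] /(germ_coef_eq0 fb) /(germ_divX fb) [g gb fg].
by exists g => //; exists (fun k => b (m + k)%N).
Qed.

Lemma analytic_eq0_or_order f : analytic f -> (\forall x \near 0, f x = 0) \/
  exists m g, [/\ analytic g, g 0 != 0 & \forall x \near 0, f x = x ^+ m * g x].
Proof.
move=> [b fb]; have [b0|/existsNP [k /eqP bk]] := pselect (forall k, b k = 0).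
  by left; apply: germ0_eq0; apply: eq_germ fb.
right; have ex_b : exists k, b k != 0 by exists k.
have [m bm min_m] := ex_minnP ex_b.
have [|g gb fg] := germ_divX (m := m) fb.
  by move=> i im; apply/eqP/negPn/negP => /min_m; rewrite leqNgt im.
exists m, g; split => //; first by exists (fun k => b (m + k)%N).
by rewrite (germ_at0 gb) addn0.
Qed.

Lemma analytic_eq f g : analytic f -> analytic g ->
  (\forall x \near 0, x != 0 -> f x = g x) -> \forall x \near 0, f x = g x.
Proof.
move=> af ag fg; have [b fgb] := analyticB af ag.
have b0 k : b k = 0.
  apply: (germ_coef_eq0 (m := k.+1) fgb) => //; exists 0.
  by apply: filterS fg => x fgx x0; rewrite fgx // subrr normr0 mul0r.
have := germ0_eq0 (eq_germ (frefl _) b0 fgb); apply: filterS => x /eqP.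
by rewrite subr_eq0 => /eqP.
Qed.

Lemma analytic_cancelX_at0 f g m : analytic f -> analytic g ->
  (\forall x \near 0, x ^+ m * f x = x ^+ m * g x) -> f 0 = g 0.
Proof.
move=> af ag xfg; apply: (nbhs_singleton (analytic_eq af ag _)).
by apply: filterS xfg => x xm_eq x0; apply: (mulfI _ xm_eq); apply: expf_neq0.
Qed.

End Germs.

(** * Hensel's lemma for analytic families of polynomials *)

Section QuadraticSystem.
Variables (R : realType) (I : finType).
Variables (l : I -> nat -> R) (beta : I -> I -> I -> R).
Implicit Types (b c : nat -> R) (w u : I -> nat -> R) (d : R).

Lemma conv_series1_small b (eps : R) : conv_series1 b -> b 0%N = 0 -> 0 < eps ->
  \forall d \near 0, 0 <= d -> forall N, \sum_(k < N) `|b k| * d ^+ k <= eps.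
Proof.
move=> [r [r0 [K bK]]] b0 eps0.
have K0 : 0 <= K by apply: le_trans (bK 0%N); rewrite mulr_ge0 // exprn_ge0 // ltW.
have half_r0 : 0 < r / 2 by rewrite divr_gt0.
have small0 : 0 < r * eps / (2 * K + 1) by rewrite divr_gt0 ?mulr_gt0 // ltr_wpDl // mulr_ge0.
apply: filterS2 (near0_lt half_r0) (near0_lt small0) => d d_half d_small d0 [|N].
  by rewrite big_ord0 ltW.
rewrite ger0_norm // in d_half d_small; pose q := d / r.
have q0 : 0 <= q by rewrite divr_ge0 // ltW.
have q_half : q <= 2^-1 by rewrite ler_pdivrMr // mulrC ltW.
have q_eps : 2 * K * q <= eps.
  have : q * (2 * K + 1) <= eps.
    move: d_small; rewrite ltr_pdivlMr; last by rewrite ltr_wpDl // mulr_ge0.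
    by rewrite /q mulrAC ler_pdivrMr // => /ltW; rewrite [eps * r]mulrC.
  by nra.
rewrite big_ord_recl b0 normr0 mul0r add0r.
apply: (@le_trans _ _ (\sum_(k < N) K * q * q ^+ k)); last first.
  rewrite -mulr_sumr; apply: le_trans q_eps; rewrite mulrC -[leRHS]mulrA.
  by apply: ler_wpM2r; [rewrite mulr_ge0|apply: sum_expr_le2; rewrite q0].
apply: ler_sum => k _; rewrite /bump /= -mulrA -exprS.
have -> : d = q * r by rewrite /q divfK // gt_eqF.
by rewrite exprMn mulrCA [leRHS]mulrC ler_wpM2l ?exprn_ge0.
Qed.

Lemma cauchy_prod_norm_le b c d N : 0 <= d ->
  \sum_(k < N) `|cauchy_prod b c k| * d ^+ k <=
  (\sum_(k < N) `|b k| * d ^+ k) * (\sum_(k < N) `|c k| * d ^+ k).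
Proof.
move=> d0; apply: (@le_trans _ _
  (\sum_(k < N) cauchy_prod (fun k => `|b k|) (fun k => `|c k|) k * d ^+ k)).
  apply: ler_sum => k _; rewrite ler_wpM2r ?exprn_ge0 //.
  by apply: le_trans (ler_norm_sum _ _ _) _; apply: ler_sum => i _; rewrite normrM.
rewrite cauchy_prod_psum mulr_suml; apply: ler_sum => i _.
rewrite ler_wpM2l ?mulr_ge0 ?exprn_ge0 //.
rewrite (big_ord_widen _ (fun k => `|c k| * d ^+ k) (leq_subr i N)).
rewrite [leRHS](bigID (fun k : 'I_N => (k < N - i)%N)) /= lerDl.
by apply: sumr_ge0 => k _; rewrite mulr_ge0 ?exprn_ge0.
Qed.

Definition quad_step w i k :=
  l i k + \sum_j \sum_m beta i j m * cauchy_prod (w j) (w m) k.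

Definition quad_iter s : I -> nat -> R := iter s quad_step (fun _ _ => 0).

Definition weighted_norm d N w := \sum_i \sum_(k < N) `|w i k| * d ^+ k.

Definition coupling := \sum_i \sum_j \sum_m `|beta i j m|.

Lemma coupling_ge0 : 0 <= coupling.
Proof. by do 3! apply: sumr_ge0 => ? _. Qed.

Lemma weighted_norm_ge d N w i : 0 <= d ->
  0 <= \sum_(k < N) `|w i k| * d ^+ k <= weighted_norm d N w.
Proof.
move=> d0; have row_ge0 j : 0 <= \sum_(k < N) `|w j k| * d ^+ k.
  by apply: sumr_ge0 => k _; rewrite mulr_ge0 ?exprn_ge0.
by rewrite row_ge0 /weighted_norm (bigD1 i) //= lerDl sumr_ge0.
Qed.

Lemma quad_step_norm_le d N w : 0 <= d ->
  weighted_norm d N (quad_step w) <=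
  weighted_norm d N l + coupling * weighted_norm d N w ^+ 2.
Proof.
move=> d0; rewrite /weighted_norm /coupling mulr_suml -big_split /=; apply: ler_sum => i _.
apply: (@le_trans _ _ (\sum_(k < N) (`|l i k| * d ^+ k +
    \sum_j \sum_m `|beta i j m| * (`|cauchy_prod (w j) (w m) k| * d ^+ k)))).
  apply: ler_sum => k _.
  have -> : \sum_j \sum_m `|beta i j m| * (`|cauchy_prod (w j) (w m) k| * d ^+ k) =
      (\sum_j \sum_m `|beta i j m * cauchy_prod (w j) (w m) k|) * d ^+ k.
    rewrite mulr_suml; apply: eq_bigr => j _; rewrite mulr_suml.
    by apply: eq_bigr => m _; rewrite normrM mulrA.
  rewrite -mulrDl ler_wpM2r ?exprn_ge0 //; apply: le_trans (ler_normD _ _) _.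
  rewrite lerD2l; apply: le_trans (ler_norm_sum _ _ _) _.
  by apply: ler_sum => j _; apply: ler_norm_sum.
rewrite big_split /= lerD2l exchange_big /= mulr_suml; apply: ler_sum => j _.
rewrite exchange_big /= mulr_suml; apply: ler_sum => m _.
rewrite -mulr_sumr ler_wpM2l // (le_trans (cauchy_prod_norm_le _ _ _ d0)) // expr2.
have /andP[wj0 wj] := weighted_norm_ge N w j d0.
have /andP[wm0 wm] := weighted_norm_ge N w m d0.
exact: ler_pM.
Qed.

Lemma quad_iter_norm_le d N kappa s : 0 <= d -> 0 <= kappa -> coupling * kappa <= 2^-1 ->
  weighted_norm d N l <= kappa / 2 -> weighted_norm d N (quad_iter s) <= kappa.
Proof.
move=> d0 kappa0 coupling_kappa l_small; elim: s => [|s IH].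
  rewrite /weighted_norm big1 // => i _; rewrite big1 // => k _.
  by rewrite normr0 mul0r.
have norm_ge0 : 0 <= weighted_norm d N (quad_iter s).
  by apply: sumr_ge0 => i _; have /andP[] := weighted_norm_ge N (quad_iter s) i d0.
have sqr_le : weighted_norm d N (quad_iter s) ^+ 2 <= kappa ^+ 2 by rewrite lerXn2r.
apply: le_trans (quad_step_norm_le _ _ d0) _.
by have := ler_wpM2l coupling_ge0 sqr_le; rewrite expr2; nra.
Qed.

Hypothesis l_at0 : forall i, l i 0%N = 0.

Lemma quad_step_local w w' s : (forall i, w i 0%N = 0) -> (forall i, w' i 0%N = 0) ->
  (forall i k, (k <= s)%N -> w i k = w' i k) ->
  forall i k, (k <= s.+1)%N -> quad_step w i k = quad_step w' i k.
Proof.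
move=> w0 w'0 ww' i k ks; congr (_ + _); apply: eq_bigr => j _; apply: eq_bigr => m _.
congr (_ * _); apply: eq_bigr => a _.
have [->|a0] := posnP a; first by rewrite w0 w'0 !mul0r.
have [->|ka] := posnP (k - a)%N; first by rewrite w0 w'0 !mulr0.
by rewrite !ww' //; lia.
Qed.

Lemma quad_iter_at0 s i : quad_iter s i 0%N = 0.
Proof.
elim: s i => [|s IH] i //=; rewrite /quad_step l_at0 add0r big1 // => j _.
by rewrite big1 // => m _; rewrite /cauchy_prod big_ord1 IH mul0r mulr0.
Qed.

Lemma quad_iter_stable s s' i k : (k <= s)%N -> (s <= s')%N ->
  quad_iter s' i k = quad_iter s i k.
Proof.
have stableS t j m : (m <= t)%N -> quad_iter t.+1 j m = quad_iter t j m.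
  elim: t j m => [|t IH] j m mt.
    by move: mt; rewrite leqn0 => /eqP ->; rewrite !quad_iter_at0.
  exact: (quad_step_local (quad_iter_at0 t.+1) (quad_iter_at0 t) IH).
move=> ks; elim: s' => [|s' IH]; first by rewrite leqn0 => /eqP ->.
rewrite leq_eqVlt => /predU1P[-> //|]; rewrite ltnS => ss'.
by rewrite stableS ?IH // (leq_trans ks).
Qed.

Hypothesis l_conv : forall i, conv_series1 (l i).

Lemma quad_iter_conv i : conv_series1 (fun k => quad_iter k i k).
Proof.
pose kappa : R := (2 * (coupling + 1))^-1.
have coupling_nneg := coupling_ge0.
have kappa0 : 0 < kappa by rewrite invr_gt0 mulr_gt0 // ltr_wpDl.
have coupling_kappa : coupling * kappa <= 2^-1.
  by rewrite /kappa ler_pdivrMr ?mulr_gt0 ?ltr_wpDl //; lra.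
have l_small : \forall d \near (0 : R), forall j, 0 <= d ->
    forall N, \sum_(k < N) `|l j k| * d ^+ k <= kappa / 2 / #|I|.+1%:R.
  apply: near0_forall => j; apply: conv_series1_small => //.
  by rewrite !divr_gt0.
have [d d0 [l_d _]] := near0_ex_sym l_small.
have l_norm N : weighted_norm d N l <= kappa / 2.
  apply: (@le_trans _ _ (\sum_(j : I) kappa / 2 / #|I|.+1%:R)).
    by apply: ler_sum => j _; apply: l_d; apply: ltW.
  rewrite sumr_const -[leLHS]mulr_natr mulrAC ler_pdivrMr //.
  by rewrite ler_wpM2l ?divr_ge0 ?(ltW kappa0) // ler_nat.
exists d; split => //; exists kappa => k.
apply: le_trans (quad_iter_norm_le k (ltW d0) (ltW kappa0) coupling_kappa (l_norm k.+1)).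
have /andP[_] := weighted_norm_ge k.+1 (quad_iter k) i (ltW d0); apply: le_trans.
rewrite big_ord_recr /= lerDr; apply: sumr_ge0 => a _.
by rewrite mulr_ge0 // exprn_ge0 // ltW.
Qed.

Lemma quadratic_system_series : exists w : I -> nat -> R,
  [/\ forall i, w i 0%N = 0, forall i, conv_series1 (w i) &
  forall i k, w i k = l i k + \sum_j \sum_m beta i j m * cauchy_prod (w j) (w m) k].
Proof.
exists (fun i k => quad_iter k i k); split=> [i|i|i k].
- exact: quad_iter_at0.
- exact: quad_iter_conv.
rewrite -(quad_iter_stable i (leqnn k) (leqnSn k)) /= /quad_step; congr (_ + _).
apply: eq_bigr => j _; apply: eq_bigr => m _; congr (_ * _).
apply: eq_bigr => a _; have ak := ltn_ord a.
by rewrite (@quad_iter_stable a k) ?(@quad_iter_stable (k - a) k) ?leq_subr.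
Qed.

End QuadraticSystem.

Lemma quadratic_system (R : realType) (I : finType) (l : I -> R -> R) (beta : I -> I -> I -> R) :
  (forall i, analytic (l i)) -> (forall i, l i 0 = 0) ->
  exists w : I -> R -> R, [/\ forall i, analytic (w i), forall i, w i 0 = 0 &
  \forall x \near 0, forall i,
    w i x = l i x + \sum_j \sum_m beta i j m * (w j x * w m x)].
Proof.
move=> /boolp.choice [b lb] l0.
have b0 i : b i 0%N = 0 by rewrite -(germ_at0 (lb i)).
have [w [w0 w_conv w_eq]] := quadratic_system_series beta b0 (fun i => germ_conv_series1 (lb i)).
have w_germ i := germ_eval_series1 (w_conv i).
exists (fun i => eval_series1 (w i)); split=> [i|i|].
- by exists (w i).
- by rewrite (germ_at0 (w_germ i)).
apply: near0_forall => i; apply: germ_uniq (w_germ i) _.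
apply: eq_germ (germD (lb i) (germ_sum _ (fun j => germ_sum _ (fun m =>
    germZ (beta i j m) (germM (w_germ j) (w_germ m)))))).
- by [].
- by move=> k; rewrite w_eq.
Qed.

Section AnalyticPolynomials.
Variable R : realType.
Implicit Types (f : R -> R) (p q : R -> {poly R}).

Definition analytic_poly p := forall i, analytic (fun x => (p x)`_i).

Lemma analytic_poly_near p q : (\forall x \near 0, p x = q x) ->
  analytic_poly p -> analytic_poly q.
Proof. by move=> pq ap i; apply: analytic_near (ap i); apply: filterS pq => x ->. Qed.

Lemma eq_analytic_poly p q : p =1 q -> analytic_poly p -> analytic_poly q.
Proof. by move=> /funext ->. Qed.

Lemma analytic_poly_cst (s : {poly R}) : analytic_poly (fun=> s).
Proof. by move=> i; apply: analytic_cst. Qed.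

Lemma analytic_polyD p q : analytic_poly p -> analytic_poly q ->
  analytic_poly (fun x => p x + q x).
Proof.
by move=> ap aq i; apply: eq_analytic (analyticD (ap i) (aq i)) => x; rewrite coefD.
Qed.

Lemma analytic_polyB p q : analytic_poly p -> analytic_poly q ->
  analytic_poly (fun x => p x - q x).
Proof.
by move=> ap aq i; apply: eq_analytic (analyticB (ap i) (aq i)) => x; rewrite coefB.
Qed.

Lemma analytic_polyM p q : analytic_poly p -> analytic_poly q ->
  analytic_poly (fun x => p x * q x).
Proof.
move=> ap aq i; apply: eq_analytic (analytic_sum (index_enum _)
  (fun j : 'I_i.+1 => analyticM (ap j) (aq (i - j)%N))) => x.
by rewrite coefM.
Qed.

Lemma analytic_polyC f : analytic f -> analytic_poly (fun x => (f x)%:P).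
Proof.
by move=> af [|i]; [apply: eq_analytic af|apply: eq_analytic (analytic_cst 0)] => x;
  rewrite coefC.
Qed.

Lemma analytic_polyZ f (s : {poly R}) : analytic f -> analytic_poly (fun x => f x *: s).
Proof.
move=> af; apply: eq_analytic_poly (analytic_polyM (analytic_polyC af) (analytic_poly_cst s)).
by move=> x; rewrite mul_polyC.
Qed.

Lemma analytic_poly_sum (I : Type) (s : seq I) (p : I -> R -> {poly R}) :
  (forall i, analytic_poly (p i)) -> analytic_poly (fun x => \sum_(i <- s) p i x).
Proof.
move=> ap k; apply: eq_analytic (analytic_sum s (fun i => ap i k)) => x.
by rewrite coef_sum.
Qed.

Lemma analytic_polyX p n : analytic_poly p -> analytic_poly (fun x => p x ^+ n).
Proof.
move=> ap; elim: n => [|n IH]; first exact: analytic_poly_cst.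
by apply: eq_analytic_poly (analytic_polyM ap IH) => x; rewrite exprS.
Qed.

Lemma linear_poly_expand (S : {linear {poly R} -> {poly R}}) (s : {poly R}) n :
  (size s <= n)%N -> S s = \sum_(j < n) s`_j *: S 'X^j.
Proof.
move=> sn; rewrite -[in LHS](take_poly_id sn) /take_poly poly_def linear_sum.
by apply: eq_bigr => j _; rewrite linearZ.
Qed.

Lemma analytic_poly_linear (S : {linear {poly R} -> {poly R}}) p n : analytic_poly p ->
  (\forall x \near 0, (size (p x) <= n)%N) -> analytic_poly (fun x => S (p x)).
Proof.
move=> ap pn; apply: (analytic_poly_near (p := fun x => \sum_(j < n) (p x)`_j *: S 'X^j)).
  by apply: filterS pn => x px; rewrite -linear_poly_expand.
by apply: analytic_poly_sum => j; apply: analytic_polyZ.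
Qed.

End AnalyticPolynomials.

Lemma size_sub_monic (R : nzRingType) (f g : {poly R}) d : f \is monic -> g \is monic ->
  size f = d.+1 -> size g = d.+1 -> (size (f - g)%R <= d)%N.
Proof.
move=> /monicP; rewrite lead_coefE => f_lead /monicP; rewrite lead_coefE => g_lead sf sg.
apply/leq_sizeP => j; rewrite leq_eqVlt => /predU1P[<-|dj].
  by rewrite coefB; move: f_lead g_lead; rewrite sf sg /= => -> ->; rewrite subrr.
by rewrite coefB !nth_default ?sf ?sg // subrr.
Qed.

Section Hensel.
Variable R : realType.

Lemma bezout_linear (F : fieldType) (u v : {poly F}) du dv :
  size u = du.+1 -> size v = dv.+1 -> coprimep u v ->
  exists S T : {linear {poly F} -> {poly F}}, forall D : {poly F}, (size D <= du + dv)%N ->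
  [/\ (size (S D) <= du)%N, (size (T D) <= dv)%N & S D * v + T D * u = D].
Proof.
move=> su sv /Bezout_eq1_coprimepP [[s1 s2] /= bezout].
have u0 : u != 0 by rewrite -size_poly_eq0 su.
pose s D := (D * s2) %% u; pose t D := D * s1 + ((D * s2) %/ u) * v.
have s_lin : linear s by move=> a D1 D2; rewrite /s mulrDl -scalerAl modpD modpZl.
have t_lin : linear t.
  by move=> a D1 D2; rewrite /t !mulrDl -!scalerAl divpD divpZl mulrDl -scalerAl scalerDr addrACA.
pose S : {linear {poly F} -> {poly F}} := HB.pack s (GRing.isLinear.Build _ _ _ _ s s_lin).
pose T : {linear {poly F} -> {poly F}} := HB.pack t (GRing.isLinear.Build _ _ _ _ t t_lin).
exists S, T => D sD; have sS : (size (s D) <= du)%N by rewrite -ltnS -su ltn_modp.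
have ST : s D * v + t D * u = D.
  transitivity (((D * s2) %/ u * u + (D * s2) %% u) * v + D * s1 * u).
    by rewrite /s /t; ring.
  by rewrite -divp_eq -[RHS]mulr1 -bezout; ring.
split=> //; rewrite -[T D]/(t D); have : (size (t D * u)%R <= du + dv)%N.
  have -> : t D * u = D - s D * v by rewrite -[X in _ = X - _]ST addrAC subrr add0r.
  apply: leq_trans (size_polyD _ _) _; rewrite size_polyN geq_max sD /=.
  by apply: leq_trans (size_polyMleq _ _) _; rewrite sv addnS /= leq_add2r.
have [->|tD0] := eqVneq (t D) 0; first by rewrite size_poly0.
by rewrite size_mul // su addnS /= addnC leq_add2l.
Qed.

(* The coefficients of U and V solve a quadratic system. *)
Lemma analytic_quadratic_polys (E : R -> {poly R}) (S T : {linear {poly R} -> {poly R}}) n du dv :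
  analytic_poly E -> (\forall x \near 0, (size (E x) <= n)%N) -> E 0 = 0 ->
  exists U V : R -> {poly R}, [/\ analytic_poly U, analytic_poly V,
    forall x, (size (U x) <= du)%N /\ (size (V x) <= dv)%N &
    \forall x \near 0,
      (forall i, (i < du)%N -> (U x)`_i = (S (E x - U x * V x))`_i) /\
      (forall i, (i < dv)%N -> (V x)`_i = (T (E x - U x * V x))`_i)].
Proof.
move=> aE sE E0; pose I := ('I_du + 'I_dv)%type.
pose phi (k : I) D := match k with inl i => (S D)`_i | inr i => (T D)`_i end.
have phiB k D1 D2 : phi k (D1 - D2) = phi k D1 - phi k D2.
  by case: k => i /=; rewrite linearB coefB.
have phi_sum k (J : finType) (F : J -> {poly R}) : phi k (\sum_j F j) = \sum_j phi k (F j).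
  by case: k => i /=; rewrite linear_sum coef_sum.
have phiZ k a D : phi k (a *: D) = a * phi k D by case: k => i /=; rewrite linearZ coefZ.
pose beta (k a b : I) : R :=
  if (a, b) is (inl i, inr j) then - phi k 'X^(i + j) else 0.
have [||w [aw _ w_eq]] := @quadratic_system R I (fun k x => phi k (E x)) beta.
- by case=> i; apply: (analytic_poly_linear _ aE sE).
- by case=> i /=; rewrite E0 linear0 coef0.
pose U x := \sum_(i < du) w (inl i) x *: 'X^i.
pose V x := \sum_(i < dv) w (inr i) x *: 'X^i.
have coef_monomials m (a : 'I_m -> R) (i : 'I_m) : (\sum_(j < m) a j *: 'X^j)`_i = a i.
  by rewrite coef_sumMXn (eq_bigl (pred1 i)) ?big_pred1_eq.
have size_monomials m (a : 'I_m -> R) : (size (\sum_(j < m) a j *: 'X^j)%R <= m)%N.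
  apply: leq_trans (size_sum _ _ _) _; apply/bigmax_leqP => j _.
  by apply: leq_trans (size_scale_leq _ _) _; rewrite size_polyXn.
exists U, V; split.
- by apply: analytic_poly_sum => i; apply: analytic_polyZ.
- by apply: analytic_poly_sum => i; apply: analytic_polyZ.
- by split; apply: size_monomials.
apply: filterS w_eq => x w_eq.
have w_phi k : w k x = phi k (E x - U x * V x).
  rewrite w_eq phiB /U mulr_suml phi_sum -sumrN big_sumType /=; congr (_ + _).
  rewrite [X in _ + X = _]big1 ?addr0 => [|j _]; last by rewrite big1 // => m _; rewrite mul0r.
  apply: eq_bigr => i _; rewrite big_sumType /= big1 ?add0r => [|m _]; last by rewrite mul0r.
  rewrite /V mulr_sumr phi_sum -sumrN; apply: eq_bigr => j _.
  by rewrite /beta exprD -[in RHS]scalerAl -[in RHS]scalerAr scalerA [in RHS]phiZ mulNr mulrC.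
split=> i i_lt.
  by rewrite (coef_monomials _ (fun j => w (inl j) x) (Ordinal i_lt)) w_phi.
by rewrite (coef_monomials _ (fun j => w (inr j) x) (Ordinal i_lt)) w_phi.
Qed.

Lemma hensel (p : R -> {poly R}) (u0 v0 : {poly R}) du dv : analytic_poly p ->
  (\forall x \near 0, p x \is monic /\ size (p x) = (du + dv).+1) ->
  u0 \is monic -> v0 \is monic -> size u0 = du.+1 -> size v0 = dv.+1 ->
  coprimep u0 v0 -> p 0 = u0 * v0 ->
  exists u v : R -> {poly R}, [/\ analytic_poly u, analytic_poly v &
   \forall x \near 0, [/\ p x = u x * v x,
     u x \is monic /\ size (u x) = du.+1 & v x \is monic /\ size (v x) = dv.+1]].
Proof.
move=> ap p_monic mu mv su sv coprime_uv p0.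
have [S [T ST]] := bezout_linear su sv coprime_uv.
pose E x := p x - u0 * v0.
have aE : analytic_poly E := analytic_polyB ap (analytic_poly_cst _).
have sE : \forall x \near 0, (size (E x) <= du + dv)%N.
  apply: filterS p_monic => x [mp sp]; apply: size_sub_monic => //; first by rewrite monicMl.
  by rewrite size_mul ?monic_neq0 // su sv addSn addnS.
have E0 : E 0 = 0 by rewrite /E p0 subrr.
have [U [V [aU aV sUV UV_eq]]] := analytic_quadratic_polys S T du dv aE sE E0.
exists (fun x => u0 + U x), (fun x => v0 + V x).
split; [exact: analytic_polyD (analytic_poly_cst _) aU|
        exact: analytic_polyD (analytic_poly_cst _) aV|].
have monicDl (f h : {poly R}) d : f \is monic -> size f = d.+1 -> (size h <= d)%N ->
    f + h \is monic /\ size (f + h) = d.+1.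
  move=> mf sf sh; have hf : (size h < size f)%N by rewrite sf ltnS.
  by rewrite monicE lead_coefDl // size_polyDl // -monicE.
apply: filterS2 sE UV_eq => x sEx [U_eq V_eq]; have [sU sV] := sUV x.
split; [|exact: monicDl|exact: monicDl].
pose D := E x - U x * V x; have sD : (size D <= du + dv)%N.
  apply: leq_trans (size_polyD _ _) _; rewrite size_polyN geq_max sEx /=.
  by apply: leq_trans (size_polyMleq _ _) _; apply: leq_trans (leq_pred _) (leq_add sU sV).
have [sS sT bezoutD] := ST D sD.
have US : U x = S D.
  apply/polyP => i; have [/U_eq //|i_ge] := ltnP i du.
  by rewrite !nth_default ?(leq_trans _ i_ge).
have VT : V x = T D.
  apply/polyP => i; have [/V_eq //|i_ge] := ltnP i dv.
  by rewrite !nth_default ?(leq_trans _ i_ge).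
have -> : (u0 + U x) * (v0 + V x) = u0 * v0 + (U x * v0 + V x * u0) + U x * V x by ring.
by rewrite {1}US {1}VT bezoutD /D /E; ring.
Qed.

End Hensel.

(** * The complex modulus *)

Section ComplexModulus.
Variable R : realType.
Local Notation C := R[i].
Local Notation toC := (real_complex R).
Implicit Types z w : C.

Lemma eq_ReIm z w : complex.Re z = complex.Re w -> complex.Im z = complex.Im w -> z = w.
Proof. by case: z => a b; case: w => c d /= -> ->. Qed.

Lemma sqnormCM z w : sqnormC (z * w) = sqnormC z * sqnormC w.
Proof. by case: z => a b; case: w => c d; rewrite /sqnormC /=; ring. Qed.

Lemma sqnormC_prod (I : Type) (s : seq I) (P : pred I) (f : I -> C) :
  sqnormC (\prod_(i <- s | P i) f i) = \prod_(i <- s | P i) sqnormC (f i).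
Proof. by apply: (big_morph _ sqnormCM); rewrite /sqnormC /=; ring. Qed.

Lemma sqnormC_ge0 z : 0 <= sqnormC z.
Proof. by rewrite addr_ge0 ?sqr_ge0. Qed.

Lemma sqnormC_eq0 z : (sqnormC z == 0) = (z == 0).
Proof. by case: z => a b; rewrite /sqnormC paddr_eq0 ?sqr_ge0 // !sqrf_eq0 eq_complex. Qed.

Lemma sqnormC_gt0 z : (0 < sqnormC z) = (z != 0).
Proof. by rewrite lt_def sqnormC_ge0 sqnormC_eq0 andbT. Qed.

Lemma sqnormC_real (x : R) : sqnormC (toC x) = x ^+ 2.
Proof. by rewrite /sqnormC /= expr0n addr0. Qed.

Lemma sqr_normc z : normc z ^+ 2 = sqnormC z.
Proof. by case: z => a b; rewrite /normc /sqnormC /= sqr_sqrtr // addr_ge0 ?sqr_ge0. Qed.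

Lemma sqnormCV z : sqnormC z^-1 = (sqnormC z)^-1.
Proof. by rewrite -!sqr_normc normcV exprVn. Qed.

Lemma normc_ge0 z : 0 <= normc z.
Proof. by case: z => a b; apply: sqrtr_ge0. Qed.

Lemma normc_gt0 z : (0 < normc z) = (z != 0).
Proof.
rewrite lt_def normc_ge0 andbT; congr negb.
by apply/eqP/eqP => [/eq0_normc //|->]; apply: normc0.
Qed.

Lemma normc_real (x : R) : normc (toC x) = `|x|.
Proof. by rewrite /normc /= expr0n addr0 sqrtr_sqr. Qed.

Lemma normc_conj z : normc (conjc z) = normc z.
Proof. by case: z => a b /=; rewrite sqrrN. Qed.

Lemma ler_normcB z w : normc (z - w) <= normc z + normc w.
Proof. by apply: le_trans (le_normcD _ _) _; rewrite normcN. Qed.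

Lemma ler_normc_add_dist z w : normc z <= normc w + normc (z - w).
Proof. by have := le_normcD w (z - w); rewrite addrC subrK. Qed.

Lemma normcX z n : normc (z ^+ n) = normc z ^+ n.
Proof. by elim: n => [|n IH]; [apply: normc1|rewrite !exprS normcM IH]. Qed.

Lemma ler_normc_sum (I : Type) (s : seq I) (P : pred I) (f : I -> C) :
  normc (\sum_(i <- s | P i) f i) <= \sum_(i <- s | P i) normc (f i).
Proof.
elim/big_rec2: _ => [|i y1 y2 _ IH]; first by rewrite normc0.
by apply: le_trans (le_normcD _ _) _; rewrite lerD2l.
Qed.

Lemma normc_prod (I : Type) (s : seq I) (P : pred I) (f : I -> C) :
  normc (\prod_(i <- s | P i) f i) = \prod_(i <- s | P i) normc (f i).
Proof. exact: (big_morph _ (@normcM R) (normc1 R)). Qed.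

Lemma ler_Re_normc z : `|complex.Re z| <= normc z.
Proof. by case: z => a b /=; rewrite -sqrtr_sqr ler_sqrt ?addr_ge0 ?sqr_ge0 // lerDl sqr_ge0. Qed.

Lemma ler_Im_normc z : `|complex.Im z| <= normc z.
Proof. by case: z => a b /=; rewrite -sqrtr_sqr ler_sqrt ?addr_ge0 ?sqr_ge0 // lerDr sqr_ge0. Qed.

Lemma ler_normc_ReIm z : normc z <= `|complex.Re z| + `|complex.Im z|.
Proof.
rewrite -ler_sqr ?nnegrE ?addr_ge0 ?normc_ge0 // sqr_normc /sqnormC.
rewrite -(real_normK (num_real (complex.Re z))) -(real_normK (num_real (complex.Im z))).
have := normr_ge0 (complex.Re z); have := normr_ge0 (complex.Im z); nra.
Qed.

End ComplexModulus.

(** * Analytic splitting of families of hyperbolic polynomials *)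

Section HyperbolicPolynomials.
Variable R : realType.
Local Notation C := R[i].
Local Notation toC := (real_complex R).
Implicit Types (s : seq R) (z : C) (n : nat).

Definition hyperbolic (p : {poly R}) :=
  forall z : C, root (map_poly toC p) z -> complex.Im z = 0.

Definition monic_hyperbolic n (p : {poly R}) :=
  [/\ p \is monic, size p = n.+1 & hyperbolic p].

Lemma hyperbolicM (p q : {poly R}) : hyperbolic (p * q) -> hyperbolic p /\ hyperbolic q.
Proof. by move=> hpq; split=> z rz; apply: hpq; rewrite rmorphM rootM rz ?orbT. Qed.

Lemma monic_hyperbolic_roots n (p : {poly R}) : monic_hyperbolic n p ->
  exists2 s, size s = n & p = \prod_(a <- s) ('X - a%:P).
Proof.
move=> [mp sp hp]; have [s factors] := closed_field_poly_normal (map_poly toC p).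
rewrite lead_coef_map (monicP mp) rmorph1 scale1r in factors.
have real_root z : z \in s -> z = toC (complex.Re z).
  move=> zs; have := hp z; rewrite factors root_prod_XsubC => /(_ zs).
  by case: z {zs} => a b /= ->.
have pE : p = \prod_(a <- map (@complex.Re R) s) ('X - a%:P).
  apply: (map_poly_inj toC); rewrite factors rmorph_prod big_map.
  apply: eq_big_seq => z zs; rewrite {1}(real_root z zs) rmorphB /= map_polyX map_polyC //.
exists (map (@complex.Re R) s) => //.
by move: sp; rewrite pE size_prod_XsubC => -[].
Qed.

Lemma sqnormC_prod_XsubC_ge s z : complex.Im z ^+ 2 ^+ size s <=
  sqnormC (map_poly toC (\prod_(a <- s) ('X - a%:P))).[z].
Proof.
rewrite rmorph_prod horner_prod sqnormC_prod; elim: s => [|a s IH]; first by rewrite big_nil.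
rewrite big_cons /= [leLHS]exprS; apply: ler_pM => //.
- exact: sqr_ge0.
- by rewrite exprn_ge0 // sqr_ge0.
rewrite rmorphB /= map_polyX map_polyC hornerXsubC.
by case: z {IH} => u v; rewrite /sqnormC /= oppr0 addr0 lerDr sqr_ge0.
Qed.

Lemma coef_prod_XsubC_le s (rho : R) k : (k <= size s)%N ->
  (forall a, a \in s -> `|a| <= rho) ->
  `|(\prod_(a <- s) ('X - a%:P))`_k| <= 2 ^+ size s * rho ^+ (size s - k).
Proof.
move=> ks s_rho; rewrite coef_prod_XsubC // normrM normrX normrN1 expr1n mul1r.
apply: le_trans (ler_norm_sum _ _ _) _; set m := (size s - k)%N.
apply: (@le_trans _ _ (\sum_(J : {set 'I_(size s)} | #|J| == m) rho ^+ m)).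
  apply: ler_sum => J /eqP <-; rewrite normr_prod -prodr_const.
  by apply: ler_prod => i _; rewrite normr_ge0 /= s_rho // mem_nth.
have rho_m : 0 <= rho ^+ m.
  have [m0|m_gt0] := posnP m; first by rewrite m0.
  have s_gt0 : (0 < size s)%N by rewrite (leq_trans m_gt0) // leq_subr.
  by rewrite exprn_ge0 // (le_trans (normr_ge0 (nth 0 s 0))) // s_rho // mem_nth.
rewrite sumr_const -[leLHS]mulr_natl ler_wpM2r // -natrX ler_nat.
by rewrite (leq_trans (max_card _)) // -cardsT -powersetT card_powerset cardsT card_ord.
Qed.

Lemma coef_prod_XsubC_scale (I : Type) (s : seq I) (F : I -> R) (lam : R) k : (k <= size s)%N ->
  (\prod_(i <- s) ('X - (lam * F i)%:P))`_k =
  lam ^+ (size s - k) * (\prod_(i <- s) ('X - (F i)%:P))`_k.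
Proof.
move=> ks; rewrite -(big_map (fun i => lam * F i) predT (fun b => 'X - b%:P)).
rewrite -(big_map F predT (fun b => 'X - b%:P)) !coef_prod_XsubC ?size_map //.
rewrite mulrCA; congr (_ * _); rewrite mulr_sumr.
apply: eq_bigr => J /eqP <-; rewrite -prodr_const -big_split /=.
by apply: eq_bigr => i _; rewrite (map_comp ( *%R lam) F) (nth_map 0) ?size_map.
Qed.

(* Newton's identity for the second power sum; multiplying by 'X^2 gives all
   three leading coefficients a meaning whatever the degree. *)
Lemma newton_sum_sqr s : let q := 'X^2 * \prod_(a <- s) ('X - a%:P) in
  \sum_(a <- s) a ^+ 2 = q`_(size s).+1 ^+ 2 - 2 * q`_(size s) /\
  \sum_(a <- s) a = - q`_(size s).+1.
Proof.
have coefM_XsubC (q : {poly R}) a k :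
    (('X - a%:P) * q)`_k = (if k is k'.+1 then q`_k' else 0) - a * q`_k.
  by rewrite mulrBl coefB coefCM coefXM; case: k.
have lead_coef_eq1 (s' : seq R) : ('X^2 * \prod_(a <- s') ('X - a%:P))`_(size s').+2 = 1.
  rewrite coefXnM /= !subSS subn0; have := monic_prod_XsubC s' predT id.
  by move/monicP; rewrite lead_coefE size_prod_XsubC.
elim: s => [|a s [IH1 IH2]] /=; first by rewrite !big_nil mulr1 !coefXn /=; split; ring.
rewrite !big_cons mulrCA IH1 IH2 !coefM_XsubC lead_coef_eq1 /=.
by split; ring.
Qed.

Lemma coprimep_prod_XsubC_filter s (c : R) :
  coprimep (\prod_(a <- s | a == c) ('X - a%:P)) (\prod_(a <- s | a != c) ('X - a%:P)).
Proof.
set v := \prod_(a <- s | a != c) _.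
apply: (big_ind (fun u => coprimep u v)); first exact: coprime1p.
  by move=> u w; rewrite coprimepMl => -> ->.
move=> a /eqP ->; rewrite coprimep_sym coprimep_XsubC /v -big_filter root_prod_XsubC.
by rewrite mem_filter eqxx.
Qed.

End HyperbolicPolynomials.

Section HyperbolicFamilies.
Variable R : realType.
Local Notation C := R[i].
Local Notation toC := (real_complex R).
Implicit Types (p : R -> {poly R}) (c f g : R -> R) (n m r : nat).

Definition hyperbolic_family n p :=
  analytic_poly p /\ \forall x \near 0, monic_hyperbolic n (p x).

Definition splits_analytically n p := exists a : 'I_n -> R -> R,
  (forall i, analytic (a i)) /\ \forall x \near 0, p x = \prod_i ('X - (a i x)%:P).

Lemma analytic_ge_at0 f (c : R) : analytic f ->
  (\forall x \near 0, x != 0 -> c <= f x) -> c <= f 0.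
Proof.
move=> /analytic_cvg0/cvgrPdist_lt cf c_le; rewrite leNgt; apply/negP => f0.
have /cf f_near : 0 < c - f 0 by rewrite subr_gt0.
have [x x0 [[fx c_le_fx] _]] := near0_ex_sym (filterI f_near c_le).
have := c_le_fx (lt0r_neq0 x0).
by move: fx; rewrite ltr_norml => /andP[]; lra.
Qed.

Lemma monic_hyperbolic_at0 n p : analytic_poly p ->
  (\forall x \near 0, x != 0 -> monic_hyperbolic n (p x)) ->
  size (p 0) = n.+1 -> hyperbolic (p 0).
Proof.
move=> ap hp s0 z rz; apply/eqP/negPn/negP => Im_z.
pose g x := sqnormC (\sum_(k < n.+1) toC (p x)`_k * z ^+ k).
have ag : analytic g.
  apply: (eq_analytic (f := fun x => (\sum_(k < n.+1) (p x)`_k * complex.Re (z ^+ k)) ^+ 2 +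
                                     (\sum_(k < n.+1) (p x)`_k * complex.Im (z ^+ k)) ^+ 2)).
    move=> x; rewrite /g /sqnormC !raddf_sum /=; congr (_ ^+ 2 + _ ^+ 2);
    by apply: eq_bigr => k _; case: (z ^+ k) => u v /=; ring.
  by apply: analyticD; apply: analyticX; apply: analytic_sum => k;
    apply: analyticM (analytic_cst _).
have gE x : size (p x) = n.+1 -> g x = sqnormC (map_poly toC (p x)).[z].
  move=> sx; rewrite /g horner_coef size_map_poly sx; congr sqnormC.
  by apply: eq_bigr => k _; rewrite coef_map.
have : complex.Im z ^+ 2 ^+ n <= g 0.
  apply: analytic_ge_at0 => //; apply: filterS hp => x hpx x0.
  have [_ sx _] := hpx x0; have [s <- E] := monic_hyperbolic_roots (hpx x0).
  by rewrite gE // E sqnormC_prod_XsubC_ge.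
rewrite gE // (rootP rz) /sqnormC /= expr0n /= addr0 leNgt.
by rewrite exprn_gt0 // exprn_even_gt0.
Qed.

Lemma splits_analytically_shift n p c : analytic c ->
  splits_analytically n (fun x => p x \Po ('X + (c x)%:P)) -> splits_analytically n p.
Proof.
move=> ac [a [aa factors]]; exists (fun i x => a i x + c x); split=> [i|].
  exact: analyticD.
apply: filterS factors => x factors.
have -> : p x = (p x \Po ('X + (c x)%:P)) \Po ('X - (c x)%:P).
  by rewrite -comp_polyA comp_polyD comp_polyX comp_polyC subrK comp_polyXr.
rewrite factors rmorph_prod /=; apply: eq_bigr => i _.
by rewrite comp_polyB comp_polyX comp_polyC polyCD opprD addrA addrAC.
Qed.

Lemma hyperbolic_family_shift n p c : analytic c ->
  hyperbolic_family n p -> hyperbolic_family n (fun x => p x \Po ('X + (c x)%:P)).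
Proof.
move=> ac [ap hp]; split.
  apply: (analytic_poly_near (p := fun x => \sum_(i < n.+1) ((p x)`_i)%:P * ('X + (c x)%:P) ^+ i)).
    apply: filterS hp => x [_ sx _]; rewrite comp_polyE sx; apply: eq_bigr => i _.
    by rewrite mul_polyC.
  apply: analytic_poly_sum => i; apply: analytic_polyM; first exact: analytic_polyC.
  by apply: analytic_polyX; apply: analytic_polyD (analytic_poly_cst _) (analytic_polyC ac).
apply: filterS hp => x [mx sx hx]; split.
- by rewrite monicE lead_coef_comp ?size_XaddC // lead_coefXaddC expr1n mulr1 -monicE.
- by rewrite size_comp_poly2 ?size_XaddC.
move=> z; rewrite map_comp_poly /= rmorphD /= map_polyX map_polyC /= root_comp => /hx.
by rewrite hornerD hornerX hornerC; case: z => u v /=; rewrite addr0.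
Qed.

(* For a monic polynomial of degree [n], the roots sum up to 0. *)
Definition centered n (q : {poly R}) := ('X^2 * q)`_n.+1 = 0.

Lemma centered_shift n (q : {poly R}) : (0 < n)%N -> monic_hyperbolic n q ->
  centered n (q \Po ('X + (- q`_n.-1 / n%:R)%:P)).
Proof.
move=> n0 /monic_hyperbolic_roots [s sn qE]; set c := - _ / _.
have nN : n%:R != 0 :> R by rewrite pnatr_eq0 -lt0n.
have sum_s : \sum_(a <- s) a = - q`_n.-1.
  by rewrite qE -sn coefPn_prod_XsubC ?opprK // sn -lt0n.
pose s' := [seq a - c | a <- s].
have -> : q \Po ('X + c%:P) = \prod_(a <- s') ('X - a%:P).
  rewrite qE rmorph_prod big_map; apply: eq_bigr => a _ /=.
  by rewrite comp_polyB comp_polyX comp_polyC polyCB opprB addrA.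
have [_] := newton_sum_sqr s'; rewrite size_map sn => sum_s'.
apply/eqP; rewrite -oppr_eq0 -sum_s' big_map sumrB big_const_seq count_predT sn iter_addr_0.
by rewrite sum_s -mulr_natr /c divfK // subrr.
Qed.

Lemma centered_roots n (q : {poly R}) : monic_hyperbolic n q -> centered n q ->
  exists s : seq R, [/\ size s = n, q = \prod_(a <- s) ('X - a%:P),
    \sum_(a <- s) a = 0 & \sum_(a <- s) a ^+ 2 = -2 * ('X^2 * q)`_n].
Proof.
move=> /monic_hyperbolic_roots [s sn qE]; rewrite /centered => center.
have [] := newton_sum_sqr s; rewrite -qE sn center oppr0 => sum_sqr sum0.
by exists s; split=> //; rewrite sum_sqr; ring.
Qed.

Lemma splits_analytically_nilpotent n p : hyperbolic_family n p ->
  (\forall x \near 0, centered n (p x)) -> (\forall x \near 0, ('X^2 * p x)`_n = 0) ->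
  splits_analytically n p.
Proof.
move=> [_ hp] center sum_sqr0; exists (fun _ _ => 0); split; first by move=> i; apply: analytic_cst.
apply: filterS3 hp center sum_sqr0 => x hpx /(centered_roots hpx) [s [sn -> _]] /[swap] ->.
rewrite mulr0 => /eqP; rewrite psumr_eq0 => [/allP s0|a _]; last exact: sqr_ge0.
transitivity (\prod_(a <- s) ('X - 0%:P : {poly R})).
  by apply: eq_big_seq => a /s0; rewrite /= sqrf_eq0 => /eqP ->.
by rewrite big_const_seq count_predT sn big_const card_ord.
Qed.

Section CenteredFamily.
Variables (n m : nat) (p : R -> {poly R}) (g : R -> R).
Hypothesis hp : hyperbolic_family n p.
Hypothesis center : \forall x \near 0, centered n (p x).
Hypothesis ag : analytic g.
Hypothesis g0 : g 0 != 0.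
Hypothesis sum_sqrE : \forall x \near 0, ('X^2 * p x)`_n = x ^+ m * g x.

Lemma centered_order_even : ~~ odd m.
Proof.
have [_ hp0] := hp; apply/negP => m_odd.
have /analytic_cvg0/cvgrPdist_lt cg := ag.
have half_g0 : 0 < `|g 0| / 2 by rewrite divr_gt0 // normr_gt0.
have sign : \forall x \near 0, x ^+ m * g x <= 0.
  apply: filterS3 hp0 center sum_sqrE => x hpx /(centered_roots hpx) [s [_ _ _ sum_s]] gx.
  have : 0 <= -2 * ('X^2 * p x)`_n by rewrite -sum_s; apply: sumr_ge0 => a _; apply: sqr_ge0.
  by rewrite gx; lra.
have [x x0 [[gx sx] [gNx sNx]]] := near0_ex_sym (filterI (cg _ half_g0) sign).
have xm0 : 0 < x ^+ m by rewrite exprn_gt0.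
move: sNx sx; rewrite exprNn -signr_odd m_odd expr1 !mulN1r mulNr oppr_le0.
rewrite (pmulr_rle0 _ xm0) (pmulr_rge0 _ xm0) => gNx0 gx0.
move: gx gNx g0; rewrite !ltr_norml; case: (ltrgt0P (g 0)) => [g_gt0|g_lt0|-> //].
- by move=> /andP[? ?] _; lra.
- by move=> _ /andP[? ?]; lra.
Qed.

Lemma centered_roots_le : \forall x \near 0, exists s : seq R,
  [/\ size s = n, p x = \prod_(a <- s) ('X - a%:P) &
    forall a, a \in s -> `|a| <= (4 * `|g 0| + 1) * `|x| ^+ m./2].
Proof.
have [_ hp0] := hp; have g_le := analytic_near0_norm ag g0.
apply: filterS2 (filterI hp0 center) (filterI sum_sqrE g_le).
move=> x [hpx /(centered_roots hpx) [s [sn pE _ sum_s]]] [gx /andP[_ g_le_x]].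
exists s; split=> // a a_s.
have : a ^+ 2 <= -2 * (x ^+ m * g x).
  rewrite -gx -sum_s (big_rem a) //= lerDl; apply: sumr_ge0 => b _; exact: sqr_ge0.
have -> : x ^+ m = (`|x| ^+ m./2) ^+ 2.
  rewrite -exprM muln2 -{1}(odd_double_half m) (negbTE centered_order_even) add0n.
  by rewrite -!muln2 mulnC !exprM real_normK ?num_real.
set y := `|x| ^+ _ => a2_le.
rewrite -ler_sqr ?nnegrE ?mulr_ge0 ?exprn_ge0 ?addr_ge0 ?mulr_ge0 //.
rewrite real_normK ?num_real //; apply: le_trans a2_le _; rewrite exprMn mulrCA mulrC.
apply: ler_wpM2r; first exact: sqr_ge0.
apply: (@le_trans _ _ (4 * `|g 0|)).
  by have := ler_norm (- g x); rewrite normrN; lra.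
by have := normr_ge0 (g 0); nra.
Qed.

End CenteredFamily.

Definition blowup n r p pt :=
  \forall x \near 0, forall k : 'I_n.+1, (p x)`_k = x ^+ (r * (n - k)) * (pt x)`_k.

Lemma blowup_exists n r p (K : R) : analytic_poly p ->
  (\forall x \near 0, exists s : seq R, [/\ size s = n, p x = \prod_(a <- s) ('X - a%:P) &
    forall a, a \in s -> `|a| <= K * `|x| ^+ r]) ->
  exists pt, [/\ analytic_poly pt, forall x, (size (pt x) <= n.+1)%N & blowup n r p pt].
Proof.
move=> ap roots_le.
have /boolp.choice [d d_spec] : forall k : 'I_n.+1, exists d, analytic d /\
    \forall x \near 0, (p x)`_k = x ^+ (r * (n - k)) * d x.
  move=> k; have [|d ad pd] := analytic_divX (m := (r * (n - k))%N) (ap k); last by exists d.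
  exists (2 ^+ n * K ^+ (n - k)); apply: filterS roots_le => x [s [sn -> s_le]] _.
  have := coef_prod_XsubC_le (k := k) _ s_le; rewrite sn -ltnS => /(_ (ltn_ord k)) /le_trans; apply.
  by rewrite exprMn -exprM mulrA.
exists (fun x => \sum_(k < n.+1) d k x *: 'X^k); split=> [|x|].
- by apply: analytic_poly_sum => k; apply: analytic_polyZ; case: (d_spec k).
- apply: leq_trans (size_sum _ _ _) _; apply/bigmax_leqP => k _.
  by apply: leq_trans (size_scale_leq _ _) _; rewrite size_polyXn.
apply: near0_forall => k; have [_ pd] := d_spec k; apply: filterS pd => x ->.
by rewrite coef_sumMXn (eq_bigl (pred1 k)) ?big_pred1_eq.
Qed.

Section Blowup.
Variables (n r : nat) (p pt : R -> {poly R}).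
Hypothesis hp : hyperbolic_family n p.
Hypothesis apt : analytic_poly pt.
Hypothesis spt : forall x, (size (pt x) <= n.+1)%N.
Hypothesis p_pt : blowup n r p pt.

Lemma hyperbolic_family_blowup : hyperbolic_family n pt.
Proof.
have [_ hp0] := hp; split=> //.
have monic_pt : \forall x \near 0, pt x \is monic /\ size (pt x) = n.+1.
  apply: filterS2 hp0 p_pt => x [/monicP + sx _] /(_ ord_max) /=.
  rewrite lead_coefE sx subnn muln0 mul1r /= => -> lead1.
  have size_pt : size (pt x) = n.+1.
    apply/eqP; rewrite eqn_leq spt ltnNge; apply/negP => sn.
    by move: lead1; rewrite nth_default // => /eqP; rewrite oner_eq0.
  by rewrite monicE lead_coefE size_pt /= -lead1 eqxx.
have hyp_pt : \forall x \near 0, x != 0 -> monic_hyperbolic n (pt x).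
  apply: filterS3 hp0 p_pt monic_pt => x [mx sx hx] pdx [mpt sizept] x0; split=> // z rz.
  have scale : (map_poly toC (p x)).[toC (x ^+ r) * z] =
      toC (x ^+ (r * n)) * (map_poly toC (pt x)).[z].
    rewrite !horner_coef !size_map_poly sx sizept mulr_sumr; apply: eq_bigr => k _.
    rewrite !coef_map /= pdx exprMn -rmorphXn /=.
    have -> : (r * n = r * (n - k) + r * k)%N by rewrite -mulnDr subnK // -ltnS.
    by rewrite exprD -exprM !rmorphM /=; ring.
  have : root (map_poly toC (p x)) (toC (x ^+ r) * z).
    by apply/rootP; rewrite scale (rootP rz) mulr0.
  move/hx; case: (z) => u v /=; rewrite mul0r addr0 => /eqP.
  by rewrite mulf_eq0 expf_eq0 (negbTE x0) andbF /= => /eqP.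
have hyp0 : hyperbolic (pt 0).
  by apply: monic_hyperbolic_at0 hyp_pt _ => //; have [] := nbhs_singleton monic_pt.
apply: filterS2 monic_pt hyp_pt => x [mx sx] hyp_x.
by have [x0|/hyp_x //] := eqVneq x 0; split=> //; rewrite x0.
Qed.

Lemma splits_analytically_blowup : splits_analytically n pt -> splits_analytically n p.
Proof.
move=> [a [aa factors]]; exists (fun i x => x ^+ r * a i x); split=> [i|].
  exact: analyticM (analytic_exprn _ _) (aa i).
have [_ hp0] := hp; apply: filterS3 hp0 p_pt factors => x [mx sx hx] pdx factors.
apply/polyP => k; rewrite -big_enum /=; rewrite -big_enum /= in factors.
have [kn|kn] := ltnP k n.+1; last by rewrite !nth_default ?sx ?size_prod_XsubC ?size_enum_ord.
rewrite coef_prod_XsubC_scale ?size_enum_ord // -factors.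
by rewrite (pdx (Ordinal kn)) /= exprM.
Qed.

(* A common root of [pt 0] would be 0 as the roots sum up to 0, contradicting
   [g 0 != 0]. *)
Lemma blowup_roots_distinct g (s : seq R) : (1 < n)%N ->
  (\forall x \near 0, centered n (p x)) ->
  analytic g -> g 0 != 0 -> (\forall x \near 0, ('X^2 * p x)`_n = x ^+ (r * 2) * g x) ->
  size s = n -> pt 0 = \prod_(a <- s) ('X - a%:P) ->
  exists2 c, c \in s & ~~ all (pred1 c) s.
Proof.
move=> n1 center ag g0 sum_sqrE sn pt0.
have n0 : (0 < n)%N := ltnW n1.
have coefn1 (q : {poly R}) : ('X^2 * q)`_n.+1 = q`_n.-1.
  by rewrite coefXnM ltnS ltnNge n0 /= subSS subn1.
have coefn2 (q : {poly R}) : ('X^2 * q)`_n = q`_(n - 2) by rewrite coefXnM ltnNge n1.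
have center0 : centered n (pt 0).
  rewrite /centered coefn1; have k_lt : (n.-1 < n.+1)%N by rewrite ltnS leq_pred.
  apply: (analytic_cancelX_at0 (m := (r * (n - n.-1))%N) (apt n.-1) (analytic_cst 0)).
  apply: filterS2 p_pt center => x /(_ (Ordinal k_lt)) /= <-.
  by rewrite /centered coefn1 mulr0.
have sum_sqr0 : ('X^2 * pt 0)`_n = g 0.
  rewrite coefn2; have k_lt : (n - 2 < n.+1)%N by rewrite ltnS leq_subr.
  apply: (analytic_cancelX_at0 (m := (r * 2)%N) (apt (n - 2)%N) ag).
  by apply: filterS2 p_pt sum_sqrE => x /(_ (Ordinal k_lt)) /=; rewrite subKn // coefn2 => <- <-.
have [] := newton_sum_sqr s; rewrite -pt0 sn center0 sum_sqr0 oppr0 => sum_sqr sum0.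
case: s sn sum_sqr sum0 {pt0} => [s0|c s sn sum_sqr sum0]; first by rewrite -s0 in n0.
exists c; first exact: mem_head.
apply: contra_neqN g0 => /allP all_c.
have sum_const (F : R -> R) : \sum_(b <- c :: s) F b = F c *+ n.
  transitivity (\sum_(b <- c :: s) F c); first by apply: eq_big_seq => b /all_c /= /eqP ->.
  by rewrite big_const_seq count_predT sn iter_addr_0.
move: sum0 sum_sqr; rewrite (sum_const id) (sum_const (fun b => b ^+ 2)) => /eqP.
rewrite mulrn_eq0 -leqn0 leqNgt n0 /= => /eqP ->.
by rewrite expr2 mul0r mul0rn; lra.
Qed.

End Blowup.

Lemma splits_analytically_two_roots n p (s : seq R) (c : R) :
  (forall k q, (k < n)%N -> hyperbolic_family k q -> splits_analytically k q) ->
  hyperbolic_family n p -> p 0 = \prod_(a <- s) ('X - a%:P) -> size s = n ->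
  c \in s -> ~~ all (pred1 c) s -> splits_analytically n p.
Proof.
move=> IH [ap hp] p0 sn cs nall.
pose s1 := [seq a <- s | a == c]; pose s2 := [seq a <- s | a != c].
have s12 : (size s1 + size s2 = n)%N by rewrite -sn !size_filter count_predC.
have s1_gt0 : (0 < size s1)%N by rewrite size_filter -has_count; apply/hasP; exists c; rewrite /=.
have s2_gt0 : (0 < size s2)%N by rewrite size_filter -has_count -has_predC in nall *.
have p0_factor : p 0 = \prod_(a <- s1) ('X - a%:P) * \prod_(a <- s2) ('X - a%:P).
  by rewrite p0 !big_filter (bigID (fun a => a == c)).
have p_size : \forall x \near 0, p x \is monic /\ size (p x) = (size s1 + size s2).+1.
  by apply: filterS hp => x [mx sx _]; rewrite s12.
have [|u [v [au av p_uv]]] := hensel ap p_size (monic_prod_XsubC _ _ _) (monic_prod_XsubC _ _ _)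
    (size_prod_XsubC _ _) (size_prod_XsubC _ _) _ p0_factor.
  by rewrite !big_filter coprimep_prod_XsubC_filter.
have [a1 [aa1 u_factors]] : splits_analytically (size s1) u.
  apply: IH; first by rewrite -s12 -addn1 leq_add2l.
  split=> //; apply: filterS2 hp p_uv => x [_ _ hx] [E [mu su] _]; split=> //.
  by rewrite E in hx; case: (hyperbolicM hx).
have [a2 [aa2 v_factors]] : splits_analytically (size s2) v.
  apply: IH; first by rewrite -s12 -add1n leq_add2r.
  split=> //; apply: filterS2 hp p_uv => x [_ _ hx] [E _ [mv sv]]; split=> //.
  by rewrite E in hx; case: (hyperbolicM hx).
rewrite -s12; exists (fun i => match fintype.split i with inl j => a1 j | inr j => a2 j end).
split=> [i|]; first by case: fintype.split.
apply: filterS3 p_uv u_factors v_factors => x [-> _ _] -> ->; rewrite big_split_ord.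
by congr (_ * _); apply: eq_bigr => j _; [rewrite (unsplitK (inl j))|rewrite (unsplitK (inr j))].
Qed.

Lemma splits_analytically_centered n p : (0 < n)%N ->
  (forall k q, (k < n)%N -> hyperbolic_family k q -> splits_analytically k q) ->
  hyperbolic_family n p -> (\forall x \near 0, centered n (p x)) -> splits_analytically n p.
Proof.
move=> n0 IH hp center; have [ap _] := hp.
have [sum_sqr0|[m [g [ag g0 sum_sqrE]]]] :=
    analytic_eq0_or_order (analytic_polyM (analytic_poly_cst 'X^2) ap n).
  exact: splits_analytically_nilpotent.
have m_even : m = (m./2 * 2)%N.
  rewrite muln2 -{1}(odd_double_half m).
  by rewrite (negbTE (centered_order_even hp center ag g0 sum_sqrE)).
have n1 : (1 < n)%N.
  rewrite ltnNge; apply: contra_neqN g0 => n_le1.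
  have n_eq1 : n = 1%N by apply/eqP; rewrite eqn_leq n_le1.
  apply: (nbhs_singleton (analytic_eq ag (analytic_cst 0) _)).
  apply: filterS sum_sqrE => x; rewrite coefXnM n_eq1 /= => /esym /eqP.
  by rewrite mulf_eq0 expf_eq0 => /orP[/andP[_ ->] //|/eqP].
have [pt [apt spt p_pt]] := blowup_exists ap (centered_roots_le hp center ag g0 sum_sqrE).
apply: (splits_analytically_blowup hp p_pt).
have hpt := hyperbolic_family_blowup hp apt spt p_pt.
have [_ /nbhs_singleton /monic_hyperbolic_roots [s sn pt0]] := hpt.
rewrite m_even in sum_sqrE.
have [c cs nall] := blowup_roots_distinct apt p_pt n1 center ag g0 sum_sqrE sn pt0.
exact: splits_analytically_two_roots hpt pt0 sn cs nall.
Qed.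

Theorem rellich_splitting n p : hyperbolic_family n p -> splits_analytically n p.
Proof.
elim/ltn_ind: n p => n IH p hp; have [ap hp0] := hp.
have [n0|n0] := posnP n.
  exists (fun _ _ => 0); split; first by move=> i; apply: analytic_cst.
  apply: filterS hp0 => x /monic_hyperbolic_roots [s /eqP].
  by rewrite n0 => /nilP -> ->; rewrite big_nil big_ord0.
pose c x := - (p x)`_n.-1 / n%:R.
have ac : analytic c.
  by apply: eq_analytic (analyticM (ap n.-1) (analytic_cst (- n%:R^-1))) => x; rewrite /c; ring.
apply: (splits_analytically_shift ac); apply: splits_analytically_centered => //.
- by move=> k q kn; apply: IH.
- exact: hyperbolic_family_shift.
- by apply: filterS hp0 => x; apply: centered_shift.
Qed.

End HyperbolicFamilies.

(** * Lagrange interpolation *)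

Lemma deriv_prod (A : comNzRingType) (I : finType) (f : I -> {poly A}) :
  (\prod_i f i)^`() = \sum_i (f i)^`() * \prod_(j | j != i) f j.
Proof.
have : uniq (index_enum I) by apply: index_enum_uniq.
elim: (index_enum _) => [|i s IH] /=; first by rewrite !big_nil -polyC1 derivC.
move=> /andP[i_s us]; rewrite !big_cons derivM IH // eqxx /=; congr (_ * _ + _).
  rewrite big_seq [RHS]big_seq_cond; apply: eq_bigl => j; case j_s: (j \in s) => //=.
  by case: eqP => // ji; rewrite -ji j_s in i_s.
rewrite mulr_sumr !big_seq; apply: eq_bigr => j j_s; rewrite big_cons mulrCA.
by case: eqP => // ij; rewrite ij j_s in i_s.
Qed.

Section Interpolation.
Variables (F : fieldType) (M : nat) (a : 'I_M -> F).
Implicit Types (i j : 'I_M) (v w : 'I_M -> F) (N : {poly F}).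

Definition cofactor j : {poly F} := \prod_(i | i != j) ('X - (a i)%:P).

Lemma prod_XsubC_cofactor j : \prod_i ('X - (a i)%:P) = ('X - (a j)%:P) * cofactor j.
Proof. by rewrite (bigD1 j). Qed.

Lemma horner_prod_XsubC j : (\prod_i ('X - (a i)%:P)).[a j] = 0.
Proof. by rewrite (prod_XsubC_cofactor j) hornerM hornerXsubC subrr mul0r. Qed.

Lemma horner_deriv_prod_XsubC j : ((\prod_i ('X - (a i)%:P))^`()).[a j] = (cofactor j).[a j].
Proof.
rewrite (prod_XsubC_cofactor j) derivM derivXsubC mul1r hornerD hornerM hornerXsubC.
by rewrite subrr mul0r addr0.
Qed.

Lemma horner_cofactor j (x : F) : (cofactor j).[x] = \prod_(i | i != j) (x - a i).
Proof. by rewrite horner_prod; apply: eq_bigr => i _; rewrite hornerXsubC. Qed.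

Lemma horner_cofactor_neq i j : i != j -> (cofactor j).[a i] = 0.
Proof. by move=> ij; rewrite horner_cofactor (bigD1 i) //= subrr mul0r. Qed.

Lemma size_cofactor j : size (cofactor j) = M.
Proof.
have := size_prod_XsubC (enum 'I_M) a; rewrite big_enum size_enum_ord /= (prod_XsubC_cofactor j).
rewrite size_Mmonic ?polyXsubC_eq0 ?size_XsubC //; first by case.
by apply: monic_prod => i _; apply: monicXsubC.
Qed.

Definition interp v : {poly F} := \sum_j (v j / (cofactor j).[a j]) *: cofactor j.

Lemma size_interp v : (size (interp v) <= M)%N.
Proof.
apply: leq_trans (size_sum _ _ _) _; apply/bigmax_leqP => j _.
by rewrite (leq_trans (size_scale_leq _ _)) ?size_cofactor.
Qed.

Lemma horner_interp v x : (interp v).[x] = \sum_j v j * ((cofactor j).[x] / (cofactor j).[a j]).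
Proof.
by rewrite /interp horner_sum; apply: eq_bigr => j _; rewrite hornerZ mulrAC mulrA.
Qed.

Hypothesis a_inj : injective a.

Lemma cofactor_neq0 j : (cofactor j).[a j] != 0.
Proof.
rewrite horner_cofactor; apply/prodf_neq0 => i ij.
by rewrite subr_eq0; apply: contra_neq ij => /a_inj.
Qed.

Lemma interp_node v j : (interp v).[a j] = v j.
Proof.
rewrite horner_interp (bigD1 j) //= divff ?cofactor_neq0 // mulr1 big1 ?addr0 // => i ij.
by rewrite horner_cofactor_neq 1?eq_sym // mul0r mulr0.
Qed.

Lemma interp_unique N v : (size N <= M)%N -> (forall j, N.[a j] = v j) -> N = interp v.
Proof.
move=> sN Nv; apply/eqP; rewrite -subr_eq0; apply/eqP.
apply: (@roots_geq_poly_eq0 _ _ [seq a j | j <- enum 'I_M]).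
- apply/allP => z /mapP [j _ ->]; apply/rootP.
  by rewrite hornerD hornerN interp_node Nv subrr.
- by rewrite map_inj_uniq ?enum_uniq.
rewrite size_map size_enum_ord (leq_trans (size_polyD _ _)) // geq_max sN size_polyN.
exact: size_interp.
Qed.

End Interpolation.

Lemma map_cofactor (F F' : fieldType) (f : {rmorphism F -> F'}) M (a : 'I_M -> F) j :
  map_poly f (cofactor a j) = cofactor (f \o a) j.
Proof.
by rewrite rmorph_prod; apply: eq_bigr => i _; rewrite rmorphB /= map_polyX map_polyC.
Qed.

(** * The pencil of real and imaginary parts *)

Section RealImaginaryParts.
Variable R : realType.
Local Notation C := R[i].
Local Notation toC := (real_complex R).
Implicit Types (p : {poly C}) (y : R) (z : C).

Lemma sqr_iC : iC R * iC R = -1.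
Proof. by apply: eq_ReIm => /=; ring. Qed.

Definition rePoly p : {poly R} := map_poly (@complex.Re R) p.
Definition imPoly p : {poly R} := map_poly (@complex.Im R) p.

Lemma coef_rePoly p k : (rePoly p)`_k = complex.Re p`_k.
Proof. by rewrite coef_map_id0. Qed.

Lemma coef_imPoly p k : (imPoly p)`_k = complex.Im p`_k.
Proof. by rewrite coef_map_id0. Qed.

Lemma re_imPolyE p : p = map_poly toC (rePoly p) + iC R *: map_poly toC (imPoly p).
Proof.
apply/polyP => k; rewrite coefD coefZ !(coef_map toC) coef_rePoly coef_imPoly.
by case: (p`_k) => u v; apply: eq_ReIm => /=; ring.
Qed.

Lemma conj_re_imPolyE p :
  map_poly conjc p = map_poly toC (rePoly p) - iC R *: map_poly toC (imPoly p).
Proof.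
apply/polyP => k; rewrite coefB coefZ coef_map !(coef_map toC) coef_rePoly coef_imPoly /=.
by case: (p`_k) => u v; apply: eq_ReIm => /=; ring.
Qed.

Lemma horner_real p y : p.[toC y] = Complex (rePoly p).[y] (imPoly p).[y].
Proof.
rewrite {1}(re_imPolyE p) hornerD hornerZ !horner_map /=.
by apply: eq_ReIm => /=; ring.
Qed.

Lemma normc_re_imPoly_le p z (V : R) :
  normc p.[z] <= V -> normc p.[conjc z] <= V ->
  normc (map_poly toC (rePoly p)).[z] <= V /\ normc (map_poly toC (imPoly p)).[z] <= V.
Proof.
move=> pz pz_conj; set u := (map_poly toC (rePoly p)).[z]; set v := (map_poly toC (imPoly p)).[z].
have pzE : p.[z] = u + iC R * v by rewrite {1}(re_imPolyE p) hornerD hornerZ.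
have pz_conjE : conjc p.[conjc z] = u - iC R * v.
  by rewrite -horner_map /= conjcK conj_re_imPolyE hornerD hornerN hornerZ.
have two_inv : normc (2^-1 : C) = 2^-1.
  by rewrite normcV (_ : 2 = toC 2) ?normc_real ?ger0_norm // rmorphMn rmorph1.
have iC_norm : normc (iC R) = 1 by rewrite /iC /= expr0n expr1n add0r sqrtr1.
have uE : u = 2^-1 * (p.[z] + conjc p.[conjc z]) by rewrite pzE pz_conjE; field.
have vE : v = iC R * (2^-1 * (conjc p.[conjc z] - p.[z])).
  rewrite pzE pz_conjE; transitivity (- (iC R * iC R) * v); last by field.
  by rewrite sqr_iC opprK mul1r.
rewrite uE vE !normcM iC_norm mul1r two_inv.
have := le_normcD p.[z] (conjc p.[conjc z]); have := ler_normcB (conjc p.[conjc z]) p.[z].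
by rewrite normc_conj; lra.
Qed.

Definition pencil p (t : R) : {poly R} := rePoly p + t *: imPoly p.

Lemma sqr_pencil_le p t y : (pencil p t).[y] ^+ 2 <= (1 + t ^+ 2) * sqnormC p.[toC y].
Proof.
rewrite horner_real /sqnormC /= /pencil hornerD hornerZ.
by have := sqr_ge0 (t * (rePoly p).[y] - (imPoly p).[y]); nra.
Qed.

Lemma pencil_root_sqnormC p t z : root (map_poly toC (pencil p t)) z ->
  sqnormC p.[z] = sqnormC (map_poly conjc p).[z].
Proof.
move=> /rootP; rewrite rmorphD /= map_polyZ hornerD hornerZ => /eqP; rewrite addr_eq0 => /eqP re_im.
rewrite conj_re_imPolyE {1}(re_imPolyE p) !hornerD hornerN hornerZ re_im.
case: ((map_poly toC (imPoly p)).[z]) => u v; rewrite /sqnormC /=; ring.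
Qed.

Definition wronskian p : {poly R} :=
  imPoly p * (rePoly p)^`() - rePoly p * (imPoly p)^`().

Lemma wronskian_pencil p t :
  imPoly p * (pencil p t)^`() - pencil p t * (imPoly p)^`() = wronskian p.
Proof.
rewrite /wronskian /pencil derivD derivZ mulrDr mulrDl -!scalerAl -scalerAr.
by rewrite opprD addrACA subrr addr0.
Qed.

Lemma horner_wronskian p y :
  (wronskian p).[y] = - complex.Im (conjc p.[toC y] * p^`().[toC y]).
Proof.
have re_deriv : rePoly p^`() = (rePoly p)^`().
  by apply/polyP => k; rewrite coef_rePoly !coef_deriv coef_rePoly raddfMn.
have im_deriv : imPoly p^`() = (imPoly p)^`().
  by apply/polyP => k; rewrite coef_imPoly !coef_deriv coef_imPoly raddfMn.
rewrite !horner_real re_deriv im_deriv /wronskian hornerD hornerN !hornerM /=; ring.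
Qed.

End RealImaginaryParts.

(** * The fiber over a fixed x *)

Lemma upper_add_neq0 (R : realType) (z w : R[i]) :
  0 <= complex.Im z -> 0 < complex.Im w -> z + w != 0.
Proof.
move=> z0 w0; apply: contraTneq w0 => /(congr1 (@complex.Im R)) /=.
by rewrite raddfD /= -leNgt; lra.
Qed.

Lemma sqnormC_add_gt0 (R : realType) (w : R[i]) (y : R) : 0 < complex.Im w ->
  0 < sqnormC (real_complex R y + w).
Proof. by move=> w0; rewrite sqnormC_gt0 upper_add_neq0. Qed.

Definition poisson (R : realType) (w : R[i]) (y : R) : R :=
  complex.Im w / sqnormC (real_complex R y + w).

Lemma poisson_ge0 (R : realType) (w : R[i]) (y : R) : 0 <= complex.Im w -> 0 <= poisson w y.
Proof. by move=> w0; rewrite divr_ge0 ?sqnormC_ge0. Qed.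

Section Fiber.
Variable R : realType.
Local Notation C := R[i].
Local Notation toC := (real_complex R).
Variables (M : nat) (nu : 'I_M -> C) (t : R).
Implicit Types (j k : 'I_M) (y : R) (z : C).

Definition fiberP : {poly C} := \prod_k ('X + (nu k)%:P).

Lemma fiberP_XsubC : fiberP = \prod_k ('X - (- nu k)%:P).
Proof. by apply: eq_bigr => k _; rewrite polyCN opprK. Qed.

Lemma monic_fiberP : fiberP \is monic.
Proof. by rewrite fiberP_XsubC; apply: monic_prod => k _; apply: monicXsubC. Qed.

Lemma size_fiberP : size fiberP = M.+1.
Proof. by rewrite fiberP_XsubC -big_enum size_prod_XsubC size_enum_ord. Qed.

Lemma horner_fiberP z : fiberP.[z] = \prod_k (z + nu k).
Proof. by rewrite horner_prod; apply: eq_bigr => k _; rewrite hornerD hornerX hornerC. Qed.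

Lemma horner_conj_fiberP z : (map_poly conjc fiberP).[z] = \prod_k (z + conjc (nu k)).
Proof.
rewrite rmorph_prod horner_prod; apply: eq_bigr => k _.
by rewrite rmorphD /= map_polyX map_polyC hornerD hornerX hornerC.
Qed.

Lemma coef_fiberP_lead : fiberP`_M = 1.
Proof. by have := monic_fiberP; rewrite monicE lead_coefE size_fiberP => /eqP. Qed.

Lemma size_imPoly_fiberP : (size (imPoly fiberP) <= M)%N.
Proof.
apply/leq_sizeP => j; rewrite coef_imPoly leq_eqVlt => /predU1P[<-|Mj].
  by rewrite coef_fiberP_lead.
by rewrite nth_default ?size_fiberP.
Qed.

Lemma coef_pencil_fiberP_lead : (pencil fiberP t)`_M = 1.
Proof.
by rewrite /pencil coefD coefZ coef_rePoly coef_imPoly coef_fiberP_lead /= mulr0 addr0.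
Qed.

Lemma size_pencil_fiberP : size (pencil fiberP t) = M.+1.
Proof.
apply/eqP; rewrite eqn_leq; apply/andP; split.
  apply/leq_sizeP => j Mj; rewrite coefD coefZ coef_rePoly coef_imPoly.
  by rewrite nth_default ?size_fiberP //= mulr0 addr0.
rewrite ltnNge; apply/negP => /leq_sizeP /(_ M (leqnn _)) /eqP.
by rewrite coef_pencil_fiberP_lead oner_eq0.
Qed.

Lemma monic_pencil_fiberP : pencil fiberP t \is monic.
Proof. by rewrite monicE lead_coefE size_pencil_fiberP /= coef_pencil_fiberP_lead. Qed.

Lemma horner_wronskian_fiberP y : (wronskian fiberP).[y] =
  \sum_k complex.Im (nu k) * \prod_(i | i != k) sqnormC (toC y + nu i).
Proof.
rewrite horner_wronskian deriv_prod horner_sum mulr_sumr raddf_sum -sumrN.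
apply: eq_bigr => k _; rewrite derivD derivX derivC addr0 mul1r horner_fiberP (bigD1 k) //=.
rewrite rmorphM -mulrA horner_prod rmorph_prod -big_split /=.
have -> : \prod_(i | i != k) (conjc (toC y + nu i) * ('X + (nu i)%:P).[toC y]) =
    toC (\prod_(i | i != k) sqnormC (toC y + nu i)).
  rewrite rmorph_prod; apply: eq_bigr => i _; rewrite hornerD hornerX hornerC.
  by case: (nu i) => u v; apply: eq_ReIm; rewrite /sqnormC /=; ring.
by case: (nu k) => u v /=; ring.
Qed.

Definition poisson_sum y : R := \sum_k poisson (nu k) y.

Hypothesis nu_gt0 : forall k, 0 < complex.Im (nu k).

Lemma pencil_fiberP_hyperbolic : hyperbolic (pencil fiberP t).
Proof.
move=> z rz; have M_gt0 : (0 < M)%N.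
  rewrite -ltnS -size_pencil_fiberP -(size_map_poly toC); apply: root_size_gt1 rz.
  by rewrite map_poly_eq0 monic_neq0 // monic_pencil_fiberP.
have := pencil_root_sqnormC rz; rewrite horner_fiberP horner_conj_fiberP !sqnormC_prod.
move=> sqnorm_eq; apply/eqP/negPn/negP => Im_z.
have lt_prod (b : bool) : 0 < (if b then complex.Im z else - complex.Im z) ->
    \prod_k sqnormC (z + (if b then conjc (nu k) else nu k)) <
    \prod_k sqnormC (z + (if b then nu k else conjc (nu k))).
  move=> Im_gt0; apply: ltr_prod.
    by apply/hasP; exists (Ordinal M_gt0) => //; apply: mem_index_enum.
  move=> k _; rewrite sqnormC_ge0 /=.
  by have := nu_gt0 k; case: b Im_gt0; case: (z) => u v; case: (nu k) => u' v' /=;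
    rewrite /sqnormC /=; nra.
have [Im_gt0|Im_lt0|Im_eq0] := ltrgt0P (complex.Im z); last by rewrite Im_eq0 eqxx in Im_z.
  by have := lt_prod true Im_gt0; rewrite sqnorm_eq ltxx.
by have := lt_prod false; rewrite oppr_gt0 => /(_ Im_lt0); rewrite sqnorm_eq ltxx.
Qed.

Lemma fiberP_neq0 z : 0 <= complex.Im z -> fiberP.[z] != 0.
Proof. by move=> z_ge0; rewrite horner_fiberP; apply/prodf_neq0 => k _; apply: upper_add_neq0. Qed.

Lemma sqnormC_fiberP_gt0 y : 0 < sqnormC fiberP.[toC y].
Proof. by rewrite sqnormC_gt0 fiberP_neq0. Qed.

Lemma normc_fiberP_ge z : 0 <= complex.Im z -> \prod_k complex.Im (nu k) <= normc fiberP.[z].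
Proof.
move=> z_ge0; rewrite horner_fiberP normc_prod; apply: ler_prod => k _.
rewrite (ltW (nu_gt0 k)) /=; apply: le_trans (ler_Im_normc _); rewrite raddfD /=.
by rewrite ger0_norm ?addr_ge0 ?(ltW (nu_gt0 k)) // lerDr.
Qed.

Lemma poisson_sum_ge0 y : 0 <= poisson_sum y.
Proof. by apply: sumr_ge0 => k _; apply: poisson_ge0; apply: ltW. Qed.

Lemma wronskian_poisson y : (wronskian fiberP).[y] = poisson_sum y * sqnormC fiberP.[toC y].
Proof.
rewrite horner_wronskian_fiberP /poisson_sum mulr_suml horner_fiberP sqnormC_prod.
apply: eq_bigr => k _; rewrite /poisson [in RHS](bigD1 k) //= mulrA divfK //.
by rewrite gt_eqF // sqnormC_add_gt0.
Qed.

Lemma wronskian_fiberP_gt0 y : (0 < M)%N -> 0 < (wronskian fiberP).[y].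
Proof.
move=> M_gt0; rewrite wronskian_poisson mulr_gt0 ?sqnormC_fiberP_gt0 //.
rewrite /poisson_sum (bigD1 (Ordinal M_gt0)) //= ltr_pwDl ?divr_gt0 ?sqnormC_add_gt0 //.
by apply: sumr_ge0 => k _; apply: poisson_ge0; apply: ltW.
Qed.

Section Roots.
Variable a : 'I_M -> R.
Hypothesis pencil_roots : pencil fiberP t = \prod_j ('X - (a j)%:P).

Lemma pencil_cofactor j : pencil fiberP t = ('X - (a j)%:P) * cofactor a j.
Proof. by rewrite pencil_roots (prod_XsubC_cofactor a j). Qed.

Lemma pencil_root j : (pencil fiberP t).[a j] = 0.
Proof. by rewrite pencil_roots horner_prod_XsubC. Qed.

Lemma deriv_pencil_root j : (pencil fiberP t)^`().[a j] = (cofactor a j).[a j].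
Proof. by rewrite pencil_roots horner_deriv_prod_XsubC. Qed.

Lemma wronskian_root j :
  (wronskian fiberP).[a j] = (imPoly fiberP).[a j] * (cofactor a j).[a j].
Proof.
rewrite -(wronskian_pencil _ t) hornerD hornerN !hornerM.
by rewrite deriv_pencil_root pencil_root mul0r subr0.
Qed.

Lemma wronskian_root_gt0 j : 0 < (wronskian fiberP).[a j].
Proof. by apply: wronskian_fiberP_gt0; apply: leq_ltn_trans (ltn_ord j). Qed.

Lemma pencil_roots_inj : injective a.
Proof.
move=> i j aij; apply/eqP; apply/negPn/negP => ij; have := wronskian_root_gt0 j.
by rewrite wronskian_root -{2}aij horner_cofactor_neq // mulr0 ltxx.
Qed.

Definition weight j : R := (imPoly fiberP).[a j] / (cofactor a j).[a j].

Lemma wronskian_root_weight j :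
  (wronskian fiberP).[a j] = weight j * (cofactor a j).[a j] ^+ 2.
Proof.
have := cofactor_neq0 pencil_roots_inj j => c0.
by rewrite wronskian_root /weight; field.
Qed.

Lemma weight_gt0 j : 0 < weight j.
Proof.
have := wronskian_root_gt0 j; rewrite wronskian_root_weight pmulr_lgt0 //.
by rewrite exprn_even_gt0 // cofactor_neq0 //; apply: pencil_roots_inj.
Qed.

Lemma imPoly_fiberP_sum : imPoly fiberP = \sum_j weight j *: cofactor a j.
Proof.
exact: (interp_unique pencil_roots_inj (v := fun j => (imPoly fiberP).[a j]) size_imPoly_fiberP).
Qed.

Lemma sum_weight : \sum_j weight j = \sum_k complex.Im (nu k).
Proof.
have [M_gt0|] := posnP M.
  by rewrite !big1 // => j; have := ltn_ord j; rewrite [X in (_ < X)%N -> _]M_gt0.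
move=> M_gt0; have := congr1 (fun p : {poly R} => p`_M.-1) imPoly_fiberP_sum.
have coefP : fiberP`_M.-1 = \sum_k nu k.
  rewrite fiberP_XsubC; pose s := [seq - nu k | k <- enum 'I_M].
  have size_s : size s = M by rewrite size_map size_enum_ord.
  have -> : \prod_k ('X - (- nu k)%:P) = \prod_(x <- s) ('X - x%:P) by rewrite big_map big_enum.
  have := coefPn_prod_XsubC (ps := s); rewrite size_s -lt0n => /(_ M_gt0) ->.
  by rewrite big_map big_enum sumrN opprK.
rewrite coef_imPoly coefP raddf_sum coef_sum => ->; apply: eq_bigr => j _.
have /monicP : cofactor a j \is monic by apply: monic_prod => i _; apply: monicXsubC.
by rewrite lead_coefE size_cofactor coefZ => ->; rewrite mulr1.
Qed.

Lemma weight_le j : weight j <= \sum_k complex.Im (nu k).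
Proof.
by rewrite -sum_weight (bigD1 j) //= lerDl; apply: sumr_ge0 => i _; rewrite ltW ?weight_gt0.
Qed.

Lemma wronskian_sum_sqr : wronskian fiberP = \sum_j weight j *: cofactor a j ^+ 2.
Proof.
rewrite -(wronskian_pencil _ t) {1}imPoly_fiberP_sum imPoly_fiberP_sum.
rewrite raddf_sum mulr_suml mulr_sumr -sumrB.
apply: eq_bigr => j _ /=; rewrite derivZ -scalerAl -scalerAr -scalerBr; congr (_ *: _).
by rewrite !(pencil_cofactor j) derivM derivXsubC; ring.
Qed.

Lemma weight_cofactor_le j y :
  weight j * (cofactor a j).[y] ^+ 2 <= (wronskian fiberP).[y].
Proof.
rewrite wronskian_sum_sqr horner_sum (bigD1 j) //= hornerZ horner_exp lerDl.
apply: sumr_ge0 => i _; rewrite hornerZ horner_exp mulr_ge0 ?sqr_ge0 //.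
by rewrite ltW ?weight_gt0.
Qed.

End Roots.
End Fiber.

(** * Existence of the branches *)

Section Slices.
Variable R : realType.
Local Notation C := R[i].
Local Notation toC := (real_complex R).
Implicit Types (p : {poly {poly C}}) (x : R).

Definition slice p x : {poly C} := map_poly (horner_eval (toC x)) p.

Lemma eval2_slice p x (y : C) : eval2 p (toC x) y = (slice p x).[y].
Proof.
rewrite /eval2 (horner_coef p) (horner_coef_wide _ (size_poly _ _)) horner_sum.
apply: eq_bigr => i _; rewrite hornerM horner_exp hornerC; congr (_ * _).
by rewrite coef_map.
Qed.

Lemma slice_conj2 p x : slice (conj2 p) x = map_poly conjc (slice p x).
Proof.
apply/polyP => k; rewrite !coef_map /= /horner_eval.
have {1}-> : toC x = Num.conj (toC x) by apply: eq_ReIm; rewrite /= ?oppr0.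
by rewrite horner_map.
Qed.

Lemma slice_Apoly p x : slice (Apoly p) x = map_poly toC (rePoly (slice p x)).
Proof.
have -> : slice (Apoly p) x = (slice p x + slice (conj2 p) x) * (2%:R^-1)%:P.
  by rewrite /slice /Apoly rmorphM rmorphD /= map_polyC /= /horner_eval hornerC.
rewrite slice_conj2 conj_re_imPolyE {1}(re_imPolyE (slice p x)) addrACA subrr addr0 -mulr2n.
by rewrite mulrC mul_polyC -scalerMnr scalerMnl -mulr_natr mulVf ?scale1r // pnatr_eq0.
Qed.

Lemma slice_Bpoly p x : slice (Bpoly p) x = map_poly toC (imPoly (slice p x)).
Proof.
have -> : slice (Bpoly p) x = (slice p x - slice (conj2 p) x) * ((2%:R * iC R)^-1)%:P.
  by rewrite /slice /Bpoly rmorphM rmorphB /= map_polyC /= /horner_eval hornerC.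
rewrite slice_conj2 conj_re_imPolyE {1}(re_imPolyE (slice p x)) opprD opprK addrACA subrr add0r.
have i_neq0 : iC R != 0 by rewrite eq_complex /= oner_eq0 andbF.
rewrite -mulr2n mulrC mul_polyC -scalerMnr scalerA scalerMnl -mulr_natr.
by rewrite [X in X *: _](_ : _ = 1) ?scale1r //; field; rewrite i_neq0.
Qed.

Lemma slice_pencil p x t :
  slice (Apoly p + (toC t)%:P%:P * Bpoly p) x = map_poly toC (pencil (slice p x) t).
Proof.
have -> : slice (Apoly p + (toC t)%:P%:P * Bpoly p) x =
    slice (Apoly p) x + (toC t)%:P * slice (Bpoly p) x.
  by rewrite /slice rmorphD rmorphM /= map_polyC /= /horner_eval hornerC.
by rewrite slice_Apoly slice_Bpoly mul_polyC rmorphD /= map_polyZ.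
Qed.

Lemma slice_deriv_pencil p x t :
  slice ((Apoly p)^`() + (toC t)%:P%:P * (Bpoly p)^`()) x =
  map_poly toC (pencil (slice p x) t)^`().
Proof.
have -> : (Apoly p)^`() + (toC t)%:P%:P * (Bpoly p)^`() =
    (Apoly p + (toC t)%:P%:P * Bpoly p)^`().
  by rewrite derivD [X in _ = _ + X]derivM derivC mul0r add0r.
by rewrite -deriv_map -slice_pencil /slice deriv_map.
Qed.

Lemma analytic_poly_Re_slice (h : {additive C -> R}) p :
  (forall z y, h (z * toC y) = h z * y) -> analytic_poly (fun x => map_poly h (slice p x)).
Proof.
move=> hM i; apply: (eq_analytic (f := fun x => \sum_(k < size p`_i) h (p`_i)`_k * x ^+ k)).
  move=> x; rewrite coef_map_id0 ?raddf0 // coef_map /= /horner_eval horner_coef raddf_sum.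
  by apply: eq_bigr => k _; rewrite -rmorphXn /= hM.
by apply: analytic_sum => k; apply: analyticM (analytic_cst _) (analytic_exprn _ _).
Qed.

Lemma analytic_poly_pencil p t : analytic_poly (fun x => pencil (slice p x) t).
Proof.
apply: analytic_polyD; first by apply: analytic_poly_Re_slice => -[u v] y /=; ring.
apply: eq_analytic_poly (analytic_polyM (analytic_poly_cst t%:P) _) => [x|].
  by rewrite mul_polyC.
by apply: analytic_poly_Re_slice => -[u v] y /=; ring.
Qed.

End Slices.

Section Branches.
Variable R : realType.
Local Notation C := R[i].
Local Notation toC := (real_complex R).
Variables (M : nat) (L : 'I_M -> nat) (q : 'I_M -> {poly R}) (t : R).

(* The factors of [P] are [y + node x k]. *)
Definition node (x : R) k : C := Complex (q k).[x] (x ^+ (2 * L k)).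

Lemma horner_node x k : (polyRC (q k) + iC R *: 'X^(2 * L k)).[toC x] = node x k.
Proof.
rewrite hornerD hornerZ hornerXn [X in X + _](horner_map toC) /= -rmorphXn /=.
by apply: eq_ReIm => /=; ring.
Qed.

Lemma slice_Ppoly x : slice (Ppoly q L) x = fiberP (node x).
Proof.
rewrite /slice rmorph_prod; apply: eq_bigr => k _.
by rewrite rmorphD /= map_polyX map_polyC /= /horner_eval horner_node.
Qed.

Definition branch_roots x (a : 'I_M -> R) :=
  pencil (fiberP (node x)) t = \prod_j ('X - (a j)%:P).

Lemma branch_rootsP x (a : 'I_M -> R) : branch_roots x a <->
  forall y, eval2 (Apoly (Ppoly q L) + (rC t)%:P%:P * Bpoly (Ppoly q L)) (rC x) y =
    \prod_(j < M) (y - rC (a j)).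
Proof.
have evalE y : eval2 (Apoly (Ppoly q L) + (rC t)%:P%:P * Bpoly (Ppoly q L)) (rC x) y =
    (map_poly toC (pencil (fiberP (node x)) t)).[y].
  by rewrite -[rC x]/(toC x) eval2_slice slice_pencil slice_Ppoly.
have mapE : map_poly toC (\prod_j ('X - (a j)%:P)) = \prod_j ('X - (toC (a j))%:P).
  by rewrite rmorph_prod; apply: eq_bigr => j _; rewrite rmorphB /= map_polyX map_polyC.
have prodE y : (\prod_j ('X - (toC (a j))%:P)).[y] = \prod_(j < M) (y - rC (a j)).
  by rewrite horner_prod; apply: eq_bigr => j _; rewrite hornerXsubC.
split=> [roots y|factors]; first by rewrite evalE roots mapE prodE.
apply: (map_poly_inj toC); rewrite mapE; apply/eqP; rewrite -subr_eq0; apply/eqP.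
set D := (X in X = 0); apply: (@roots_geq_poly_eq0 _ _ [seq (k%:R : C) | k <- iota 0 (size D)]).
- by apply/allP => z _; apply/rootP; rewrite hornerD hornerN prodE -factors evalE subrr.
- by rewrite map_inj_uniq ?iota_uniq // => i j /eqP; rewrite eqr_nat => /eqP.
- by rewrite size_map size_iota.
Qed.

Lemma Im_node_gt0 x k : x != 0 -> 0 < complex.Im (node x k).
Proof. by move=> x0; rewrite /= exprn_even_gt0 ?x0 ?orbT // oddM. Qed.

Hypothesis L_gt0 : forall j, (0 < L j)%N.
Hypothesis q0 : forall j, (q j).[0] = 0.

Lemma node0 k : node 0 k = 0.
Proof. by rewrite /node q0 expr0n muln_eq0 /= eqn0Ngt L_gt0. Qed.

Lemma pencil_at0 : pencil (fiberP (node 0)) t = 'X^M.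
Proof.
have -> : fiberP (node 0) = 'X^M.
  rewrite /fiberP; under eq_bigr do rewrite node0 addr0.
  by rewrite prodr_const card_ord.
apply/polyP => k; rewrite coefD coefZ coef_rePoly coef_imPoly !coefXn.
by case: eqP => _ /=; rewrite mulr0 addr0.
Qed.

Lemma hyperbolic_family_pencil : hyperbolic_family M (fun x => pencil (fiberP (node x)) t).
Proof.
split.
  by apply: eq_analytic_poly (analytic_poly_pencil (Ppoly q L) t) => x; rewrite slice_Ppoly.
apply: (@filterE _ (nbhs (0 : R))) => x.
split; [exact: monic_pencil_fiberP|exact: size_pencil_fiberP|].
have [->|x0] := eqVneq x 0; last by apply: pencil_fiberP_hyperbolic => k; apply: Im_node_gt0.
move=> z /rootP; rewrite pencil_at0 map_polyXn hornerXn => /eqP.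
by rewrite expf_eq0 => /andP[_ /eqP ->].
Qed.

Lemma branches_exist : exists b : 'I_M -> nat -> R,
  [/\ forall j, conv_series1 (b j), forall j, eval_series1 (b j) 0 = 0 &
    \forall x \near 0, branch_roots x (fun j => eval_series1 (b j) x)].
Proof.
have [a [/boolp.choice [b a_germ] roots]] := rellich_splitting hyperbolic_family_pencil.
have a_eval : \forall x \near 0, forall j, a j x = eval_series1 (b j) x.
  apply: near0_forall => j; apply: germ_uniq (a_germ j) _.
  by apply: germ_eval_series1; apply: germ_conv_series1 (a_germ j).
have roots_eval : \forall x \near 0, branch_roots x (fun j => eval_series1 (b j) x).
  apply: filterS2 roots a_eval => x root_x a_x; rewrite /branch_roots root_x.
  by apply: eq_bigr => j _; rewrite a_x.
exists b; split=> // j; first exact: germ_conv_series1 (a_germ j).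
have := pencil_root (nbhs_singleton roots_eval) j; rewrite pencil_at0 hornerXn => /eqP.
by rewrite expf_eq0 => /andP[_ /eqP].
Qed.

End Branches.

(** * Double power series and interpolation at the roots *)

Section CoefficientBounds.
Variable R : realType.
Local Notation C := R[i].
Implicit Types (p h : {poly C}) (rho K : R) (a y : C).

Definition coef_bound rho K p := forall n, normc p`_n * rho ^+ n <= K.

Lemma coef_bound_horner rho K p y : 0 < rho -> coef_bound rho K p ->
  normc y <= rho / 2 -> normc p.[y] <= 2 * K.
Proof.
move=> rho0 pK y_le; rewrite horner_coef; apply: le_trans (ler_normc_sum _ _ _) _.
pose s := normc y / rho; have s0 : 0 <= s by rewrite divr_ge0 ?normc_ge0 // ltW.
have K0 : 0 <= K by apply: le_trans (pK 0%N); rewrite mulr_ge0 ?normc_ge0.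
apply: (@le_trans _ _ (\sum_(i < size p) K * s ^+ i)).
  apply: ler_sum => i _; rewrite normcM normcX.
  have -> : normc y = rho * s by rewrite /s mulrC divfK // gt_eqF.
  by rewrite exprMn mulrA ler_wpM2r ?exprn_ge0.
rewrite -mulr_sumr mulrC ler_wpM2r // sum_expr_le2 // s0 /=.
by rewrite ler_pdivrMr // mulrC.
Qed.

Lemma coef_bound_div_XsubC rho K p a : 0 < rho -> coef_bound rho K p ->
  normc a <= rho / 2 ->
  exists2 h, p = h * ('X - a%:P) + (p.[a])%:P & coef_bound rho (2 * K / rho) h.
Proof.
move=> rho0 pK a_le; pose h := p %/ ('X - a%:P).
have pE : p = h * ('X - a%:P) + (p.[a])%:P by rewrite {1}(divp_eq p ('X - a%:P)) modp_XsubC.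
have K0 : 0 <= K by apply: le_trans (pK 0%N); rewrite mulr_ge0 ?normc_ge0.
exists h => // n; have h_rec k : h`_k = p`_k.+1 + a * h`_k.+1.
  by rewrite {1}pE coefD coefC /= addr0 mulrBr coefB coefMX coefMC /=; ring.
rewrite ler_pdivlMr // -mulrA -exprSr.
have [m] := ubnP (size h - n); elim: m n => // m IH n; rewrite ltnS => hn.
have [h_le|h_gt] := leqP (size h) n; first by rewrite nth_default // normc0 mul0r mulr_ge0.
have := IH n.+1 _; rewrite subnS -ltnS prednK ?subn_gt0 // => /(_ hn) IHn.
rewrite h_rec; apply: (@le_trans _ _ ((normc p`_n.+1 + rho / 2 * normc h`_n.+1) * rho ^+ n.+1)).
  rewrite ler_wpM2r ?exprn_ge0 ?(ltW rho0) //; apply: le_trans (le_normcD _ _) _.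
  by rewrite lerD2l normcM ler_wpM2r ?normc_ge0.
have -> : (normc p`_n.+1 + rho / 2 * normc h`_n.+1) * rho ^+ n.+1 =
    normc p`_n.+1 * rho ^+ n.+1 + 2^-1 * (normc h`_n.+1 * rho ^+ n.+2).
  by rewrite [rho ^+ n.+2]exprS; ring.
by have := pK n.+1; lra.
Qed.

Lemma coef_bound_div_prod rho K p (s : seq C) : 0 < rho -> coef_bound rho K p ->
  (forall a, a \in s -> normc a <= rho / 2) ->
  exists h N, [/\ p = h * \prod_(a <- s) ('X - a%:P) + N, (size N <= size s)%N &
    coef_bound rho (K * (2 / rho) ^+ size s) h].
Proof.
move=> rho0 pK; elim: s => [|a s IH] s_le.
  by exists p, 0; rewrite big_nil mulr1 addr0 size_poly0 mulr1.
have [|h1 [N1 [pE sN h1K]]] := IH; first by move=> b bs; apply: s_le; rewrite inE bs orbT.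
have [h h1E hK] := coef_bound_div_XsubC rho0 h1K (s_le a (mem_head _ _)).
exists h, ((h1.[a])%:P * \prod_(a <- s) ('X - a%:P) + N1); split.
- by rewrite {1}pE {1}h1E big_cons; ring.
- rewrite (leq_trans (size_polyD _ _)) // geq_max (leq_trans sN) //= andbT mul_polyC.
  by rewrite (leq_trans (size_scale_leq _ _)) // size_prod_XsubC.
- have -> : K * (2 / rho) ^+ size (a :: s) = 2 * (K * (2 / rho) ^+ size s) / rho.
    by rewrite /= exprS; ring.
  exact: hK.
Qed.

Lemma interp_error rho K p M (a : 'I_M -> C) y : 0 < rho -> coef_bound rho K p ->
  injective a -> (forall j, normc (a j) <= rho / 2) -> normc y <= rho / 2 ->
  normc (p.[y] - (interp a (fun j => p.[a j])).[y]) <=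
  2 * K * (2 / rho) ^+ M * normc (\prod_j (y - a j)).
Proof.
move=> rho0 pK a_inj a_le y_le.
have [_ /mapP [j _ ->] //|h [N [pE sN hK]]] :=
  coef_bound_div_prod (s := [seq a j | j <- enum 'I_M]) rho0 pK.
rewrite size_map size_enum_ord big_map big_enum /= in pE sN hK.
have horner_nodal x : (\prod_j ('X - (a j)%:P)).[x] = \prod_j (x - a j).
  by rewrite horner_prod; apply: eq_bigr => j _; rewrite hornerXsubC.
have NE : N = interp a (fun j => p.[a j]).
  by apply: interp_unique => // j; rewrite pE hornerD hornerM horner_prod_XsubC mulr0 add0r.
rewrite -NE pE hornerD addrK hornerM normcM horner_nodal ler_wpM2r ?normc_ge0 //.
by have := coef_bound_horner rho0 hK y_le; rewrite mulrA.
Qed.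

End CoefficientBounds.

Section DoubleSeries.
Variable R : realType.
Local Notation C := R[i].

Definition limC (u : nat -> C) : C :=
  Complex (limR (fun n => complex.Re (u n))) (limR (fun n => complex.Im (u n))).

Lemma geometric_cvgC (u : nat -> C) (A q : R) : 0 <= q <= 2^-1 ->
  (forall n, normc (u n.+1 - u n) <= A * q ^+ n) ->
  [/\ (fun n => complex.Re (u n)) @ \oo --> complex.Re (limC u),
      (fun n => complex.Im (u n)) @ \oo --> complex.Im (limC u) &
      forall N, normc (limC u - u N) <= 4 * A * q ^+ N].
Proof.
move=> q_half u_step.
have [|cvgRe Re_le] := geometric_cvg (u := fun n => complex.Re (u n)) (A := A) q_half.
  by move=> n; rewrite -raddfB; apply: le_trans (ler_Re_normc _) _.
have [|cvgIm Im_le] := geometric_cvg (u := fun n => complex.Im (u n)) (A := A) q_half.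
  by move=> n; rewrite -raddfB; apply: le_trans (ler_Im_normc _) _.
split=> // N; apply: le_trans (ler_normc_ReIm _) _; rewrite !raddfB /=.
apply: le_trans (lerD (Re_le N) (Im_le N)) _; rewrite -mulrDl.
by rewrite [2 * A + 2 * A](_ : _ = 4 * A) //; ring.
Qed.

Variables (c : nat -> nat -> C) (r K : R).
Hypothesis r_gt0 : 0 < r.
Hypothesis c_le : forall m n, normc (c m n) * r ^+ (m + n) <= K.
Implicit Types (x y : C) (s : R).

Lemma series2_bound_ge0 : 0 <= K.
Proof. by apply: le_trans (c_le 0 0); rewrite mulr_ge0 ?normc_ge0. Qed.

Let K_ge0 := series2_bound_ge0.

Lemma series2_term_le x y s m n : normc x <= s * r -> normc y <= s * r -> 0 <= s ->
  normc (c m n * x ^+ m * y ^+ n) <= K * s ^+ (m + n).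
Proof.
move=> x_le y_le s0; rewrite !normcM !normcX.
have sr0 : 0 <= s * r by rewrite mulr_ge0 // ltW.
apply: (@le_trans _ _ (normc (c m n) * (s * r) ^+ m * (s * r) ^+ n)).
  apply: ler_pM; rewrite ?mulr_ge0 ?exprn_ge0 ?normc_ge0 //.
    by rewrite ler_wpM2l ?normc_ge0 //; apply: lerXn2r; rewrite ?nnegrE ?normc_ge0.
  by apply: lerXn2r; rewrite ?nnegrE ?normc_ge0.
have -> : normc (c m n) * (s * r) ^+ m * (s * r) ^+ n =
    (normc (c m n) * r ^+ (m + n)) * s ^+ (m + n) by rewrite !exprMn !exprD; ring.
by rewrite ler_wpM2r ?exprn_ge0.
Qed.

Lemma psum2S x y N : psum2 c x y N.+1 - psum2 c x y N =
  \sum_(m < N) c m N * x ^+ m * y ^+ N + \sum_(n < N.+1) c N n * x ^+ N * y ^+ n.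
Proof.
rewrite /psum2 big_ord_recr /=; under eq_bigr do rewrite big_ord_recr /=.
by rewrite big_split /=; ring.
Qed.

Lemma psum2_step_le x y s N : normc x <= s * r -> normc y <= s * r -> 0 <= s <= 2^-1 ->
  normc (psum2 c x y N.+1 - psum2 c x y N) <= 4 * K * s ^+ N.
Proof.
move=> x_le y_le s_half; have /andP[s0 _] := s_half.
have row_le n (f : 'I_n -> C) : (forall m, normc (f m) <= K * s ^+ (m + N)) ->
    normc (\sum_m f m) <= 2 * K * s ^+ N.
  move=> f_le; apply: le_trans (ler_normc_sum _ _ _) _.
  apply: (@le_trans _ _ (\sum_(m < n) s ^+ m * (K * s ^+ N))).
    by apply: ler_sum => m _; apply: le_trans (f_le m) _; rewrite exprD mulrCA mulrA.
  by rewrite -mulr_suml -mulrA ler_wpM2r ?mulr_ge0 ?exprn_ge0 // sum_expr_le2.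
rewrite psum2S; apply: le_trans (le_normcD _ _) _.
have -> : 4 * K * s ^+ N = 2 * K * s ^+ N + 2 * K * s ^+ N by ring.
apply: lerD; apply: row_le => m; first exact: series2_term_le.
by rewrite addnC; apply: series2_term_le.
Qed.

Lemma eval_series2_approx x y s :
  normc x <= s * r -> normc y <= s * r -> 0 <= s <= 2^-1 ->
  [/\ (fun N => complex.Re (psum2 c x y N)) @ \oo --> complex.Re (eval_series2 c x y),
      (fun N => complex.Im (psum2 c x y N)) @ \oo --> complex.Im (eval_series2 c x y) &
      forall N, normc (eval_series2 c x y - psum2 c x y N) <= 16 * K * s ^+ N].
Proof.
move=> x_le y_le s_half.
have [cvgRe cvgIm approx] := geometric_cvgC s_half (fun N => psum2_step_le N x_le y_le s_half).
split=> // N; apply: le_trans (approx N) _.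
by rewrite [4 * (4 * K)](_ : _ = 16 * K) //; ring.
Qed.

Lemma eval_series2_approx_half x y N : normc x <= r / 2 -> normc y <= r / 2 ->
  normc (eval_series2 c x y - psum2 c x y N) <= 16 * K * 2^-1 ^+ N.
Proof.
rewrite mulrC => x_le y_le; have [|_ _] := eval_series2_approx x_le y_le; last exact.
by rewrite lexx invr_ge0 ler0n.
Qed.

Lemma eval_series2_le x y : normc x <= r / 2 -> normc y <= r / 2 ->
  normc (eval_series2 c x y) <= 16 * K.
Proof.
move=> x_le y_le; have := eval_series2_approx_half 0 x_le y_le.
by rewrite /psum2 big_ord0 subr0 expr0 mulr1.
Qed.

Definition psum2_poly x N : {poly C} := \poly_(n < N) (\sum_(m < N) c m n * x ^+ m).

Lemma horner_psum2_poly x y N : (psum2_poly x N).[y] = psum2 c x y N.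
Proof.
by rewrite horner_poly /psum2 exchange_big /=; apply: eq_bigr => n _; rewrite mulr_suml.
Qed.

Lemma coef_bound_psum2_poly x N : normc x <= r / 2 -> coef_bound r (2 * K) (psum2_poly x N).
Proof.
move=> x_le n; rewrite coef_poly; case: ifP => _; last by rewrite normc0 mul0r mulr_ge0.
pose s := normc x / r; have s_half : 0 <= s <= 2^-1.
  by rewrite divr_ge0 ?normc_ge0 ?(ltW r_gt0) //= ler_pdivrMr // mulrC.
apply: (@le_trans _ _ ((\sum_(m < N) normc (c m n * x ^+ m)) * r ^+ n)).
  by rewrite ler_wpM2r ?exprn_ge0 ?(ltW r_gt0) // ler_normc_sum.
rewrite mulr_suml; apply: (@le_trans _ _ (\sum_(m < N) s ^+ m * K)).
  apply: ler_sum => m _; rewrite normcM normcX.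
  have -> : normc x = s * r by rewrite /s divfK // gt_eqF.
  have -> : normc (c m n) * (s * r) ^+ m * r ^+ n = s ^+ m * (normc (c m n) * r ^+ (m + n)).
    by rewrite exprMn exprD; ring.
  by rewrite ler_wpM2l ?exprn_ge0 //; case/andP: s_half.
by rewrite -mulr_suml ler_wpM2r // sum_expr_le2.
Qed.

Variables (M : nat) (a : 'I_M -> C) (x : C).
Hypothesis a_inj : injective a.
Hypothesis a_le : forall j, normc (a j) <= r / 2.
Hypothesis x_le : normc x <= r / 2.

Lemma interp_psum2_approx y N :
  normc ((interp a (fun j => psum2 c x (a j) N)).[y] -
         (interp a (fun j => eval_series2 c x (a j))).[y]) <=
  16 * K * (\sum_j normc ((cofactor a j).[y] / (cofactor a j).[a j])) * 2^-1 ^+ N.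
Proof.
rewrite 2!horner_interp -sumrB; apply: le_trans (ler_normc_sum _ _ _) _.
rewrite [leRHS]mulrAC mulr_sumr; apply: ler_sum => j _.
rewrite -mulrBl normcM; apply: ler_wpM2r; first exact: normc_ge0.
by rewrite -normcN opprB; apply: (eval_series2_approx_half N x_le (a_le j)).
Qed.

Lemma interp_series2_error y : normc y <= r / 2 ->
  normc (eval_series2 c x y - (interp a (fun j => eval_series2 c x (a j))).[y]) <=
  4 * K * (2 / r) ^+ M * normc (\prod_j (y - a j)).
Proof.
move=> y_le; pose D := \sum_j normc ((cofactor a j).[y] / (cofactor a j).[a j]).
apply: (ler_add_geometric (A := 16 * K * (1 + D)) (q := 2^-1)) => [|N].
  by rewrite ger0_norm ?invf_lt1 ?invr_ge0 // ltr1n.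
have := interp_error r_gt0 (coef_bound_psum2_poly N x_le) a_inj a_le y_le.
have -> : (fun j => (psum2_poly x N).[a j]) = (fun j => psum2 c x (a j) N).
  by apply/funext => j; rewrite horner_psum2_poly.
rewrite horner_psum2_poly => trunc_error.
have value_error := eval_series2_approx_half N x_le y_le.
have interp_error := interp_psum2_approx y N; rewrite -/D in interp_error.
set q := eval_series2 c x y in value_error *.
set p := psum2 c x y N in trunc_error value_error.
set J := _.[y] in trunc_error interp_error.
set I := (interp a (fun j => eval_series2 c x (a j))).[y] in interp_error *.
have -> : q - I = (q - p) + ((p - J) + (J - I)) by ring.
apply: le_trans (le_normcD _ _) _; have := le_normcD (p - J) (J - I).
have -> : 4 * K * (2 / r) ^+ M = 2 * (2 * K) * (2 / r) ^+ M by ring.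
have -> : 16 * K * (1 + D) * 2^-1 ^+ N = 16 * K * 2^-1 ^+ N + 16 * K * D * 2^-1 ^+ N by ring.
by lra.
Qed.

End DoubleSeries.

(** * Complex-valued functions of a real variable *)

Section ComplexCurves.
Variable R : realType.
Local Notation C := R[i].
Local Notation toC := (real_complex R).
Local Notation Re := (@complex.Re R).
Local Notation Im := (@complex.Im R).
Implicit Types (g h : R -> C) (x : R) (d e z : C) (N P : {poly C}).

Definition is_cderive g x d :=
  is_derive x (1 : R) (fun s => Re (g s)) (Re d) /\
  is_derive x (1 : R) (fun s => Im (g s)) (Im d).

Lemma eq_is_derive (u v : R -> R) x (c c' : R) : u =1 v -> c = c' ->
  is_derive x 1 u c -> is_derive x 1 v c'.
Proof. by move=> /funext -> ->. Qed.

Lemma eq_is_cderive g h x d e : g =1 h -> d = e -> is_cderive g x d -> is_cderive h x e.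
Proof. by move=> /funext -> ->. Qed.

Lemma is_cderive_cst z x : is_cderive (fun=> z) x 0.
Proof. by split; apply: is_derive_cst. Qed.

Lemma is_cderive_real x : is_cderive toC x 1.
Proof. by split; [apply: is_derive_id|apply: is_derive_cst]. Qed.

Lemma is_cderiveD g h x d e : is_cderive g x d -> is_cderive h x e ->
  is_cderive (fun s => g s + h s) x (d + e).
Proof.
move=> [gr gi] [hr hi]; split.
  by apply: eq_is_derive (is_deriveD gr hr) => [s|]; rewrite /= raddfD.
by apply: eq_is_derive (is_deriveD gi hi) => [s|]; rewrite /= raddfD.
Qed.

Lemma is_cderiveM g h x d e : is_cderive g x d -> is_cderive h x e ->
  is_cderive (fun s => g s * h s) x (d * h x + g x * e).
Proof.
move=> [gr gi] [hr hi]; split.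
  apply: eq_is_derive (is_deriveB (is_deriveM gr hr) (is_deriveM gi hi)) => [s|].
    by rewrite !fctE; case: (g s) => a b; case: (h s) => u v.
  case: (g x) => a b; case: (h x) => u v; case: d {gr gi} => d1 d2; case: e {hr hi} => e1 e2.
  by rewrite /GRing.scale /=; ring.
apply: eq_is_derive (is_deriveD (is_deriveM gr hi) (is_deriveM gi hr)) => [s|].
  by rewrite !fctE; case: (g s) => a b; case: (h s) => u v.
case: (g x) => a b; case: (h x) => u v; case: d {gr gi} => d1 d2; case: e {hr hi} => e1 e2.
by rewrite /GRing.scale /=; ring.
Qed.

Lemma is_cderiveV g x d : g x != 0 -> is_cderive g x d ->
  is_cderive (fun s => (g s)^-1) x (- (d * ((g x)^-1 * (g x)^-1))).
Proof.
move=> g0 [gr gi].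
pose n s := Re (g s) * Re (g s) + Im (g s) * Im (g s).
have n0 : n x != 0 by move: g0; rewrite -sqnormC_eq0 /sqnormC /n !expr2.
have dV := is_deriveV n0 (is_deriveD (is_deriveM gr gr) (is_deriveM gi gi)).
split.
  apply: eq_is_derive (is_deriveM gr dV) => [s|].
    by rewrite !fctE /n; case: (g s) => a b /=; rewrite !expr2.
  move: n0; rewrite /n; case: (g x) => a b /=; case: d {gr gi dV} => d1 d2 /=.
  by rewrite /GRing.scale /= !expr2 => n0; field.
apply: eq_is_derive (is_deriveN (is_deriveM gi dV)) => [s|].
  by rewrite !fctE /n; case: (g s) => a b /=; rewrite !expr2.
move: n0; rewrite /n; case: (g x) => a b /=; case: d {gr gi dV} => d1 d2 /=.
by rewrite /GRing.scale /= !expr2 => n0; field.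
Qed.

Lemma is_cderive_horner (p : {poly C}) g x d : is_cderive g x d ->
  is_cderive (fun s => p.[g s]) x (p^`().[g x] * d).
Proof.
move=> dg; elim/poly_ind: p => [|p c IH].
  apply: eq_is_cderive (is_cderive_cst 0 x) => [s|]; rewrite ?horner0 //.
  by rewrite deriv0 horner0 mul0r.
apply: eq_is_cderive (is_cderiveD (is_cderiveM IH dg) (is_cderive_cst c x)) => [s|].
  by rewrite hornerMXaddC.
by rewrite derivMXaddC hornerD hornerMX; ring.
Qed.

Lemma is_cderive_continuous g x d : is_cderive g x d ->
  {for x, continuous (fun s => Re (g s))} /\ {for x, continuous (fun s => Im (g s))}.
Proof.
move=> [[gr _] [gi _]]; split.
  exact: (differentiable_continuous (proj1 (derivable1_diffP _ _) gr)).
exact: (differentiable_continuous (proj1 (derivable1_diffP _ _) gi)).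
Qed.

Lemma continuous_sqnormC g : (forall x, exists d, is_cderive g x d) ->
  continuous (fun x => sqnormC (g x)).
Proof.
move=> dg x; have [d /is_cderive_continuous [cr ci]] := dg x.
exact: (continuousD (continuousM cr cr) (continuousM ci ci)).
Qed.

Definition ratio N P z := N.[z] / P.[z].

Definition ratio_deriv N P := ratio (N^`() * P - N * P^`()) (P ^+ 2).

Lemma is_cderive_ratio N P g x d : P.[g x] != 0 -> is_cderive g x d ->
  is_cderive (fun s => ratio N P (g s)) x (ratio_deriv N P (g x) * d).
Proof.
move=> P0 dg; have dV := is_cderiveV P0 (is_cderive_horner P dg).
apply: eq_is_cderive (is_cderiveM (is_cderive_horner N dg) dV) => //.
by rewrite /ratio_deriv /ratio expr2 hornerD hornerN !hornerM; field.
Qed.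

Lemma integral_is_derive (F f : R -> R) (a b : R) : a < b ->
  (forall x, x \in `[a, b] -> is_derive x (1 : R) F (f x)) ->
  (forall x, x \in `[a, b] -> {for x, continuous f}) ->
  (\int[@lebesgue_measure R]_(x in `[a, b]) (f x)%:E = (F b - F a)%:E)%E.
Proof.
move=> ab dF cf; have cF x : x \in `[a, b] -> {for x, continuous F}.
  by move=> /dF [dx _]; apply: differentiable_continuous; apply/derivable1_diffP.
rewrite (continuous_FTC2 (F := F) ab) //.
- by apply: continuous_in_subspaceT => x; rewrite inE => xab; apply: cf.
- split.
  + by move=> x /subset_itv_oo_cc xab; have [] := dF _ xab.
  + by apply: cvg_at_right_filter; apply: cF; rewrite bound_itvE ltW.
  + by apply: cvg_at_left_filter; apply: cF; rewrite bound_itvE ltW.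
- by move=> x /subset_itv_oo_cc xab; rewrite derive1E; have [_] := dF _ xab.
Qed.

End ComplexCurves.

Section ComplexMeasurability.
Context d (T : measurableType d) (R : realType).
Local Notation C := R[i].
Local Notation toC := (real_complex R).
Variable D : set T.
Implicit Types (g h : T -> C) (u : T -> R).

Lemma measurable_inv : measurable_fun [set: R] (fun x : R => x^-1).
Proof.
have -> : [set: R] = [set~ 0] `|` [set 0] by rewrite setUC setUv.
apply/measurable_funU; first exact: measurableC.
  exact: measurable_set1.
split; last exact: measurable_fun_set1.
apply: open_continuous_measurable_fun.
  by apply: closed_openC; apply: closed_eq.
by move=> x; rewrite inE /= => /eqP; apply: inv_continuous.
Qed.

Definition cmeasurable g :=
  measurable_fun D (fun s => complex.Re (g s)) /\ measurable_fun D (fun s => complex.Im (g s)).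

Lemma eq_cmeasurable g h : g =1 h -> cmeasurable g -> cmeasurable h.
Proof. by move=> /funext ->. Qed.

Lemma cmeasurable_cst z : cmeasurable (fun=> z).
Proof. by split; apply: measurable_cst. Qed.

Lemma cmeasurable_real u : measurable_fun D u -> cmeasurable (fun s => toC (u s)).
Proof. by move=> mu; split=> //; apply: measurable_cst. Qed.

Lemma cmeasurableD g h : cmeasurable g -> cmeasurable h -> cmeasurable (fun s => g s + h s).
Proof.
move=> [gr gi] [hr hi]; split.
  by under eq_fun do rewrite raddfD; apply: measurable_funD.
by under eq_fun do rewrite raddfD; apply: measurable_funD.
Qed.

Lemma cmeasurableM g h : cmeasurable g -> cmeasurable h -> cmeasurable (fun s => g s * h s).
Proof.
have ReM z w : complex.Re (z * w) =
    complex.Re z * complex.Re w - complex.Im z * complex.Im w :> R.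
  by case: z => a b; case: w.
have ImM z w : complex.Im (z * w) =
    complex.Re z * complex.Im w + complex.Im z * complex.Re w :> R.
  by case: z => a b; case: w.
move=> [gr gi] [hr hi]; split.
  by under eq_fun do rewrite ReM; apply: measurable_funB; apply: measurable_funM.
by under eq_fun do rewrite ImM; apply: measurable_funD; apply: measurable_funM.
Qed.

Lemma measurable_sqnormC g : cmeasurable g -> measurable_fun D (fun s => sqnormC (g s)).
Proof. by move=> [gr gi]; apply: measurable_funD; apply: measurable_funX. Qed.

Lemma cmeasurableV g : cmeasurable g -> cmeasurable (fun s => (g s)^-1).
Proof.
have ReV z : complex.Re z^-1 = complex.Re z * (sqnormC z)^-1 :> R by case: z.
have ImV z : complex.Im z^-1 = - complex.Im z * (sqnormC z)^-1 :> R.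
  by case: z => a b /=; rewrite mulNr.
move=> mg; have [gr gi] := mg.
have m_inv : measurable_fun D (fun s => (sqnormC (g s))^-1).
  exact: measurableT_comp measurable_inv (measurable_sqnormC mg).
split; first by under eq_fun do rewrite ReV; apply: measurable_funM.
by under eq_fun do rewrite ImV; apply: measurable_funM => //; apply: measurable_funN.
Qed.

Lemma cmeasurable_horner (p : {poly C}) g : cmeasurable g -> cmeasurable (fun s => p.[g s]).
Proof.
move=> mg; elim/poly_ind: p => [|p c IH].
  by apply: eq_cmeasurable (cmeasurable_cst 0) => s; rewrite horner0.
apply: eq_cmeasurable (cmeasurableD (cmeasurableM IH mg) (cmeasurable_cst c)) => s.
by rewrite hornerMXaddC.
Qed.

Lemma cmeasurableX g n : cmeasurable g -> cmeasurable (fun s => g s ^+ n).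
Proof. by move=> /(cmeasurable_horner 'X^n); apply: eq_cmeasurable => s; rewrite hornerXn. Qed.

Lemma cmeasurable_ratio (N P : {poly C}) g : cmeasurable g ->
  cmeasurable (fun s => ratio N P (g s)).
Proof.
by move=> mg; apply: cmeasurableM; [|apply: cmeasurableV]; apply: cmeasurable_horner.
Qed.

Lemma cmeasurable_sum (I : Type) (s : seq I) (f : I -> T -> C) :
  (forall i, cmeasurable (f i)) -> cmeasurable (fun p => \sum_(i <- s) f i p).
Proof.
move=> mf; elim: s => [|i s IH].
  by apply: eq_cmeasurable (cmeasurable_cst 0) => p; rewrite big_nil.
by apply: eq_cmeasurable (cmeasurableD (mf i) IH) => p; rewrite big_cons.
Qed.

Lemma cmeasurable_prod (I : Type) (s : seq I) (f : I -> T -> C) :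
  (forall i, cmeasurable (f i)) -> cmeasurable (fun p => \prod_(i <- s) f i p).
Proof.
move=> mf; elim: s => [|i s IH].
  by apply: eq_cmeasurable (cmeasurable_cst 1) => p; rewrite big_nil.
by apply: eq_cmeasurable (cmeasurableM (mf i) IH) => p; rewrite big_cons.
Qed.

End ComplexMeasurability.

(** * Integrals of real-valued functions *)

Section RealIntegrals.
Context d (T : measurableType d) (R : realType).
Variables (m : {measure set T -> \bar R}) (D : set T).
Hypothesis mD : measurable D.
Implicit Types (f g : T -> R) (k : R).

Lemma ge0_le_integral_EFin f g : measurable_fun D f -> measurable_fun D g ->
  (forall x, D x -> 0 <= f x) -> (forall x, D x -> f x <= g x) ->
  (\int[m]_(x in D) (f x)%:E <= \int[m]_(x in D) (g x)%:E)%E.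
Proof. by move=> mf mg f0 fg; apply: ge0_le_integral => //; apply/measurable_EFinP. Qed.

Lemma norm_le_integral_EFin f g : measurable_fun D f -> measurable_fun D g ->
  (forall x, D x -> `|f x| <= g x) ->
  (\int[m]_(x in D) (f x)%:E <= \int[m]_(x in D) (g x)%:E)%E.
Proof.
move=> mf mg fg; apply: le_trans (lee_abs _) _; apply: le_trans (le_abse_integral _ mD _) _.
  by apply/measurable_EFinP.
by apply: ge0_le_integral_EFin => //; apply: measurableT_comp.
Qed.

Lemma ge0_integral_EFinD f g : measurable_fun D f -> measurable_fun D g ->
  (forall x, D x -> 0 <= f x) -> (forall x, D x -> 0 <= g x) ->
  (\int[m]_(x in D) (f x + g x)%:E = \int[m]_(x in D) (f x)%:E + \int[m]_(x in D) (g x)%:E)%E.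
Proof. by move=> mf mg f0 g0; rewrite -ge0_integralD //; apply/measurable_EFinP. Qed.

Lemma ge0_integral_EFinZ f k : measurable_fun D f -> (forall x, D x -> 0 <= f x) -> 0 <= k ->
  (\int[m]_(x in D) (k * f x)%:E = k%:E * \int[m]_(x in D) (f x)%:E)%E.
Proof. by move=> mf f0 k0; rewrite -ge0_integralZl_EFin //; apply/measurable_EFinP. Qed.

Lemma ge0_integral_EFin_sum (I : Type) (s : seq I) (f : I -> T -> R) :
  (forall i, measurable_fun D (f i)) -> (forall i x, D x -> 0 <= f i x) ->
  (\int[m]_(x in D) (\sum_(i <- s) f i x)%:E = \sum_(i <- s) \int[m]_(x in D) (f i x)%:E)%E.
Proof.
move=> mf f0; rewrite -ge0_integral_sum //.
- by apply: eq_integral => x _; rewrite -sumEFin.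
- by move=> i; apply/measurable_EFinP.
Qed.

Lemma ge0_subset_integral_EFin (A : set T) f : measurable A -> A `<=` D -> measurable_fun D f ->
  (forall x, D x -> 0 <= f x) ->
  (\int[m]_(x in A) (f x)%:E <= \int[m]_(x in D) (f x)%:E)%E.
Proof. by move=> mA AD mf f0; apply: ge0_subset_integral => //; apply/measurable_EFinP. Qed.

End RealIntegrals.

Section Rectangles.
Context d1 d2 (T1 : measurableType d1) (T2 : measurableType d2) (R : realType).
Variables (m1 : {sigma_finite_measure set T1 -> \bar R}).
Variables (m2 : {sigma_finite_measure set T2 -> \bar R}).
Variables (A1 : set T1) (A2 : set T2) (f : T1 * T2 -> R).
Hypotheses (mA1 : measurable A1) (mA2 : measurable A2).
Hypothesis mf : measurable_fun (A1 `*` A2) f.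

Let restr := (EFin \o f) \_ (A1 `*` A2).

Let mA : measurable (A1 `*` A2). Proof. exact: measurableX. Qed.

Let restrE x y : restr (x, y) = if (x \in A1) && (y \in A2) then (f (x, y))%:E else 0%E.
Proof. by rewrite /restr patchE in_setX. Qed.

Let integral_restr_snd x :
  (\int[m2]_y restr (x, y) = ((fun x => \int[m2]_(y in A2) (f (x, y))%:E) \_ A1) x)%E.
Proof.
rewrite patchE; case: ifPn => xA.
  by rewrite [RHS]integral_mkcond; apply: eq_integral => y _; rewrite restrE xA patchE.
by apply: integral0_eq => y _; rewrite restrE (negbTE xA).
Qed.

Let integral_restr_fst y :
  (\int[m1]_x restr (x, y) = ((fun y => \int[m1]_(x in A1) (f (x, y))%:E) \_ A2) y)%E.
Proof.
rewrite patchE; case: ifPn => yA.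
  by rewrite [RHS]integral_mkcond; apply: eq_integral => x _; rewrite restrE yA andbT patchE.
by apply: integral0_eq => x _; rewrite restrE (negbTE yA) andbF.
Qed.

Lemma fubini_rectangle (B : R) : (m1 A1 < +oo)%E -> (m2 A2 < +oo)%E ->
  (forall x y, A1 x -> A2 y -> `|f (x, y)| <= B) ->
  (\int[m1]_(x in A1) \int[m2]_(y in A2) (f (x, y))%:E =
   \int[m2]_(y in A2) \int[m1]_(x in A1) (f (x, y))%:E)%E.
Proof.
move=> fin1 fin2 fB.
have int_f : (m1 \x m2)%E.-integrable (A1 `*` A2) (EFin \o f).
  apply: measurable_bounded_integrable => //.
    have measA : (m1 \x m2)%E (A1 `*` A2) = (m1 A1 * m2 A2)%E by exact: product_measure1E.
    apply: (@le_lt_trans _ _ (m1 A1 * m2 A2)%E); first by rewrite -measA.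
    by apply: lte_mul_pinfty; rewrite ?ge0_fin_numE.
  exists B; split; first exact: num_real.
  by move=> B' /ltW BB' [x y] [/= xA yA]; apply: le_trans BB'; apply: fB.
have := Fubini (proj1 (integrable_mkcond _ mA) int_f); rewrite -/restr.
under eq_integral do rewrite integral_restr_snd.
under [X in _ = X -> _]eq_integral do rewrite integral_restr_fst.
by rewrite -!integral_mkcond.
Qed.

Hypothesis f_ge0 : forall p, 0 <= f p.

Let restr_ge0 p : (0 <= restr p)%E.
Proof. by rewrite /restr patchE; case: ifP => // _; rewrite lee_fin. Qed.

Let mrestr : measurable_fun setT restr.
Proof. by apply: (proj1 (measurable_restrictT _ mA)); apply/measurable_EFinP. Qed.

Lemma measurable_integral_fst :
  measurable_fun A1 (fun x => \int[m2]_(y in A2) (f (x, y))%:E)%E.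
Proof.
have /(measurable_funTS (D := A1)) : measurable_fun setT (fubini_F m2 restr).
  exact: measurable_fun_fubini_tonelli_F.
apply: eq_measurable_fun => x; rewrite inE => xA.
by rewrite /fubini_F integral_restr_snd patchE mem_set.
Qed.

Lemma tonelli_rectangle :
  (\int[m1 \x m2]_(p in A1 `*` A2) (f p)%:E =
   \int[m1]_(x in A1) \int[m2]_(y in A2) (f (x, y))%:E)%E.
Proof.
rewrite integral_mkcond (fubini_tonelli1 _ mrestr restr_ge0) [RHS]integral_mkcond.
by apply: eq_integral => x _; rewrite /fubini_F integral_restr_snd.
Qed.

End Rectangles.

(** * The half-disc estimate *)

Section HalfDisc.
Variable R : realType.
Local Notation C := R[i].
Local Notation toC := (real_complex R).
Local Notation Re := (@complex.Re R).
Local Notation Im := (@complex.Im R).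
Local Notation mu := (@lebesgue_measure R).
Implicit Types (r theta : R) (z : C).

Definition unitC theta : C := Complex (cos theta) (sin theta).

Lemma normc_unitC theta : normc (unitC theta) = 1.
Proof. by rewrite /normc /= cos2Dsin2 sqrtr1. Qed.

Lemma cmeasurable_unitC d (T : measurableType d) (D : set T) (u : T -> R) :
  measurable_fun D u -> cmeasurable D (fun p => unitC (u p)).
Proof.
move=> mu; split.
  apply: (measurableT_comp (f := @cos R)) => //.
  by apply: continuous_measurable_fun; apply: continuous_cos.
apply: (measurableT_comp (f := @sin R)) => //.
by apply: continuous_measurable_fun; apply: continuous_sin.
Qed.

Lemma normc_horner_le (p : {poly C}) (rho : R) z : normc z <= rho ->
  normc p.[z] <= \sum_(i < size p) normc p`_i * rho ^+ i.
Proof.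
move=> z_le; rewrite horner_coef; apply: le_trans (ler_normc_sum _ _ _) _; apply: ler_sum => i _.
rewrite normcM normcX ler_wpM2l ?normc_ge0 //; apply: lerXn2r; rewrite ?nnegrE ?normc_ge0 //.
exact: le_trans (normc_ge0 _) z_le.
Qed.

Lemma normc_ratio_le (N P : {poly C}) (delta rho : R) z : 0 < delta -> delta <= normc P.[z] ->
  normc z <= rho -> normc (ratio N P z) <= (\sum_(i < size N) normc N`_i * rho ^+ i) / delta.
Proof.
move=> delta0 P_ge z_le; rewrite normcM normcV; apply: ler_pM; rewrite ?invr_ge0 ?normc_ge0 //.
  exact: normc_horner_le.
by rewrite lef_pV2 ?posrE // (lt_le_trans delta0).
Qed.

Variables (N P : {poly C}) (a rho V delta : R).
Hypothesis rho_gt0 : 0 < rho.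
Hypothesis delta_gt0 : 0 < delta.
Hypothesis P_ge : forall z : C, 0 <= Im z -> delta <= normc P.[z].

Definition polar r theta : C := toC a + toC r * unitC theta.

Lemma Im_polar r theta : Im (polar r theta) = r * sin theta.
Proof. by rewrite /polar /unitC /=; ring. Qed.

Lemma normc_polar_le r theta : 0 <= r -> normc (polar r theta) <= `|a| + r.
Proof.
move=> r0; apply: le_trans (le_normcD _ _) _.
by rewrite normcM normc_unitC mulr1 !normc_real (ger0_norm r0).
Qed.

Lemma is_cderive_polar_radius r theta : is_cderive (polar^~ theta) r (unitC theta).
Proof.
apply: eq_is_cderive (is_cderiveD (is_cderive_cst (toC a) r)
  (is_cderiveM (is_cderive_real r) (is_cderive_cst (unitC theta) r))) => //.
by ring.
Qed.

Lemma is_cderive_unitC theta : is_cderive unitC theta (Complex (- sin theta) (cos theta)).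
Proof. by split; [apply: is_derive_cos|apply: is_derive_sin]. Qed.

Lemma is_cderive_polar_angle r theta :
  is_cderive (polar r) theta (toC r * Complex (- sin theta) (cos theta)).
Proof.
apply: eq_is_cderive (is_cderiveD (is_cderive_cst (toC a) theta)
  (is_cderiveM (is_cderive_cst (toC r) theta) (is_cderive_unitC theta))) => //.
by ring.
Qed.

Lemma upper_half_neq0 r theta : 0 <= r -> 0 <= theta <= pi -> P.[polar r theta] != 0.
Proof.
move=> r0 theta_pi; rewrite -normc_gt0; apply: lt_le_trans delta_gt0 (P_ge _).
by rewrite Im_polar mulr_ge0 // sin_ge0_pi.
Qed.

(* By the Cauchy-Riemann equations this is both minus the radial derivative of
   the imaginary part of [ratio N P] and 1/r times the angular derivative of
   its real part. *)
Definition polar_deriv r theta : R := - Im (ratio_deriv N P (polar r theta) * unitC theta).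

Lemma is_cderive_ratio_deriv (g : R -> C) x d : P.[g x] != 0 -> is_cderive g x d ->
  exists e, is_cderive (fun s => ratio_deriv N P (g s)) x e.
Proof.
by move=> P0 dg; eexists; apply: is_cderive_ratio dg; rewrite horner_exp expf_neq0.
Qed.

Lemma integral_polar_radius theta : 0 <= theta <= pi ->
  (\int[mu]_(r in `[0%R, rho]) (polar_deriv r theta)%:E =
   (Im (ratio N P (toC a)) - Im (ratio N P (polar rho theta)))%:E)%E.
Proof.
move=> theta_pi; pose F r := - Im (ratio N P (polar r theta)).
have P_neq0 r : r \in `[0%R, rho] -> P.[polar r theta] != 0.
  by rewrite in_itv /= => /andP[r0 _]; apply: upper_half_neq0.
transitivity (F rho - F 0)%:E; last first.
  by rewrite /F /polar mul0r addr0 -/(polar rho theta) opprK addrC.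
apply: integral_is_derive => // r /P_neq0 P0.
  have [_ dIm] := is_cderive_ratio (g := polar^~ theta) N P0 (is_cderive_polar_radius r theta).
  exact: is_deriveN dIm.
have [e de] := is_cderive_ratio_deriv (g := polar^~ theta) P0 (is_cderive_polar_radius r theta).
have [_ cIm] := is_cderive_continuous (is_cderiveM de (is_cderive_cst (unitC theta) r)).
exact: continuousN cIm.
Qed.

Lemma integral_polar_angle r : 0 < r ->
  (\int[mu]_(theta in `[0%R, pi]) (polar_deriv r theta)%:E =
   ((Re (ratio N P (toC (a - r))) - Re (ratio N P (toC (a + r)))) / r)%:E)%E.
Proof.
move=> r0; pose F theta := r^-1 * Re (ratio N P (polar r theta)).
have P_neq0 theta : theta \in `[0%R, pi] -> P.[polar r theta] != 0.
  by rewrite in_itv /= => theta_pi; apply: upper_half_neq0 => //; apply: ltW.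
have polar0 : polar r 0 = toC (a + r).
  by apply: eq_ReIm; rewrite /polar /unitC /= cos0 sin0; ring.
have polar_pi : polar r pi = toC (a - r).
  by apply: eq_ReIm; rewrite /polar /unitC /= cospi sinpi; ring.
transitivity (F pi - F 0)%:E; last by rewrite /F polar0 polar_pi; congr (_%:E); ring.
apply: integral_is_derive => [|theta /P_neq0 P0|theta /P_neq0 P0]; first exact: pi_gt0.
  have [dRe _] := is_cderive_ratio N P0 (is_cderive_polar_angle r theta).
  apply: eq_is_derive (is_deriveM (is_derive_cst r^-1 theta 1) dRe) => //.
  rewrite /polar_deriv /unitC scaler0 addr0 /GRing.scale; case: (ratio_deriv _ _ _) => u v /=.
  by field; rewrite gt_eqF.
have [e de] := is_cderive_ratio_deriv P0 (is_cderive_polar_angle r theta).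
have [_ cIm] := is_cderive_continuous (is_cderiveM de (is_cderive_unitC theta)).
exact: continuousN cIm.
Qed.

Lemma cmeasurable_polar d (T : measurableType d) (D : set T) (u v : T -> R) :
  measurable_fun D u -> measurable_fun D v -> cmeasurable D (fun p => polar (u p) (v p)).
Proof.
move=> mu mv; apply: cmeasurableD; first exact: cmeasurable_cst.
by apply: cmeasurableM; [apply: cmeasurable_real|apply: cmeasurable_unitC].
Qed.

Lemma measurable_polar_deriv d (T : measurableType d) (D : set T) (u v : T -> R) :
  measurable_fun D u -> measurable_fun D v ->
  measurable_fun D (fun p => polar_deriv (u p) (v p)).
Proof.
move=> mu mv; have m_polar := cmeasurable_polar mu mv.
have m_ratio := cmeasurable_ratio (N^`() * P - N * P^`()) (P ^+ 2) m_polar.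
by have [_ mIm] := cmeasurableM m_ratio (cmeasurable_unitC mv); apply: measurable_funN.
Qed.

Lemma polar_deriv_bounded : exists B, forall r theta,
  0 <= r <= rho -> 0 <= theta <= pi -> `|polar_deriv r theta| <= B.
Proof.
eexists => r theta /andP[r0 r_le] theta_pi; rewrite normrN; apply: le_trans (ler_Im_normc _) _.
rewrite normcM normc_unitC mulr1 /ratio_deriv.
apply: (normc_ratio_le _ (exprn_gt0 2 delta_gt0) (rho := `|a| + rho)).
  rewrite horner_exp normcX lerXn2r ?nnegrE ?normc_ge0 ?(ltW delta_gt0) // P_ge //.
  by rewrite Im_polar mulr_ge0 // sin_ge0_pi.
by apply: le_trans (normc_polar_le _ r0) _; rewrite lerD2l.
Qed.

Lemma polar_deriv_fubini :
  (\int[mu]_(r in `]0%R, rho]) \int[mu]_(theta in `[0%R, pi]) (polar_deriv r theta)%:E =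
   \int[mu]_(theta in `[0%R, pi]) \int[mu]_(r in `]0%R, rho]) (polar_deriv r theta)%:E)%E.
Proof.
have [B polar_deriv_le] := polar_deriv_bounded.
apply: (@fubini_rectangle _ _ _ _ _ mu mu _ _ (fun p => polar_deriv p.1 p.2) _ _ _ B) => //=.
- apply: measurable_funTS; apply: measurable_polar_deriv; first exact: measurable_fst.
  exact: measurable_snd.
- by rewrite lebesgue_measure_itv /= lte_fin rho_gt0 -EFinB ltry.
- by rewrite lebesgue_measure_itv /= lte_fin pi_gt0 -EFinB ltry.
- move=> r theta; rewrite !in_itv /= => /andP[r0 r_le] theta_pi.
  by apply: polar_deriv_le => //; rewrite (ltW r0).
Qed.

Hypothesis V_ge : forall theta, 0 <= theta <= pi -> normc (ratio N P (polar rho theta)) <= V.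

Lemma integral_arc_ge : V < Im (ratio N P (toC a)) ->
  ((pi * (Im (ratio N P (toC a)) - V))%:E <=
   \int[mu]_(theta in `[0%R, pi]) (Im (ratio N P (toC a)) - Im (ratio N P (polar rho theta)))%:E)%E.
Proof.
set c := Im (ratio N P (toC a)) => Vc.
apply: (@le_trans _ _ (\int[mu]_(theta in `[0%R, pi]) (c - V)%:E)%E).
  rewrite integral_cst; last exact: measurable_itv.
  by rewrite /= lebesgue_measure_itv /= lte_fin pi_gt0 -EFinB -EFinM subr0 mulrC.
apply: ge0_le_integral_EFin => [||||theta]; first exact: measurable_itv.
- exact: measurable_cst.
- apply: measurable_funB; first exact: measurable_cst.
  have m_polar := cmeasurable_polar (measurable_cst rho) (@measurable_id _ _ `[0%R, pi]%classic).
  exact: (proj2 (cmeasurable_ratio N P m_polar)).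
- by move=> theta _; rewrite subr_ge0 ltW.
rewrite /= in_itv /= => theta_pi; rewrite lerD2l lerN2; apply: le_trans (ler_norm _) _.
by apply: le_trans (ler_Im_normc _) _; apply: V_ge.
Qed.

Lemma half_disc_estimate : ((pi * (Im (ratio N P (toC a)) - V))%:E <=
  \int[mu]_(r in `]0%R, rho])
    ((`|Re (ratio N P (toC (a + r)))| + `|Re (ratio N P (toC (a - r)))|) / r)%:E)%E.
Proof.
have [c_le|Vc] := leP (Im (ratio N P (toC a))) V.
  apply: (@le_trans _ _ 0%E); first by rewrite lee_fin mulr_ge0_le0 ?pi_ge0 // subr_le0.
  apply: integral_ge0 => r /=; rewrite in_itv /= => /andP[r0 _].
  by rewrite lee_fin divr_ge0 // ?addr_ge0 // ltW.
apply: le_trans (integral_arc_ge Vc) _.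
have -> : (\int[mu]_(theta in `[0%R, pi])
      (Im (ratio N P (toC a)) - Im (ratio N P (polar rho theta)))%:E =
    \int[mu]_(theta in `[0%R, pi]) \int[mu]_(r in `]0%R, rho]) (polar_deriv r theta)%:E)%E.
  apply: eq_integral => theta; rewrite inE /= in_itv /= => theta_pi.
  rewrite -integral_polar_radius //; apply/esym/integral_itv_obnd_cbnd.
  apply/measurable_EFinP/measurable_polar_deriv; first exact: measurable_id.
  exact: measurable_cst.
rewrite -polar_deriv_fubini; under eq_integral => r.
  rewrite inE /= in_itv /= => /andP[r0 _]; rewrite integral_polar_angle //; over.
have m_ratio (s : R -> R) : measurable_fun `]0%R, rho] s ->
    measurable_fun `]0%R, rho] (fun r => Re (ratio N P (toC (s r)))).
  by move=> ms; have [] := cmeasurable_ratio N P (cmeasurable_real ms).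
have m_add := m_ratio _ (measurable_funD (measurable_cst a) (@measurable_id _ _ _)).
have m_sub := m_ratio _ (measurable_funB (measurable_cst a) (@measurable_id _ _ _)).
have m_inv : measurable_fun `]0%R, rho] (fun r : R => r^-1).
  by apply: measurable_funTS; apply: measurable_inv.
apply: norm_le_integral_EFin => [|||r]; first exact: measurable_itv.
- by apply: measurable_funM => //; apply: measurable_funB.
- by apply: measurable_funM => //; apply: measurable_funD; apply: measurableT_comp.
rewrite /= in_itv /= => /andP[r0 _]; rewrite normrM normfV (gtr0_norm r0).
by rewrite ler_wpM2r ?invr_ge0 ?(ltW r0) // addrC (le_trans (ler_normD _ _)) ?normrN.
Qed.

End HalfDisc.

(** * Integrals along a fiber *)

Section Translations.
Variable R : realType.
Local Notation mu := (@lebesgue_measure R).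
Implicit Types (G : R -> R) (D : set R) (a b u v rho e : R).

Lemma continuous_measurable_funS G D : continuous G -> measurable_fun D G.
Proof. by move=> cG; apply: measurable_funTS; apply: continuous_measurable_fun. Qed.

Lemma continuous_translation a : continuous (fun r => a + r).
Proof. by move=> r; apply: continuousD; [apply: cst_continuous|apply: cvg_id]. Qed.

Lemma continuous_reflection a : continuous (fun r => a - r).
Proof. by move=> r; apply: continuousB; [apply: cst_continuous|apply: cvg_id]. Qed.

Lemma integral_translation G a u v : u <= v -> continuous G ->
  (\int[mu]_(y in `[(a + u)%R, (a + v)%R]) (G y)%:E = \int[mu]_(r in `[u, v]) (G (a + r))%:E)%E.
Proof.
move=> uv cG; have derivE : (fun r : R => a + r : R)^`()%classic = cst 1.
  apply/funext => r; rewrite derive1E.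
  by have [_ ->] := is_deriveD (is_derive_cst a r 1) (is_derive_id r (1 : R)); rewrite add0r.
rewrite (@integration_by_substitution_increasing _ (fun r => a + r) G) //.
- by apply: eq_integral => r _; rewrite derivE /= mulr1.
- by move=> x y _ _ xy; rewrite ltrD2l.
- by rewrite derivE => x _; apply: cst_continuous.
- by rewrite derivE; apply: is_cvg_cst.
- by rewrite derivE; apply: is_cvg_cst.
- split.
  + by move=> x _; apply: derivableD; [apply: derivable_cst|apply: derivable_id].
  + by apply: cvg_at_right_filter; apply: continuous_translation.
  + by apply: cvg_at_left_filter; apply: continuous_translation.
- exact: continuous_subspaceT.
Qed.

Lemma integral_translate_le G a rho e : 0 <= rho -> rho + `|a| <= e ->
  continuous G -> (forall y, 0 <= G y) ->
  (\int[mu]_(r in `]0%R, rho]) (G (a + r))%:E <= \int[mu]_(y in `[(- e)%R, e]) (G y)%:E)%E.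
Proof.
move=> rho0 rho_e cG G0; have := ler_norm a; have := ler_norm (- a); rewrite normrN => Na_le a_le.
have mG D : measurable_fun D (fun r => G (a + r)).
  apply: continuous_measurable_funS => r; apply: continuous_comp; last exact: cG.
  exact: continuous_translation.
rewrite integral_itv_obnd_cbnd; last by apply/measurable_EFinP; apply: mG.
rewrite -integral_translation //; apply: ge0_subset_integral_EFin => //.
- by move=> y /=; rewrite !in_itv /= => /andP[y_ge y_le]; apply/andP; split; lra.
- exact: continuous_measurable_funS.
Qed.

Lemma integral_reflect_le G a rho e : 0 <= rho -> rho + `|a| <= e ->
  continuous G -> (forall y, 0 <= G y) ->
  (\int[mu]_(r in `]0%R, rho]) (G (a - r))%:E <= \int[mu]_(y in `[(- e)%R, e]) (G y)%:E)%E.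
Proof.
move=> rho0 rho_e cG G0; have e0 : 0 <= e by apply: le_trans rho_e; rewrite addr_ge0.
have := @integration_by_substitution_oppr _ G (- e) e _ (continuous_subspaceT cG).
rewrite opprK => ->; last by lra.
have -> : (fun r => (G (a - r))%:E) = (fun r => ((G \o -%R) (- a + r))%:E).
  by apply/funext => r /=; rewrite opprD opprK.
apply: integral_translate_le => //; first by rewrite normrN.
- by move=> y; apply: continuous_comp; [apply: opp_continuous|apply: cG].
- by move=> y; apply: G0.
Qed.

Lemma integral_cst_itv e k : 0 <= e -> (\int[mu]_(y in `[(- e)%R, e]) k%:E = (k * (2 * e))%:E)%E.
Proof.
move=> e0; rewrite integral_cst; last exact: measurable_itv.
rewrite /= lebesgue_measure_itv /= lte_fin; case: ltP => [_|e_le].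
  by rewrite -EFinD -EFinM; congr (_%:E); ring.
by rewrite mule0 (_ : e = 0) ?mulr0 //; lra.
Qed.

End Translations.

Section PoissonKernel.
Variable R : realType.
Local Notation C := R[i].
Local Notation toC := (real_complex R).
Local Notation Im := (@complex.Im R).
Local Notation mu := (@lebesgue_measure R).
Implicit Types (w : C) (y e : R).

Lemma is_derive_poisson w y : 0 < Im w ->
  is_derive y (1 : R) (fun s => atan ((s + complex.Re w) / Im w)) (poisson w y).
Proof.
move=> w0; have Im_neq0 : Im w != 0 by rewrite gt_eqF.
have affine : is_derive y (1 : R) (fun s => (s + complex.Re w) / Im w) (Im w)^-1.
  apply: eq_is_derive (is_deriveM (is_deriveD (is_derive_id y (1 : R))
    (is_derive_cst (complex.Re w) y 1)) (is_derive_cst (Im w)^-1 y 1)) => //.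
  by rewrite scaler0 add0r addr0 /GRing.scale /= mulr1.
apply: eq_is_derive (is_derive1_comp (is_derive1_atan _) affine) => //.
have := sqnormC_add_gt0 y w0; rewrite /poisson /sqnormC !raddfD /= add0r => denom_gt0.
by field; rewrite Im_neq0 /= gt_eqF // addrC.
Qed.

Lemma continuous_poisson w : 0 < Im w -> continuous (poisson w).
Proof.
move=> w0 y; apply: (continuousM (@cst_continuous _ _ (Im w) y)).
apply: continuousV; first by rewrite gt_eqF // sqnormC_add_gt0.
apply: continuous_sqnormC => s; eexists.
exact: is_cderiveD (is_cderive_real s) (is_cderive_cst w s).
Qed.

Lemma integral_poisson_le w e : 0 < Im w -> 0 < e ->
  (\int[mu]_(y in `[(- e)%R, e]) (poisson w y)%:E <= pi%:E)%E.
Proof.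
move=> w0 e0; pose F s := atan ((s + complex.Re w) / Im w).
have -> : (\int[mu]_(y in `[(- e)%R, e]) (poisson w y)%:E = (F e - F (- e))%:E)%E.
  apply: integral_is_derive => [|y _|y _]; first by lra.
  - exact: is_derive_poisson.
  - exact: continuous_poisson.
rewrite lee_fin /F; have := atan_ltpi2 ((e + complex.Re w) / Im w).
by have := atan_gtNpi2 ((- e + complex.Re w) / Im w); lra.
Qed.

Variables (M : nat) (nu : 'I_M -> C).
Hypothesis nu_gt0 : forall k, 0 < Im (nu k).

Lemma continuous_poisson_sum : continuous (poisson_sum nu).
Proof.
rewrite /poisson_sum; elim: (index_enum _) => [|k s IH].
  by under eq_fun do rewrite big_nil; apply: cst_continuous.
under eq_fun do rewrite big_cons.
by move=> y; apply: continuousD; [apply: continuous_poisson|apply: IH].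
Qed.

Lemma integral_poisson_sum_le e : 0 < e ->
  (\int[mu]_(y in `[(- e)%R, e]) (poisson_sum nu y)%:E <= (M%:R * pi)%:E)%E.
Proof.
move=> e0; rewrite ge0_integral_EFin_sum.
- apply: (@le_trans _ _ (\sum_(k < M) pi%:E)%E); last first.
    by rewrite sumEFin lee_fin sumr_const card_ord mulr_natl.
  by apply: lee_sum => k _; apply: integral_poisson_le.
- exact: measurable_itv.
- by move=> k; apply: continuous_measurable_funS; apply: continuous_poisson.
- by move=> k y _; apply: poisson_ge0; apply: ltW.
Qed.

End PoissonKernel.

Section Inequalities.
Variable R : realType.

Lemma weighted_cauchy_schwarz (I : finType) (w u v : I -> R) : (forall i, 0 < w i) ->
  (\sum_i u i * v i) ^+ 2 <= (\sum_i u i ^+ 2 / w i) * (\sum_i w i * v i ^+ 2).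
Proof.
move=> w0; set S := \sum_i u i * v i; set U := \sum_i _ / _; set V := \sum_i _ * _ ^+ 2.
have lagrange : \sum_i \sum_j (u i * v j * w j - u j * v i * w i) ^+ 2 / (w i * w j) =
    U * V + V * U - (S * S + S * S).
  rewrite !big_distrlr -!big_split -sumrB; apply: eq_bigr => i _ /=.
  rewrite -!big_split -sumrB; apply: eq_bigr => j _ /=.
  by field; rewrite !gt_eqF.
have : 0 <= \sum_i \sum_j (u i * v j * w j - u j * v i * w i) ^+ 2 / (w i * w j).
  by apply: sumr_ge0 => i _; apply: sumr_ge0 => j _; rewrite divr_ge0 ?sqr_ge0 ?mulr_ge0 ?ltW.
by rewrite lagrange [V * U]mulrC expr2; lra.
Qed.

Lemma norm_mulf_div_le (x y p g w lam : R) : 0 < lam -> 0 < w -> 0 < p -> w * y ^+ 2 <= g * p ->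
  `|x * y| / p <= 2^-1 * (lam * (x ^+ 2 / p) + (lam * w)^-1 * g).
Proof.
move=> lam0 w0 p0 y_le; rewrite ler_pdivrMr // normrM.
have -> : 2^-1 * (lam * (x ^+ 2 / p) + (lam * w)^-1 * g) * p =
    2^-1 * (lam * x ^+ 2 + (lam * w)^-1 * (g * p)) by field; rewrite !gt_eqF.
apply: (@le_trans _ _ (2^-1 * (lam * x ^+ 2 + (lam * w)^-1 * (w * y ^+ 2)))); last first.
  by rewrite ler_wpM2l // lerD2l ler_wpM2l // invr_ge0 mulr_ge0 ?ltW.
rewrite -(real_normK (num_real x)) -(real_normK (num_real y)) -subr_ge0.
have -> : 2^-1 * (lam * `|x| ^+ 2 + (lam * w)^-1 * (w * `|y| ^+ 2)) - `|x| * `|y| =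
    (2 * lam)^-1 * (lam * `|x| - `|y|) ^+ 2 by field; rewrite !gt_eqF.
by rewrite mulr_ge0 ?sqr_ge0 // invr_ge0 mulr_ge0 ?ltW.
Qed.

(* The parameter is chosen as [lam = 2 * m / (w * v)]. *)
Lemma optimize_parameter (v V w m p : R) (J : \bar R) :
  0 <= v -> 0 < w -> 0 < m -> 0 < p -> (0 <= J)%E ->
  (forall lam, 0 < lam -> ((p * (v - V))%:E <= lam%:E * J + (m * p / (lam * w))%:E)%E) ->
  ((w * v ^+ 2)%:E <= (4 * V ^+ 2 * w)%:E + (8 * m / p)%:E * J)%E.
Proof.
move=> v_ge0 w0 m0 p0 J0 le_lam; have c0 : 0 < 8 * m / p by rewrite divr_gt0 ?mulr_gt0.
have [->|J_fin] := eqVneq J +oo%E; first by rewrite gt0_muley ?lte_fin // addey // leey.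
have {}J_fin : J \is a fin_num by rewrite ge0_fin_numE // lt_neqAle J_fin leey.
move: J0 le_lam; rewrite -(fineK J_fin); set x := fine J; rewrite lee_fin => x0 le_lam.
rewrite -EFinM -EFinD lee_fin; have [->|v_neq0] := eqVneq v 0.
  rewrite expr0n mulr0 addr_ge0 // mulr_ge0 ?(ltW w0) ?(ltW c0) //.
  by rewrite mulr_ge0 ?sqr_ge0.
have v0 : 0 < v by rewrite lt_neqAle eq_sym v_neq0.
have := le_lam (2 * m / (w * v)); rewrite divr_gt0 ?mulr_gt0 // => /(_ isT).
rewrite -EFinM -EFinD lee_fin.
have -> : m * p / (2 * m / (w * v) * w) = p * v / 2 by field; rewrite !gt_eqF.
move=> opt; have : w * v * (v - 2 * V) <= 4 * m / p * x.
  have -> : w * v * (v - 2 * V) = 2 * w * v / p * (p * (v - V) - p * v / 2).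
    by field; rewrite gt_eqF.
  have -> : 4 * m / p * x = 2 * w * v / p * (2 * m / (w * v) * x) by field; rewrite !gt_eqF.
  apply: ler_wpM2l; first by rewrite divr_ge0 ?mulr_ge0 // ltW.
  by rewrite lerBlDr.
have -> : 8 * m / p * x = 2 * (4 * m / p * x) by ring.
by have := mulr_ge0 (ltW w0) (sqr_ge0 (v - 2 * V)); nra.
Qed.

Lemma sqnormC_le_dist (z w : R[i]) : sqnormC z <= 2 * sqnormC w + 2 * sqnormC (z - w).
Proof.
case: z w => [a b] [c d]; rewrite /sqnormC /=.
by have := sqr_ge0 (a - 2 * c); have := sqr_ge0 (b - 2 * d); nra.
Qed.

Lemma integral_affine_le (f g : R -> R) (e k c : R) : 0 <= e -> 0 <= k -> 0 <= c ->
  measurable_fun `[- e, e] f -> measurable_fun `[- e, e] g ->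
  (forall y, 0 <= f y) -> (forall y, 0 <= g y) ->
  (forall y, `|y| <= e -> f y <= k * g y + c) ->
  (\int[@lebesgue_measure R]_(y in `[(- e)%R, e]) (f y)%:E <=
   k%:E * \int[@lebesgue_measure R]_(y in `[(- e)%R, e]) (g y)%:E + (c * (2 * e))%:E)%E.
Proof.
move=> e0 k0 c0 mf mg f0 g0 fg.
have mkg : measurable_fun `[- e, e] (fun y => k * g y).
  by apply: measurable_funM => //; apply: measurable_cst.
rewrite -integral_cst_itv // -ge0_integral_EFinZ // -ge0_integral_EFinD //.
- apply: ge0_le_integral_EFin => //; first exact: measurable_funD.
  by move=> y; rewrite /= in_itv /= -ler_norml; apply: fg.
- by move=> y _; apply: mulr_ge0.
Qed.

End Inequalities.

Section FiberBounds.
Variable R : realType.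
Local Notation C := R[i].
Local Notation toC := (real_complex R).
Local Notation Re := (@complex.Re R).
Local Notation Im := (@complex.Im R).
Local Notation mu := (@lebesgue_measure R).

Definition sqratio (N P : {poly C}) (y : R) : R := sqnormC (ratio N P (toC y)).

Lemma sqratio_ge0 N P y : 0 <= sqratio N P y.
Proof. exact: sqnormC_ge0. Qed.

Lemma continuous_sqratio N P : (forall y, P.[toC y] != 0) -> continuous (sqratio N P).
Proof.
move=> P_neq0; apply: continuous_sqnormC => y; eexists.
exact: is_cderive_ratio (P_neq0 y) (is_cderive_real y).
Qed.

Lemma sqratio_real (N : {poly R}) P y :
  sqratio (map_poly toC N) P y = N.[y] ^+ 2 / sqnormC P.[toC y].
Proof. by rewrite /sqratio /ratio horner_map sqnormCM sqnormCV sqnormC_real. Qed.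

Lemma sqratio_re_im N P y : sqratio N P y =
  sqratio (map_poly toC (rePoly N)) P y + sqratio (map_poly toC (imPoly N)) P y.
Proof.
by rewrite !sqratio_real /sqratio /ratio horner_real sqnormCM sqnormCV mulrDl.
Qed.

Variables (M : nat) (nu : 'I_M -> C) (t : R) (a : 'I_M -> R) (e : R).
Hypothesis nu_gt0 : forall k, 0 < Im (nu k).
Hypothesis pencil_roots : pencil (fiberP nu) t = \prod_j ('X - (a j)%:P).
Hypothesis e_gt0 : 0 < e.
Local Notation P := (fiberP nu).
Local Notation fiber_integral N := (\int[mu]_(y in `[(- e)%R, e]) (sqratio N P y)%:E)%E.
Implicit Types (j : 'I_M) (N : {poly R}) (s y lam rho V : R).

Lemma fiberP_real_neq0 y : P.[toC y] != 0.
Proof. exact: (fiberP_neq0 nu_gt0). Qed.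

Lemma fiber_integral_ge0 (N : {poly C}) : (0 <= fiber_integral N)%E.
Proof. by apply: integral_ge0 => y _; rewrite lee_fin sqratio_ge0. Qed.

Lemma measurable_sqratio (N : {poly C}) (D : set R) : measurable_fun D (sqratio N P).
Proof.
by apply: continuous_measurable_funS; apply: continuous_sqratio; apply: fiberP_real_neq0.
Qed.

(* For a real polynomial [N], the real part of [(1 + i t) N / P] on the real
   axis is [N * pencil P t / |P|^2], so at a root [a j] of the pencil this
   quotient is purely imaginary. *)
Definition twist s N : {poly C} := (toC s * Complex 1 t) *: map_poly toC N.

Lemma Re_twist_ratio s N y : Re (ratio (twist s N) P (toC y)) =
  s * (N.[y] * (pencil P t).[y] / sqnormC P.[toC y]).
Proof.
have := sqnormC_fiberP_gt0 nu_gt0 y.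
rewrite /ratio /twist hornerZ horner_map horner_real /pencil hornerD hornerZ /sqnormC /=.
by move=> P_gt0; field; rewrite gt_eqF.
Qed.

Lemma imPoly_root_neq0 j : (imPoly P).[a j] != 0.
Proof.
have := wronskian_root_gt0 nu_gt0 a j; rewrite (wronskian_root pencil_roots).
by apply: contraTneq => ->; rewrite mul0r ltxx.
Qed.

Lemma Im_twist_ratio_root s N j :
  Im (ratio (twist s N) P (toC (a j))) = - s * (N.[a j] / (imPoly P).[a j]).
Proof.
have := pencil_root pencil_roots j; rewrite /pencil hornerD hornerZ => /eqP.
rewrite addr_eq0 => /eqP re_im; have := imPoly_root_neq0 j.
rewrite /ratio /twist hornerZ horner_map horner_real re_im /=.
set b := (imPoly P).[a j] => b0.
have t_gt0 : 0 < 1 + t ^+ 2 by rewrite ltr_pwDl ?sqr_ge0.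
have -> : (- (t * b)) ^+ 2 + b ^+ 2 = b ^+ 2 * (1 + t ^+ 2) by ring.
by field; rewrite b0 gt_eqF.
Qed.

Lemma normc_twist_ratio_le s N z : `|s| <= 1 ->
  normc (ratio (twist s N) P z) <= (1 + `|t|) * normc (ratio (map_poly toC N) P z).
Proof.
move=> s1; rewrite /ratio /twist hornerZ -mulrA normcM ler_wpM2r ?normc_ge0 //.
rewrite normcM normc_real -[leRHS]mul1r ler_pM ?normc_ge0 //.
by apply: le_trans (ler_normc_ReIm _) _; rewrite normr1.
Qed.

(* The arithmetic-geometric mean bound for |N * cofactor a j| / |P|^2, the
   parameter [lam] being chosen in [optimize_parameter]. *)
Definition twist_majorant N lam j y : R :=
  2^-1 * (lam * sqratio (map_poly toC N) P y + (lam * weight nu a j)^-1 * poisson_sum nu y).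

Lemma twist_majorant_ge0 N lam j y : 0 < lam -> 0 <= twist_majorant N lam j y.
Proof.
move=> lam0; have w0 := weight_gt0 nu_gt0 pencil_roots j.
rewrite mulr_ge0 // addr_ge0 ?mulr_ge0 ?sqratio_ge0 ?poisson_sum_ge0 ?(ltW lam0) //.
by rewrite invr_ge0 mulr_ge0 ?ltW.
Qed.

Lemma continuous_twist_majorant N lam j : continuous (twist_majorant N lam j).
Proof.
have scale k (f : R -> R) : continuous f -> continuous (fun y => k * f y).
  by move=> cf y; apply: continuousM; [apply: cst_continuous|apply: cf].
apply: (scale _ (fun y => _ + _)) => y.
have c_sqratio := scale lam _ (continuous_sqratio (N := map_poly toC N) fiberP_real_neq0).
have c_poisson := scale (lam * weight nu a j)^-1 _ (continuous_poisson_sum nu_gt0).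
exact: continuousD (c_sqratio y) (c_poisson y).
Qed.

Lemma integral_twist_majorant_le N lam j : 0 < lam ->
  (2%:E * \int[mu]_(y in `[(- e)%R, e]) (twist_majorant N lam j y)%:E <=
   lam%:E * fiber_integral (map_poly toC N) + (M%:R * pi / (lam * weight nu a j))%:E)%E.
Proof.
move=> lam0; have lw_gt0 : 0 < lam * weight nu a j.
  by rewrite mulr_gt0 // (weight_gt0 nu_gt0 pencil_roots).
have m_sqratio : measurable_fun `[- e, e] (sqratio (map_poly toC N) P).
  exact: measurable_sqratio.
have m_poisson : measurable_fun `[- e, e] (poisson_sum nu).
  by apply: continuous_measurable_funS; apply: continuous_poisson_sum.
have m_scale k (f : R -> R) : measurable_fun `[- e, e] f ->
    measurable_fun `[- e, e] (fun y => k * f y).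
  by move=> mf; apply: measurable_funM => //; apply: measurable_cst.
have poisson0 y := poisson_sum_ge0 nu_gt0 y.
have inv_ge0 : 0 <= (lam * weight nu a j)^-1 by rewrite invr_ge0 ltW.
rewrite ge0_integral_EFinZ //; [|by apply: measurable_funD; apply: m_scale|]; last first.
  by move=> y _; rewrite addr_ge0 ?mulr_ge0 ?sqratio_ge0 ?(ltW lam0).
rewrite muleA -EFinM divff ?pnatr_eq0 // mul1e ge0_integral_EFinD //; first last.
- by move=> y _; rewrite mulr_ge0.
- by move=> y _; rewrite mulr_ge0 ?sqratio_ge0 ?(ltW lam0).
- exact: m_scale.
- exact: m_scale.
apply: leeD.
  by rewrite ge0_integral_EFinZ ?(ltW lam0) // => y _; apply: sqratio_ge0.
rewrite ge0_integral_EFinZ // [M%:R * pi / _]mulrC EFinM lee_wpmul2l ?lee_fin //.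
exact: integral_poisson_sum_le.
Qed.

Lemma measurable_Re_twist_ratio s N (D : set R) (u : R -> R) : measurable_fun D u ->
  measurable_fun D (fun r => `|Re (ratio (twist s N) P (toC (u r)))|).
Proof.
move=> m_u; apply: measurableT_comp => //.
exact: (proj1 (cmeasurable_ratio (twist s N) P (cmeasurable_real m_u))).
Qed.

Lemma Re_twist_ratio_le s N lam j y : `|s| <= 1 -> 0 < lam -> y != a j ->
  `|Re (ratio (twist s N) P (toC y))| / `|y - a j| <= twist_majorant N lam j y.
Proof.
move=> s1 lam0 y_neq; have w0 := weight_gt0 nu_gt0 pencil_roots j.
have P0 := sqnormC_fiberP_gt0 nu_gt0 y.
have dist0 : 0 < `|y - a j| by rewrite normr_gt0 subr_eq0.
rewrite Re_twist_ratio (pencil_cofactor pencil_roots j) hornerM hornerXsubC.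
apply: (@le_trans _ _ (`|N.[y] * (cofactor a j).[y]| / sqnormC P.[toC y])).
  rewrite normrM mulrCA normrM normfV [`|(_ - _) * _|]normrM (gtr0_norm P0).
  rewrite ler_pdivrMr // mulrC -!mulrA [leLHS]mulrCA.
  by rewrite ler_wpM2l // mulrCA ler_wpM2l ?invr_ge0 ?(ltW P0) // ler_piMr.
rewrite /twist_majorant sqratio_real; apply: norm_mulf_div_le => //.
by rewrite -(wronskian_poisson nu_gt0); apply: (weight_cofactor_le nu_gt0 pencil_roots).
Qed.

Lemma integral_Re_twist_ratio_le s N lam j rho : `|s| <= 1 -> 0 < lam ->
  0 < rho -> rho + `|a j| <= e ->
  (\int[mu]_(r in `]0%R, rho]) ((`|Re (ratio (twist s N) P (toC (a j + r)))| +
      `|Re (ratio (twist s N) P (toC (a j - r)))|) / r)%:E <=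
   2%:E * \int[mu]_(y in `[(- e)%R, e]) (twist_majorant N lam j y)%:E)%E.
Proof.
move=> s1 lam0 rho0 rho_e; pose G := twist_majorant N lam j.
have G0 y : 0 <= G y by apply: twist_majorant_ge0.
have cG : continuous G by apply: continuous_twist_majorant.
have c_sub := @continuous_reflection _ (a j); have c_add := @continuous_translation _ (a j).
have mG (u : R -> R) : continuous u -> measurable_fun `]0%R, rho] (fun r => G (u r)).
  move=> cu; apply: continuous_measurable_funS => r.
  by apply: continuous_comp; [apply: cu|apply: cG].
have m_inv : measurable_fun `]0%R, rho] (fun r : R => r^-1).
  by apply: measurable_funTS; apply: measurable_inv.
apply: (@le_trans _ _ (\int[mu]_(r in `]0%R, rho]) (G (a j + r) + G (a j - r))%:E)%E).
  apply: ge0_le_integral_EFin => [||||r]; first exact: measurable_itv.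
  - apply: measurable_funM => //.
    by apply: measurable_funD; apply: measurable_Re_twist_ratio; apply: continuous_measurable_funS.
  - by apply: measurable_funD; apply: mG.
  - by move=> r; rewrite /= in_itv /= => /andP[r0 _]; rewrite divr_ge0 ?addr_ge0 // ltW.
  rewrite /= in_itv /= => /andP[r0 _]; rewrite mulrDl.
  have dist_add : `|a j + r - a j| = r by rewrite addrAC subrr add0r gtr0_norm.
  have dist_sub : `|a j - r - a j| = r by rewrite addrAC subrr add0r normrN gtr0_norm.
  apply: lerD.
  - rewrite -{2}dist_add.
    by rewrite Re_twist_ratio_le // -subr_eq0 -normr_eq0 dist_add gt_eqF.
  - rewrite -{2}dist_sub.
    by rewrite Re_twist_ratio_le // -subr_eq0 -normr_eq0 dist_sub gt_eqF.
rewrite ge0_integral_EFinD //; [|exact: mG|exact: mG].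
rewrite mule_natl mule2n; apply: leeD.
  exact: integral_translate_le (ltW rho0) rho_e cG G0.
exact: integral_reflect_le (ltW rho0) rho_e cG G0.
Qed.

Lemma root_value_le N V lam j rho : 0 < lam -> 0 < rho -> rho + `|a j| <= e ->
  (forall z, normc (z - toC (a j)) = rho ->
    (1 + `|t|) * normc (ratio (map_poly toC N) P z) <= V) ->
  ((pi * (`|N.[a j] / (imPoly P).[a j]| - V))%:E <=
   lam%:E * fiber_integral (map_poly toC N) + (M%:R * pi / (lam * weight nu a j))%:E)%E.
Proof.
move=> lam0 rho0 rho_e V_ge; pose s := - Num.sg (N.[a j] / (imPoly P).[a j]).
have s1 : `|s| <= 1 by rewrite normrN normr_sg; case: eqP.
have Im_at_root : Im (ratio (twist s N) P (toC (a j))) = `|N.[a j] / (imPoly P).[a j]|.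
  by rewrite Im_twist_ratio_root opprK -normrEsg.
have prod_Im_gt0 : 0 < \prod_k Im (nu k) by apply: prodr_gt0.
apply: le_trans (integral_twist_majorant_le N j lam0).
apply: le_trans (integral_Re_twist_ratio_le N s1 lam0 rho0 rho_e); rewrite -Im_at_root.
apply: (half_disc_estimate rho0 prod_Im_gt0 (normc_fiberP_ge nu_gt0)) => theta _.
apply: le_trans (normc_twist_ratio_le _ _ s1) _; apply: V_ge.
by rewrite /polar addrAC subrr add0r normcM normc_unitC mulr1 normc_real gtr0_norm.
Qed.

Lemma sqr_root_value_le N V j rho : 0 < rho -> rho + `|a j| <= e ->
  (forall z, normc (z - toC (a j)) = rho ->
    (1 + `|t|) * normc (ratio (map_poly toC N) P z) <= V) ->
  ((N.[a j] ^+ 2 / (wronskian P).[a j])%:E <=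
   (4 * V ^+ 2 * weight nu a j)%:E + (8 * M%:R / pi)%:E * fiber_integral (map_poly toC N))%E.
Proof.
move=> rho0 rho_e V_ge; have w0 := weight_gt0 nu_gt0 pencil_roots j.
have M_gt0 : 0 < M%:R :> R by rewrite ltr0n (leq_ltn_trans _ (ltn_ord j)).
have cofactor_neq : (cofactor a j).[a j] != 0.
  exact: cofactor_neq0 (pencil_roots_inj nu_gt0 pencil_roots) j.
have -> : N.[a j] ^+ 2 / (wronskian P).[a j] =
    weight nu a j * `|N.[a j] / (imPoly P).[a j]| ^+ 2.
  rewrite real_normK ?num_real // (wronskian_root pencil_roots) /weight.
  by field; rewrite imPoly_root_neq0.
apply: optimize_parameter => // [||lam lam0]; [exact: pi_gt0|exact: fiber_integral_ge0|].
exact: root_value_le rho0 rho_e V_ge.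
Qed.

Lemma sqnormC_root_value_le (N : {poly C}) V0 delta j rho : 0 < rho -> rho + `|a j| <= e ->
  0 < delta -> (forall z, normc (z - toC (a j)) = rho -> delta <= normc P.[z]) ->
  (forall z, normc z <= e -> normc N.[z] <= V0) ->
  ((sqnormC N.[toC (a j)] / (wronskian P).[a j])%:E <=
   (8 * ((1 + `|t|) * (V0 / delta)) ^+ 2 * weight nu a j)%:E +
   (8 * M%:R / pi)%:E * fiber_integral N)%E.
Proof.
move=> rho0 rho_e delta0 P_ge N_le; set V := (1 + `|t|) * (V0 / delta).
have ratio_le (N1 : {poly R}) : (forall z, normc z <= e -> normc (map_poly toC N1).[z] <= V0) ->
    forall z, normc (z - toC (a j)) = rho ->
    (1 + `|t|) * normc (ratio (map_poly toC N1) P z) <= V.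
  move=> N1_le z z_rho; rewrite ler_wpM2l ?addr_ge0 // normcM normcV ler_pM ?normc_ge0 //.
  - by rewrite invr_ge0 normc_ge0.
  - apply: N1_le; apply: le_trans (ler_normc_add_dist z (toC (a j))) _.
    by rewrite z_rho normc_real addrC.
  - by rewrite lef_pV2 ?posrE ?P_ge // (lt_le_trans delta0) ?P_ge.
have parts_le z : normc z <= e -> normc (map_poly toC (rePoly N)).[z] <= V0 /\
    normc (map_poly toC (imPoly N)).[z] <= V0.
  by move=> z_le; apply: normc_re_imPoly_le; apply: N_le; rewrite ?normc_conj.
have re_le := sqr_root_value_le rho0 rho_e (ratio_le _ (fun z z_le => proj1 (parts_le z z_le))).
have im_le := sqr_root_value_le rho0 rho_e (ratio_le _ (fun z z_le => proj2 (parts_le z z_le))).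
have -> : sqnormC N.[toC (a j)] / (wronskian P).[a j] =
    (rePoly N).[a j] ^+ 2 / (wronskian P).[a j] + (imPoly N).[a j] ^+ 2 / (wronskian P).[a j].
  by rewrite horner_real /sqnormC mulrDl.
have -> : fiber_integral N =
    (fiber_integral (map_poly toC (rePoly N)) + fiber_integral (map_poly toC (imPoly N)))%E.
  rewrite -ge0_integral_EFinD //; first by apply: eq_integral => y _; rewrite -sqratio_re_im.
  - exact: measurable_sqratio.
  - exact: measurable_sqratio.
  - by move=> y _; apply: sqratio_ge0.
  - by move=> y _; apply: sqratio_ge0.
rewrite EFinD; apply: le_trans (leeD re_le im_le) _.
rewrite addeACA -EFinD (ge0_muleDr _ (fiber_integral_ge0 _) (fiber_integral_ge0 _)).
set w := weight nu a j.
by rewrite (_ : 8 * V ^+ 2 * w = 4 * V ^+ 2 * w + 4 * V ^+ 2 * w) //; ring.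
Qed.

Variables (Q : C -> C) (kappa : R).
Hypothesis kappa_ge0 : 0 <= kappa.
Hypothesis mQ : cmeasurable `[- e, e] (fun y => Q (toC y)).
Local Notation interpQ := (interp (fun j => toC (a j)) (fun j => Q (toC (a j)))).
Hypothesis interp_error : forall y, `|y| <= e ->
  normc (Q (toC y) - interpQ.[toC y]) <= kappa * `|(pencil P t).[y]|.

Definition quotient_integral : \bar R :=
  \int[mu]_(y in `[(- e)%R, e]) (sqnormC (Q (toC y) / P.[toC y]))%:E.

Definition branch_ratio j : R := sqnormC (Q (toC (a j))) / (wronskian P).[a j].

Lemma branch_ratio_ge0 j : 0 <= branch_ratio j.
Proof. by rewrite divr_ge0 ?sqnormC_ge0 // ltW // (wronskian_root_gt0 nu_gt0). Qed.

Lemma measurable_sqnormC_quotient :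
  measurable_fun `[- e, e] (fun y => sqnormC (Q (toC y) / P.[toC y])).
Proof.
apply: measurable_sqnormC; apply: cmeasurableM => //; apply: cmeasurableV.
by apply: cmeasurable_horner; apply: cmeasurable_real; apply: measurable_id.
Qed.

Lemma quotient_integral_ge0 : (0 <= quotient_integral)%E.
Proof. by apply: integral_ge0 => y _; rewrite lee_fin sqnormC_ge0. Qed.

Let error_sqr : R := 2 * (kappa ^+ 2 * (1 + t ^+ 2)).

Let error_sqr_ge0 : 0 <= error_sqr.
Proof. by rewrite mulr_ge0 // mulr_ge0 ?addr_ge0 ?sqr_ge0. Qed.

Lemma sqnormC_quotient_le_dist z w y : normc (z - w) <= kappa * `|(pencil P t).[y]| ->
  sqnormC (z / P.[toC y]) <= 2 * sqnormC (w / P.[toC y]) + error_sqr.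
Proof.
move=> dist_le; have P0 := sqnormC_fiberP_gt0 nu_gt0 y.
rewrite !sqnormCM sqnormCV ler_pdivrMr // mulrDl mulrA divfK ?gt_eqF //.
apply: le_trans (sqnormC_le_dist z w) _; rewrite lerD2l -sqr_normc /error_sqr.
rewrite -mulrA ler_wpM2l // -[leRHS]mulrA.
apply: (@le_trans _ _ ((kappa * `|(pencil P t).[y]|) ^+ 2)).
  by apply: lerXn2r; rewrite ?nnegrE ?normc_ge0 ?mulr_ge0.
rewrite exprMn ler_wpM2l ?sqr_ge0 // real_normK ?num_real //; exact: sqr_pencil_le.
Qed.

Lemma integral_interp_le :
  (fiber_integral interpQ <= 2%:E * quotient_integral + (error_sqr * (2 * e))%:E)%E.
Proof.
apply: integral_affine_le => //; first exact: ltW.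
- exact: measurable_sqratio.
- exact: measurable_sqnormC_quotient.
- by move=> y; apply: sqratio_ge0.
- by move=> y; apply: sqnormC_ge0.
by move=> y /interp_error y_le; apply: sqnormC_quotient_le_dist; rewrite -normcN opprB.
Qed.

Lemma quotient_integral_le_interp :
  (quotient_integral <= 2%:E * fiber_integral interpQ + (error_sqr * (2 * e))%:E)%E.
Proof.
apply: integral_affine_le => //; first exact: ltW.
- exact: measurable_sqnormC_quotient.
- exact: measurable_sqratio.
- by move=> y; apply: sqnormC_ge0.
- by move=> y; apply: sqratio_ge0.
by move=> y /interp_error y_le; apply: sqnormC_quotient_le_dist.
Qed.

Lemma sqnormC_interp_le y :
  sqnormC interpQ.[toC y] <= (\sum_j branch_ratio j) * (wronskian P).[y].
Proof.
have w0 j := weight_gt0 nu_gt0 pencil_roots j.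
pose u j := normc (Q (toC (a j))) / `|(cofactor a j).[a j]|.
have -> : \sum_j branch_ratio j = \sum_j u j ^+ 2 / weight nu a j.
  apply: eq_bigr => j _; rewrite /branch_ratio (wronskian_root_weight nu_gt0 pencil_roots).
  by rewrite /u expr_div_n real_normK ?num_real // sqr_normc invfM mulrA mulrAC.
have -> : (wronskian P).[y] = \sum_j weight nu a j * `|(cofactor a j).[y]| ^+ 2.
  rewrite (wronskian_sum_sqr nu_gt0 pencil_roots) horner_sum; apply: eq_bigr => j _.
  by rewrite hornerZ horner_exp real_normK ?num_real.
apply: le_trans (weighted_cauchy_schwarz _ _ w0).
rewrite -sqr_normc; apply: lerXn2r; rewrite ?nnegrE ?normc_ge0 //.
  by apply: sumr_ge0 => j _; rewrite mulr_ge0 ?divr_ge0 ?normc_ge0.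
rewrite horner_interp; apply: le_trans (ler_normc_sum _ _ _) _; apply: ler_sum => j _.
rewrite normcM -!map_cofactor !horner_map -fmorphV -rmorphM normc_real /u normrM normfV.
by rewrite mulrAC mulrA.
Qed.

Lemma quotient_integral_le : (quotient_integral <=
  (2 * (M%:R * pi) * (\sum_j branch_ratio j) + error_sqr * (2 * e))%:E)%E.
Proof.
apply: le_trans quotient_integral_le_interp _; rewrite [leRHS]EFinD leeD2r // -mulrA EFinM.
rewrite lee_wpmul2l ?lee_fin // mulrC EFinM.
set S := \sum_j branch_ratio j.
have S0 : 0 <= S by apply: sumr_ge0 => j _; apply: branch_ratio_ge0.
have m_poisson : measurable_fun `[- e, e] (poisson_sum nu).
  by apply: continuous_measurable_funS; apply: continuous_poisson_sum.
apply: (@le_trans _ _ (\int[mu]_(y in `[(- e)%R, e]) (S * poisson_sum nu y)%:E)%E).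
  apply: ge0_le_integral_EFin => //.
  - exact: measurable_sqratio.
  - by apply: measurable_funM => //; apply: measurable_cst.
  - by move=> y _; apply: sqratio_ge0.
  move=> y _; rewrite /sqratio /ratio sqnormCM sqnormCV ler_pdivrMr ?(sqnormC_fiberP_gt0 nu_gt0) //.
  by rewrite -mulrA -(wronskian_poisson nu_gt0); apply: sqnormC_interp_le.
rewrite ge0_integral_EFinZ // => [|y _]; last exact: poisson_sum_ge0.
by rewrite lee_wpmul2l ?lee_fin //; apply: integral_poisson_sum_le.
Qed.

Variable V0 : R.
Hypothesis nu_le : forall k, normc (nu k) <= e / 8.
Hypothesis a_le : forall j, `|a j| <= e / 4.
Hypothesis interp_le : forall z, normc z <= e -> normc interpQ.[z] <= V0.

Lemma normc_fiberP_arc_ge z j : normc (z - toC (a j)) = e / 2 -> (e / 8) ^+ M <= normc P.[z].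
Proof.
move=> z_arc; rewrite horner_fiberP normc_prod -[X in _ ^+ X]card_ord -prodr_const.
apply: ler_prod => k _; rewrite divr_ge0 ?(ltW e_gt0) //=.
have := le_normcD (z + nu k) (- (toC (a j) + nu k)).
have -> : z + nu k - (toC (a j) + nu k) = z - toC (a j) by ring.
have := le_normcD (toC (a j)) (nu k); rewrite normcN z_arc normc_real.
by have := a_le j; have := nu_le k; lra.
Qed.

Lemma branch_ratio_le j : ((branch_ratio j)%:E <=
  (8 * ((1 + `|t|) * (V0 / (e / 8) ^+ M)) ^+ 2 * (M%:R * e) +
   8 * M%:R / pi * (error_sqr * (2 * e)))%:E + (8 * M%:R / pi * 2)%:E * quotient_integral)%E.
Proof.
have rho0 : 0 < e / 2 by rewrite divr_gt0.
have delta0 : 0 < (e / 8) ^+ M by rewrite exprn_gt0 // divr_gt0.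
have rho_e : e / 2 + `|a j| <= e by have := a_le j; have := e_gt0; lra.
have weight_le_e : weight nu a j <= M%:R * e.
  apply: le_trans (weight_le nu_gt0 pencil_roots j) _.
  rewrite -[M in M%:R]card_ord mulr_natl -sumr_const; apply: ler_sum => k _.
  apply: le_trans (ler_norm _) _; apply: le_trans (ler_Im_normc _) _.
  by apply: le_trans (nu_le k) _; have := e_gt0; lra.
have := sqnormC_root_value_le rho0 rho_e delta0 (fun z => @normc_fiberP_arc_ge z j) interp_le.
have toC_inj : injective (fun j => toC (a j)).
  by move=> i k /complexI; apply: (pencil_roots_inj nu_gt0 pencil_roots).
rewrite interp_node // => /le_trans; apply.
have c0 : (0 <= (8 * M%:R / pi)%:E :> \bar R)%E by rewrite lee_fin divr_ge0 ?mulr_ge0 ?pi_ge0.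
rewrite EFinD -addeA; apply: leeD; first by rewrite lee_fin ler_wpM2l // mulr_ge0 ?sqr_ge0.
apply: le_trans (lee_wpmul2l c0 integral_interp_le) _.
have error_ge0 : (0 <= (error_sqr * (2 * e))%:E)%E.
  by rewrite lee_fin mulr_ge0 // mulr_ge0 // ltW.
have quotient_ge0 : (0 <= 2%:E * quotient_integral)%E.
  by rewrite mule_ge0 ?quotient_integral_ge0 ?lee_fin.
by rewrite (ge0_muleDr _ quotient_ge0 error_ge0) addeC muleA -!EFinM.
Qed.

End FiberBounds.

Section FiniteIntegrals.
Context d (T : measurableType d) (R : realType).
Variables (m : {measure set T -> \bar R}) (D : set T) (f : T -> \bar R).
Hypotheses (mD : measurable D) (finD : (m D < +oo)%E) (mf : measurable_fun D f).
Hypothesis f_ge0 : forall x, D x -> (0 <= f x)%E.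

Lemma integral_affine_lt_pinfty (c1 c2 : R) : 0 <= c1 -> 0 <= c2 ->
  (\int[m]_(x in D) f x < +oo)%E -> (\int[m]_(x in D) (c1%:E + c2%:E * f x) < +oo)%E.
Proof.
move=> c1_ge0 c2_ge0 finf; rewrite ge0_integralD //.
- rewrite integral_cst // ge0_integralZl_EFin //.
  by apply: lte_add_pinfty; apply: lte_mul_pinfty; rewrite ?lee_fin.
- by move=> x Dx; apply: mule_ge0; rewrite ?lee_fin ?f_ge0.
- exact: measurable_funeM.
Qed.

Lemma integral_bounded_lt_pinfty (N : set T) (c : R) : measurable N -> m N = 0%E -> 0 <= c ->
  (forall x, D x -> ~ N x -> (f x <= c%:E)%E) -> (\int[m]_(x in D) f x < +oo)%E.
Proof.
move=> mN N0 c0 f_le; rewrite (ge0_negligible_integral mN) //.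
apply: (@le_lt_trans _ _ (\int[m]_(x in D `\` N) c%:E)%E).
  apply: ge0_le_integral => //.
  - exact: measurableD.
  - by move=> x [Dx _]; apply: f_ge0.
  - by apply: measurable_funS mf => //; apply: subDsetl.
  - by move=> x [Dx Nx]; apply: f_le.
rewrite integral_cst; last exact: measurableD.
apply: lte_mul_pinfty => //; apply: le_lt_trans finD.
by apply: le_measure; rewrite ?inE //; apply: measurableD.
Qed.

End FiniteIntegrals.

Section InverseNotIntegrable.
Variable R : realType.
Local Notation mu := (@lebesgue_measure R).
Implicit Types (d eps c : R).

Lemma integral_inv d eps : 0 < eps -> eps < d ->
  (\int[mu]_(x in `[eps, d]) (x^-1)%:E = (ln d - ln eps)%:E)%E.
Proof.
move=> eps0 eps_d; have pos x : x \in `[eps, d] -> 0 < x.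
  by rewrite in_itv /= => /andP[eps_x _]; apply: lt_le_trans eps_x.
apply: integral_is_derive => // x /pos x0; first exact: is_derive1_ln.
by apply: inv_continuous; rewrite gt_eqF.
Qed.

Lemma integral_inv_pinfty d : 0 < d -> (\int[mu]_(x in `]0%R, d]) (x^-1)%:E = +oo)%E.
Proof.
move=> d0; set J := (\int[mu]_(x in _) _)%E.
have pos (x : R) : `]0, d]%classic x -> 0 <= x^-1.
  by rewrite /= in_itv /= => /andP[x0 _]; rewrite invr_ge0 ltW.
have J0 : (0 <= J)%E by apply: integral_ge0 => x x_in; rewrite lee_fin pos.
have J_ge eps : 0 < eps -> eps < d -> ((ln d - ln eps)%:E <= J)%E.
  move=> eps0 eps_d; rewrite -integral_inv //; apply: ge0_subset_integral_EFin => //.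
  - move=> x /=; rewrite !in_itv /= => /andP[eps_x ->]; rewrite andbT.
    exact: lt_le_trans eps_x.
  - by apply: measurable_funTS; apply: measurable_inv.
apply/eqP/negPn/negP => J_neq.
have J_fin : J \is a fin_num by rewrite ge0_fin_numE // lt_neqAle J_neq leey.
have J1 : 0 < fine J + 1 by rewrite ltr_wpDl // fine_ge0.
have := J_ge (expR (ln d - (fine J + 1))) (expR_gt0 _).
rewrite -[J]fineK // lee_fin expRK opprB addrCA subrr addr0 gerDl ler10.
by move=> J_bound; apply/notF/J_bound; rewrite -{2}(lnK d0) ltr_expR gtrBl.
Qed.

Lemma integral_cst_div_pinfty c d : 0 < c -> 0 < d ->
  (\int[mu]_(x in `]0%R, d]) (c / x)%:E = +oo)%E.
Proof.
move=> c0 d0; rewrite ge0_integral_EFinZ ?(ltW c0) //.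
- by rewrite integral_inv_pinfty // gt0_muley.
- by apply: measurable_funTS; apply: measurable_inv.
- by move=> x; rewrite /= in_itv /= => /andP[x0 _]; rewrite invr_ge0 ltW.
Qed.

End InverseNotIntegrable.

(** * Orders of vanishing *)

Section Orders.
Variable R : realType.
Local Notation C := R[i].
Local Notation toC := (real_complex R).
Local Notation Re := (@complex.Re R).
Local Notation Im := (@complex.Im R).
Implicit Types (f : R -> C) (g : R -> R) (x K : R) (k m n N : nat).

Lemma vanishesP f n :
  vanishes_to f n <-> exists K, \forall x \near (0 : R), normc (f x) <= K * `|x| ^+ n.
Proof.
split=> [[r [r0 [K f_le]]]|[K /nbhs_norm0P [r r0 f_le]]].
  by exists K; apply: filterS (near0_lt r0) => x /f_le; rewrite -[rC _]/(toC _) lecR.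
by exists r; split=> //; exists K => x /f_le; rewrite -[rC _]/(toC _) lecR.
Qed.

Lemma Ord_near f f' : (\forall x \near (0 : R), f x = f' x) -> Ord f = Ord f'.
Proof.
move=> ff'; rewrite /Ord; congr (ereal_sup [set _ | _ in _]); apply/seteqP.
by split=> n /= /vanishesP [K f_le]; apply/vanishesP; exists K;
  apply: filterS2 ff' f_le => x ff'x f_le; [rewrite -ff'x|rewrite ff'x].
Qed.

Definition order_le f k :=
  exists2 c : R, 0 < c & \forall x \near (0 : R), c * `|x| ^+ k <= normc (f x).

Lemma normX_le_near0 K eps k n : (k < n)%N -> 0 < eps ->
  \forall x \near (0 : R), K * `|x| ^+ n <= eps * `|x| ^+ k.
Proof.
move=> kn eps0; have K1 : 0 < `|K| + 1 by rewrite ltr_wpDl.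
apply: filterS2 (near0_lt ltr01) (near0_lt (divr_gt0 eps0 K1)) => x x1 x_eps.
apply: (@le_trans _ _ ((`|K| + 1) * (`|x| * `|x| ^+ k))).
  apply: (@le_trans _ _ ((`|K| + 1) * `|x| ^+ n)).
    by rewrite ler_wpM2r ?exprn_ge0 // (le_trans (ler_norm _)) // lerDl.
  by rewrite ler_wpM2l ?(ltW K1) // -exprS ler_wiXn2l // ltW.
rewrite mulrA ler_wpM2r ?exprn_ge0 // mulrC -ler_pdivlMr //; exact: ltW.
Qed.

Lemma order_le_vanishes f k m : order_le f k -> vanishes_to f m -> (m <= k)%N.
Proof.
move=> [c c0 f_ge] /vanishesP [K f_le]; rewrite leqNgt; apply/negP => km.
have half : 0 < c / 2 by rewrite divr_gt0.
have [x x0 [[x_ge [x_le x_small]] _]] :=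
  near0_ex_sym (filterI f_ge (filterI f_le (normX_le_near0 K km half))).
have := le_trans (le_trans x_ge x_le) x_small.
rewrite ler_pM2r; last by rewrite exprn_gt0 // normr_gt0 gt_eqF.
by move: c0; lra.
Qed.

Lemma vanishes_to_Ord f n : vanishes_to f n -> ((n%:R : R)%:E <= Ord f)%E.
Proof. by move=> f_n; apply: ereal_sup_ubound; exists n. Qed.

Lemma order_le_Ord f k : order_le f k -> (Ord f <= (k%:R : R)%:E)%E.
Proof.
move=> f_k; apply: ge_ereal_sup => _ [m f_m <-].
by rewrite lee_fin ler_nat; apply: order_le_vanishes f_k f_m.
Qed.

Lemma vanishes_to_weaken f m n : (n <= m)%N -> vanishes_to f m -> vanishes_to f n.
Proof.
move=> nm /vanishesP [K f_le]; apply/vanishesP; exists `|K|.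
apply: filterS2 f_le (near0_lt ltr01) => x x_le x1; apply: le_trans x_le _.
apply: (@le_trans _ _ (`|K| * `|x| ^+ m)); first by rewrite ler_wpM2r ?exprn_ge0 ?ler_norm.
by rewrite ler_wpM2l // ler_wiXn2l // ltW.
Qed.

Lemma vanishes_toD f f' n : vanishes_to f n -> vanishes_to f' n ->
  vanishes_to (fun x => f x + f' x) n.
Proof.
move=> /vanishesP [K f_le] /vanishesP [K' f'_le]; apply/vanishesP; exists (K + K').
apply: filterS2 f_le f'_le => x x_le x_le'; apply: le_trans (le_normcD _ _) _.
by rewrite mulrDl lerD.
Qed.

Lemma order_le_perturb f f' k n : (k < n)%N -> order_le f' k ->
  vanishes_to (fun x => f x - f' x) n -> order_le f k.
Proof.
move=> kn [c c0 f'_ge] /vanishesP [K dist_le]; have half : 0 < c / 2 by rewrite divr_gt0.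
exists (c / 2) => //; apply: filterS2 f'_ge (filterI dist_le (normX_le_near0 K kn half)).
move=> x x_ge [x_dist x_small]; have := ler_normc_add_dist (f' x) (f x).
rewrite -(normcN (f' x - f x)) opprB.
by rewrite [c](splitr c) mulrDl in x_ge; lra.
Qed.

Lemma analytic_order g : analytic g -> ~ (\forall x \near (0 : R), g x = 0) ->
  exists m, order_le (fun x => toC (g x)) m /\ vanishes_to (fun x => toC (g x)) m.
Proof.
move=> ag; have [//|[m [h [ah h0 gE]]] _] := analytic_eq0_or_order ag.
have h_bounds := analytic_near0_norm ah h0; exists m; split.
  exists (`|h 0| / 2); first by rewrite divr_gt0 // normr_gt0.
  apply: filterS2 gE h_bounds => x -> /andP[x_ge _].
  by rewrite normc_real normrM normrX mulrC ler_wpM2l ?exprn_ge0.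
apply/vanishesP; exists (2 * `|h 0|); apply: filterS2 gE h_bounds => x -> /andP[_ x_le].
by rewrite normc_real normrM normrX mulrC ler_wpM2r ?exprn_ge0.
Qed.

Definition order_dichotomy f := forall n, vanishes_to f n \/ exists2 k, (k < n)%N & order_le f k.

Lemma analytic_order_dichotomy g : analytic g -> order_dichotomy (fun x => toC (g x)).
Proof.
move=> ag n; have [g0|g_neq0] := pselect (\forall x \near (0 : R), g x = 0).
  by left; apply/vanishesP; exists 0; apply: filterS g0 => x ->; rewrite normc0 mul0r.
have [m [g_order g_vanishes]] := analytic_order ag g_neq0.
have [mn|nm] := ltnP m n; first by right; exists m.
by left; apply: vanishes_to_weaken nm g_vanishes.
Qed.

Lemma order_dichotomy_approx f : (forall n, exists g1 g2 : R -> R,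
    [/\ analytic g1, analytic g2 & vanishes_to (fun x => f x - Complex (g1 x) (g2 x)) n]) ->
  order_dichotomy f.
Proof.
move=> approx n; have [g1 [g2 [a1 a2 f_g]]] := approx n.
have order_leW (g : R -> R) k : (forall x, `|g x| <= normc (Complex (g1 x) (g2 x))) ->
    order_le (fun x => toC (g x)) k -> order_le (fun x => Complex (g1 x) (g2 x)) k.
  move=> g_le [c c0 g_ge]; exists c => //; apply: filterS g_ge => x.
  by rewrite normc_real => /le_trans; apply.
have [v1|[k kn g1_order]] := analytic_order_dichotomy a1 n; last first.
  right; exists k => //; apply: order_le_perturb kn _ f_g; apply: order_leW g1_order => x.
  exact: (ler_Re_normc (Complex (g1 x) (g2 x))).
have [v2|[k kn g2_order]] := analytic_order_dichotomy a2 n; last first.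
  right; exists k => //; apply: order_le_perturb kn _ f_g; apply: order_leW g2_order => x.
  exact: (ler_Im_normc (Complex (g1 x) (g2 x))).
left; move/vanishesP: v1 => [K1 v1]; move/vanishesP: v2 => [K2 v2].
have : vanishes_to (fun x => Complex (g1 x) (g2 x)) n.
  apply/vanishesP; exists (K1 + K2); apply: filterS2 v1 v2 => x.
  rewrite !normc_real mulrDl => x1 x2; apply: le_trans (ler_normc_ReIm _) _.
  exact: lerD.
by move=> /(vanishes_toD f_g); under eq_fun do rewrite subrK.
Qed.

Lemma analytic_lipschitz0 g : analytic g -> g 0 = 0 ->
  exists2 A, 1 <= A & \forall x \near (0 : R), `|g x| <= A * `|x|.
Proof.
move=> ag g0; have [/vanishesP [K g_le]|[k]] := analytic_order_dichotomy ag 1; last first.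
  rewrite ltnS leqn0 => /eqP -> [c c0 /nbhs_singleton].
  by rewrite normc_real g0 normr0 expr0 mulr1 leNgt c0.
exists (Num.max 1 K); first by rewrite le_max lexx.
apply: filterS g_le => x; rewrite normc_real expr1 => /le_trans; apply.
by rewrite ler_wpM2r // le_max lexx orbT.
Qed.

Lemma analytic_Re_psum2 (h : {additive C -> R}) (c : nat -> nat -> C) g N :
  (forall z x, h (z * toC x) = h z * x) -> analytic g ->
  analytic (fun x => h (psum2 c (toC x) (toC (g x)) N)).
Proof.
move=> h_real ag.
apply: (eq_analytic (f := fun x => \sum_(m < N) \sum_(n < N) h (c m n) * (x ^+ m * g x ^+ n))).
  move=> x; rewrite /psum2 raddf_sum; apply: eq_bigr => m _.
  rewrite raddf_sum; apply: eq_bigr => n _.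
  by rewrite -h_real rmorphM !rmorphXn mulrA.
apply: analytic_sum => m; apply: analytic_sum => n; apply: analyticM (analytic_cst _) _.
by apply: analyticM; [apply: analytic_exprn|apply: analyticX].
Qed.

Lemma order_dichotomy_series2 (c : nat -> nat -> C) r K g : 0 < r ->
  (forall m n, normc (c m n) * r ^+ (m + n) <= K) -> analytic g -> g 0 = 0 ->
  order_dichotomy (fun x => eval_series2 c (toC x) (toC (g x))).
Proof.
move=> r0 c_le ag g0; have [A A1 g_le] := analytic_lipschitz0 ag g0.
have A0 : 0 < A by apply: lt_le_trans A1.
apply: order_dichotomy_approx => N; pose S x := psum2 c (toC x) (toC (g x)) N.
exists (fun x => Re (S x)), (fun x => Im (S x)); split.
- by apply: analytic_Re_psum2 => // -[u v] x /=; rewrite mulr0 subr0.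
- by apply: analytic_Re_psum2 => // -[u v] x /=; rewrite mulr0 add0r.
have d0 : 0 < r / (2 * A) by rewrite divr_gt0 // mulr_gt0.
apply/vanishesP; exists (16 * K * (A / r) ^+ N).
apply: filterS2 g_le (near0_lt d0) => x gx_le x_lt.
have -> : Complex (Re (S x)) (Im (S x)) = S x by case: (S x).
rewrite -[leRHS]mulrA -exprMn [A / r * _]mulrAC.
have [|||_ _] := @eval_series2_approx _ c r K r0 c_le (toC x) (toC (g x)) (A * `|x| / r).
- by rewrite normc_real divfK ?gt_eqF // ler_peMl.
- by rewrite normc_real divfK ?gt_eqF.
- rewrite divr_ge0 ?mulr_ge0 ?(ltW A0) ?(ltW r0) //= ler_pdivrMr //.
  by move: x_lt; rewrite ltr_pdivlMr ?mulr_gt0 //; nra.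
- exact.
Qed.

Lemma sqnormC_le_order f g n m : (m <= n * 2)%N -> vanishes_to f n ->
  order_le (fun x => toC (g x)) m ->
  exists2 c : R, 0 <= c & \forall x \near (0 : R), sqnormC (f x) <= c * `|g x|.
Proof.
move=> mn /vanishesP [K f_le] [c c0 g_ge].
exists (K ^+ 2 / c); first by rewrite divr_ge0 ?sqr_ge0 ?ltW.
apply: filterS2 (filterI f_le g_ge) (near0_lt ltr01) => x [fx_le gx_ge] x1.
rewrite normc_real in gx_ge; rewrite -sqr_normc.
apply: (@le_trans _ _ ((K * `|x| ^+ n) ^+ 2)).
  by apply: lerXn2r; rewrite ?nnegrE ?normc_ge0 // (le_trans (normc_ge0 _) fx_le).
rewrite exprMn -exprM -[leRHS]mulrA ler_wpM2l ?sqr_ge0 // ler_pdivlMl //; apply: le_trans gx_ge.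
by rewrite ler_wpM2l ?(ltW c0) // ler_wiXn2l // ltW.
Qed.

Lemma sqnormC_ge_order f g k m : (k * 2 < m)%N -> order_le f k ->
  order_le (fun x => toC (g x)) m -> vanishes_to (fun x => toC (g x)) m ->
  exists2 c : R, 0 < c & \forall x \near (0 : R), x != 0 -> c / `|x| <= sqnormC (f x) / `|g x|.
Proof.
move=> km [c c0 f_ge] [b b0 g_ge] /vanishesP [K g_le].
have K1 : 0 < `|K| + 1 by rewrite ltr_wpDl.
exists (c ^+ 2 / (`|K| + 1)); first by rewrite divr_gt0 // exprn_gt0.
apply: filterS2 (filterI f_ge (near0_lt ltr01)) (filterI g_ge g_le) => x [fx_ge x1] [].
rewrite normc_real => gx_ge gx_le x0; have ax0 : 0 < `|x| by rewrite normr_gt0.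
have gx0 : 0 < `|g x| by apply: lt_le_trans gx_ge; rewrite mulr_gt0 // exprn_gt0.
rewrite ler_pdivlMr //.
apply: (@le_trans _ _ (c ^+ 2 / (`|K| + 1) / `|x| * ((`|K| + 1) * `|x| ^+ m))).
  rewrite ler_wpM2l ?divr_ge0 ?sqr_ge0 ?(ltW K1) //; apply: le_trans gx_le _.
  by rewrite ler_wpM2r ?exprn_ge0 // (le_trans (ler_norm _)) // lerDl.
have -> : c ^+ 2 / (`|K| + 1) / `|x| * ((`|K| + 1) * `|x| ^+ m) = c ^+ 2 * `|x| ^+ m.-1.
  by rewrite -[in LHS](ltn_predK km) [`|x| ^+ _.+1]exprS; field; rewrite !gt_eqF.
apply: (@le_trans _ _ ((c * `|x| ^+ k) ^+ 2)).
  rewrite exprMn -exprM ler_wpM2l ?sqr_ge0 // ler_wiXn2l ?(ltW x1) //.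
  by rewrite -ltnS (ltn_predK km).
by rewrite -sqr_normc; apply: lerXn2r; rewrite ?nnegrE ?normc_ge0 ?mulr_ge0 ?exprn_ge0 // ltW.
Qed.

Lemma double_Ord_dichotomy f g : order_dichotomy f -> analytic g ->
  ~ (\forall x \near (0 : R), g x = 0) ->
  ((Ord (fun x => toC (g x)) <= Ord f * 2%:E)%E /\
   exists2 c : R, 0 <= c & \forall x \near (0 : R), sqnormC (f x) <= c * `|g x|) \/
  (~ (Ord (fun x => toC (g x)) <= Ord f * 2%:E)%E /\
   exists2 c : R, 0 < c & \forall x \near (0 : R), x != 0 -> c / `|x| <= sqnormC (f x) / `|g x|).
Proof.
move=> f_dich ag g_neq0; have [m [g_order g_vanishes]] := analytic_order ag g_neq0.
have Ord_g : Ord (fun x => toC (g x)) = (m%:R : R)%:E.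
  by apply/eqP; rewrite eq_le order_le_Ord ?vanishes_to_Ord.
have two_ge0 : (0 <= 2%:E :> \bar R)%E by rewrite lee_fin.
have [f_vanishes|[k k_lt f_order]] := f_dich (uphalf m).
  have m_le : (m <= uphalf m * 2)%N by lia.
  left; split; last exact: sqnormC_le_order m_le f_vanishes g_order.
  have /(lee_wpmul2r two_ge0) := vanishes_to_Ord f_vanishes.
  by apply: le_trans; rewrite Ord_g -EFinM lee_fin -natrM ler_nat.
have k_lt2 : (k * 2 < m)%N by lia.
right; split; last exact: sqnormC_ge_order k_lt2 f_order g_order g_vanishes.
rewrite Ord_g => m_le; have /(lee_wpmul2r two_ge0) := order_le_Ord f_order.
by move=> /(le_trans m_le); rewrite -EFinM lee_fin -natrM ler_nat leqNgt k_lt2.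
Qed.

End Orders.

(** * The integrability criterion *)

Section Criterion.
Variable R : realType.
Local Notation C := R[i].
Local Notation toC := (real_complex R).
Local Notation mu := (@lebesgue_measure R).
Variables (M : nat) (L : 'I_M -> nat) (q : 'I_M -> {poly R}) (t : R).
Hypothesis L_gt0 : forall j, (0 < L j)%N.
Hypothesis q0 : forall j, (q j).[0] = 0.
Variable a : 'I_M -> R -> R.
Hypothesis a_analytic : forall j, analytic (a j).
Hypothesis a0 : forall j, a j 0 = 0.
Hypothesis a_roots : \forall x \near (0 : R), branch_roots L q t x (a^~ x).
Variables (c : nat -> nat -> C) (r K : R).
Hypothesis r_gt0 : 0 < r.
Hypothesis c_le : forall m n, normc (c m n) * r ^+ (m + n) <= K.
Implicit Types (j : 'I_M) (x y e : R) (z : C).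

Local Notation fiber x := (node L q x).
Local Notation Q x := (eval_series2 c (toC x)).
Local Notation W j x := (wronskian (fiberP (fiber x))).[a j x].
Local Notation ratio_at x j := (branch_ratio (fiber x) (a^~ x) (Q x) j).
Local Notation fiber_mass e x := (quotient_integral (fiber x) e (Q x)).
Local Notation interpQ x := (interp (fun j => toC (a j x)) (fun j => Q x (toC (a j x)))).

Let r_half_gt0 : 0 < r / 2. Proof. by rewrite divr_gt0. Qed.

Lemma branches_small e : 0 < e -> \forall x \near (0 : R), forall j, `|a j x| <= e.
Proof. by move=> e0; apply: near0_forall => j; apply: analytic_near0_le. Qed.

Lemma nodes_small e : 0 < e -> \forall x \near (0 : R), forall k, normc (fiber x k) <= e.
Proof.
move=> e0; apply: near0_forall => k; have half : 0 < e / 2 by rewrite divr_gt0.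
have q_small := analytic_near0_le (analytic_horner (q k)) (q0 k) half.
have pow0 : (0 : R) ^+ (2 * L k) = 0 by rewrite expr0n muln_eq0 /= eqn0Ngt L_gt0.
apply: filterS2 q_small (analytic_near0_le (analytic_exprn R (2 * L k)) pow0 half) => x x_q x_pow.
by apply: le_trans (ler_normc_ReIm _) _; rewrite [e](splitr e) lerD.
Qed.

Lemma analytic_wronskian_branch j : analytic (fun x => W j x).
Proof.
pose factor i x := (a j x + (q i).[x]) ^+ 2 + (x ^+ (2 * L i)) ^+ 2.
apply: (eq_analytic (f := fun x => \sum_k x ^+ (2 * L k) * \prod_(i | i != k) factor i x)).
  move=> x; rewrite horner_wronskian_fiberP; apply: eq_bigr => k _; congr (_ * _).
  by apply: eq_bigr => i _; rewrite /sqnormC /= add0r.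
apply: analytic_sum => k; apply: analyticM; first exact: analytic_exprn.
apply: analytic_prod => i; apply: analyticD; apply: analyticX; last exact: analytic_exprn.
by apply: analyticD => //; apply: analytic_horner.
Qed.

Lemma wronskian_branch_gt0 j x : x != 0 -> 0 < W j x.
Proof.
move=> x0; apply: (wronskian_root_gt0 (nu := fiber x) _ (a^~ x)) => k.
exact: Im_node_gt0.
Qed.

Lemma cmeasurable_series2 d (T : measurableType d) (D : set T) (u v : T -> R) :
  measurable_fun D u -> measurable_fun D v ->
  (forall s, D s -> `|u s| <= r / 2 /\ `|v s| <= r / 2) ->
  cmeasurable D (fun s => Q (u s) (toC (v s))).
Proof.
move=> mu_u mu_v uv_le; pose S N s := psum2 c (toC (u s)) (toC (v s)) N.
have mS N : cmeasurable D (S N).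
  apply: cmeasurable_sum => m; apply: cmeasurable_sum => n.
  apply: cmeasurableM; last by apply: cmeasurableX; apply: cmeasurable_real.
  by apply: cmeasurableM; [apply: cmeasurable_cst|apply: cmeasurableX; apply: cmeasurable_real].
have cvg_S s : D s -> ((fun N => complex.Re (S N s)) @ \oo --> complex.Re (Q (u s) (toC (v s)))) /\
    ((fun N => complex.Im (S N s)) @ \oo --> complex.Im (Q (u s) (toC (v s)))).
  move=> Ds; have [u_le v_le] := uv_le s Ds.
  by have [|||? ? _] := @eval_series2_approx _ c r K r_gt0 c_le (toC (u s)) (toC (v s)) 2^-1;
    rewrite ?normc_real 1?mulrC // invr_ge0 ler0n lexx.
split.
  apply: (measurable_fun_cvg (h := fun N s => complex.Re (S N s))) => [N|s /cvg_S []] //.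
  exact: (proj1 (mS N)).
apply: (measurable_fun_cvg (h := fun N s => complex.Im (S N s))) => [N|s /cvg_S []] //.
exact: (proj2 (mS N)).
Qed.

Lemma cmeasurable_fiberP d (T : measurableType d) (D : set T) (u v : T -> R) :
  measurable_fun D u -> measurable_fun D v ->
  cmeasurable D (fun s => (fiberP (fiber (u s))).[toC (v s)]).
Proof.
move=> mu_u mu_v.
pose factor s k := toC (v s) + (polyRC (q k) + iC R *: 'X^(2 * L k)).[toC (u s)].
apply: (eq_cmeasurable (g := fun s => \prod_k factor s k)).
  by move=> s; rewrite horner_fiberP; apply: eq_bigr => k _; rewrite /factor horner_node.
apply: cmeasurable_prod => k; apply: cmeasurableD; first exact: cmeasurable_real.
by apply: cmeasurable_horner; apply: cmeasurable_real.
Qed.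

Definition quotient (p : R * R) : C := Q p.1 (toC p.2) / (fiberP (fiber p.1)).[toC p.2].

Lemma cmeasurable_quotient (A B : set R) : measurable A -> measurable B ->
  (forall x, A x -> `|x| <= r / 2) -> (forall y, B y -> `|y| <= r / 2) ->
  cmeasurable (A `*` B) quotient.
Proof.
move=> mA mB A_le B_le.
have m_fst : measurable_fun (A `*` B) (@fst R R) by apply: measurable_funTS; apply: measurable_fst.
have m_snd : measurable_fun (A `*` B) (@snd R R) by apply: measurable_funTS; apply: measurable_snd.
apply: cmeasurableM; last by apply: cmeasurableV; apply: cmeasurable_fiberP.
by apply: cmeasurable_series2 => // p [/= p1 p2]; split; [apply: A_le|apply: B_le].
Qed.

Lemma cmeasurable_slice x e : `|x| <= r / 2 -> e <= r / 2 ->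
  cmeasurable `[- e, e] (fun y => Q x (toC y)).
Proof.
move=> x_le e_le; apply: (cmeasurable_series2 (u := fun=> x) (v := id)).
- exact: measurable_cst.
- exact: measurable_id.
- by move=> y; rewrite /= in_itv /= -ler_norml => /le_trans ->.
Qed.

Definition error_constant : R := 4 * K * (2 / r) ^+ M.

Lemma error_constant_ge0 : 0 <= error_constant.
Proof.
rewrite mulr_ge0 ?exprn_ge0 ?divr_ge0 ?(ltW r_gt0) // mulr_ge0 //.
exact: series2_bound_ge0 c_le.
Qed.

Lemma fiber_interp_error x z : x != 0 -> branch_roots L q t x (a^~ x) ->
  `|x| <= r / 2 -> (forall j, `|a j x| <= r / 2) -> normc z <= r / 2 ->
  normc (Q x z - (interpQ x).[z]) <= error_constant * \prod_j normc (z - toC (a j x)).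
Proof.
move=> x0 roots x_le a_le z_le; rewrite -normc_prod.
apply: (interp_series2_error r_gt0 c_le) => //; rewrite ?normc_real //.
- move=> i j /complexI; apply: (pencil_roots_inj (nu := fiber x) _ roots) => k.
  exact: Im_node_gt0.
- by move=> j; rewrite normc_real.
Qed.

Lemma fiber_interp_error_real x y : x != 0 -> branch_roots L q t x (a^~ x) ->
  `|x| <= r / 2 -> (forall j, `|a j x| <= r / 2) -> `|y| <= r / 2 ->
  normc (Q x (toC y) - (interpQ x).[toC y]) <=
  error_constant * `|(pencil (fiberP (fiber x)) t).[y]|.
Proof.
move=> x0 roots x_le a_le y_le; rewrite roots horner_prod normr_prod.
have -> : \prod_j `|('X - (a j x)%:P).[y]| = \prod_j normc (toC y - toC (a j x)).
  by apply: eq_bigr => j _; rewrite hornerXsubC -rmorphB normc_real.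
by apply: fiber_interp_error; rewrite ?normc_real.
Qed.

Lemma fiber_interp_le x z e : x != 0 -> branch_roots L q t x (a^~ x) ->
  `|x| <= r / 2 -> e <= r / 2 -> (forall j, `|a j x| <= e) -> normc z <= e ->
  normc (interpQ x).[z] <= 16 * K + error_constant * (2 * e) ^+ M.
Proof.
move=> x0 roots x_le e_le a_le z_le; have z_r := le_trans z_le e_le.
apply: le_trans (ler_normc_add_dist _ (Q x z)) _; apply: lerD.
  by apply: (eval_series2_le r_gt0 c_le); rewrite ?normc_real.
rewrite -normcN opprB; apply: le_trans (fiber_interp_error x0 roots x_le _ z_r) _.
  by move=> j; apply: le_trans (a_le j) e_le.
rewrite ler_wpM2l ?error_constant_ge0 // -[X in _ ^+ X]card_ord -prodr_const.
apply: ler_prod => j _; rewrite normc_ge0 /=; apply: le_trans (ler_normcB _ _) _.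
by rewrite normc_real; have := a_le j; lra.
Qed.

Lemma ratio_at_le e : 0 < e -> e <= r / 2 ->
  exists c1 c2 : R, [/\ 0 <= c1, 0 <= c2 & \forall x \near (0 : R), x != 0 -> forall j,
    ((ratio_at x j)%:E <= c1%:E + c2%:E * fiber_mass e x)%E].
Proof.
move=> e0 e_le; have pi0 := pi_gt0 R; have kappa0 := error_constant_ge0.
have quarter : 0 < e / 4 by rewrite divr_gt0.
have eighth : 0 < e / 8 by rewrite divr_gt0.
pose V0 := 16 * K + error_constant * (2 * e) ^+ M.
eexists; eexists; split; last first.
  apply: filterS2 (filterI a_roots (near0_lt r_half_gt0))
    (filterI (branches_small quarter) (nodes_small eighth)) => x [roots /ltW x_le] [a_le nu_le] x0.
  have a_e j : `|a j x| <= e by apply: le_trans (a_le j) _; lra.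
  have a_r j : `|a j x| <= r / 2 := le_trans (a_e j) e_le.
  have interp_le z : normc z <= e -> normc (interpQ x).[z] <= V0 by apply: fiber_interp_le.
  apply: (branch_ratio_le (fun k => Im_node_gt0 L q k x0) roots e0 kappa0 _ _ nu_le a_le interp_le).
  - exact: cmeasurable_slice.
  - by move=> y y_le; apply: fiber_interp_error_real => //; apply: le_trans e_le.
- by rewrite mulr_ge0 // divr_ge0 ?mulr_ge0 ?(ltW pi0).
- apply: addr_ge0; apply: mulr_ge0.
  + by rewrite mulr_ge0 ?sqr_ge0.
  + by rewrite mulr_ge0 ?(ltW e0).
  + by rewrite divr_ge0 ?mulr_ge0 ?(ltW pi0).
  + apply: mulr_ge0; last by rewrite mulr_ge0 ?(ltW e0).
    by apply: mulr_ge0 => //; apply: mulr_ge0; rewrite ?addr_ge0 ?sqr_ge0.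
Qed.

Lemma fiber_mass_le c1 : (forall j, \forall x \near (0 : R), x != 0 -> ratio_at x j <= c1) ->
  exists e c2 : R, [/\ 0 < e, e <= r / 2, 0 <= c2 &
    forall x, `|x| < e -> x != 0 -> (fiber_mass e x <= c2%:E)%E].
Proof.
move=> /near0_forall ratio_le.
have [e' e'0 near_e'] :=
  near0_ex_ball (filterI a_roots (filterI (branches_small r_half_gt0) ratio_le)).
pose e := Num.min e' (r / 2); have e0 : 0 < e by rewrite lt_min e'0.
have e_le : e <= r / 2 by rewrite ge_min lexx orbT.
have e_le' : e <= e' by rewrite ge_min lexx.
pose S := \sum_(j < M) `|c1|; have kappa0 := error_constant_ge0.
exists e, (2 * (M%:R * pi) * S + 2 * (error_constant ^+ 2 * (1 + t ^+ 2)) * (2 * e)).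
split=> // [|x x_lt x0]; last first.
  have [|roots [a_le ratio_x]] := near_e' x; first exact: lt_le_trans x_lt e_le'.
  have x_le : `|x| <= r / 2 := le_trans (ltW x_lt) e_le.
  apply: le_trans (quotient_integral_le (fun k => Im_node_gt0 L q k x0) roots e0 kappa0 _ _) _.
  - exact: cmeasurable_slice.
  - by move=> y y_le; apply: fiber_interp_error_real => //; apply: le_trans e_le.
  rewrite lee_fin lerD2r ler_wpM2l ?mulr_ge0 ?pi_ge0 //.
  by apply: ler_sum => j _; apply: le_trans (ratio_x j x0) (ler_norm _).
have S0 : 0 <= S by apply: sumr_ge0.
apply: addr_ge0; apply: mulr_ge0 => //.
- by rewrite !mulr_ge0 ?pi_ge0.
- by apply: mulr_ge0 => //; apply: mulr_ge0; rewrite ?addr_ge0 ?sqr_ge0.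
- by rewrite mulr_ge0 ?(ltW e0).
Qed.

Lemma square_itv e : [set p : R * R | `|p.1| < e /\ `|p.2| < e] =
  `](- e), e[%classic `*` `](- e), e[%classic.
Proof.
by apply/seteqP; split => [[x y]|[x y]] /=; rewrite !in_itv /= -!ltr_norml; move=> [].
Qed.

Lemma L2loc_quotient c1 : (forall j, \forall x \near (0 : R), x != 0 -> ratio_at x j <= c1) ->
  L2loc quotient.
Proof.
move=> /fiber_mass_le [e [c2 [e0 e_le c20 mass_le]]]; exists e; split=> //.
rewrite /L2_on square_itv; set I := `](- e), e[%classic.
have mI : measurable I by apply: measurable_itv.
have I_lt y : I y -> `|y| < e by rewrite /I /= in_itv /= -ltr_norml.
have I_le y : I y -> `|y| <= r / 2 by move=> /I_lt /ltW /le_trans ->.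
have mquot := cmeasurable_quotient mI mI I_le I_le; have [mRe mIm] := mquot.
have msqr := measurable_sqnormC mquot; have sqr0 p : 0 <= sqnormC (quotient p) := sqnormC_ge0 _.
split; [exact: measurableX|split=> //; split=> //].
rewrite (tonelli_rectangle mu mu mI mI msqr sqr0).
have fin_I : (mu I < +oo)%E by rewrite /= lebesgue_measure_itv /= lte_fin ifT ?ltry //; lra.
have m_inner := measurable_integral_fst mu mI mI msqr sqr0.
have inner_ge0 x : I x -> (0 <= \int[mu]_(y in I) (sqnormC (quotient (x, y)))%:E)%E.
  by move=> _; apply: integral_ge0 => y _; rewrite lee_fin.
apply: (@integral_bounded_lt_pinfty _ _ _ mu _ _ mI fin_I m_inner inner_ge0 [set 0] c2
  (measurable_set1 _) (lebesgue_measure_set1 _) c20).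
move=> x /I_lt x_lt x_neq0; have x0 : x != 0 by apply/eqP => x_eq0; apply: x_neq0.
have x_le : `|x| <= r / 2 := le_trans (ltW x_lt) e_le.
have m_sqr := measurable_sqnormC_quotient (fiber x) (cmeasurable_slice x_le e_le).
apply: le_trans (mass_le x x_lt x0); apply: ge0_subset_integral_EFin => //.
exact: subset_itv_oo_cc.
Qed.

Lemma L2loc_fiber_mass_lt_pinfty : L2loc quotient -> exists2 e : R, 0 < e <= r / 2 &
  forall d, 0 < d <= e -> measurable_fun `]0, d] (fun x => fiber_mass e x) /\
    (\int[mu]_(x in `]0%R, d]) fiber_mass e x < +oo)%E.
Proof.
move=> [e' [e'0 [_ [mRe [mIm fin]]]]].
pose e := Num.min (e' / 2) (r / 2); have e_lt' : e < e'.
  by rewrite (@le_lt_trans _ _ (e' / 2)) ?ge_min ?lexx //; lra.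
have e0 : 0 < e by rewrite lt_min divr_gt0.
have e_le : e <= r / 2 by rewrite ge_min lexx orbT.
exists e => [|d /andP[d0 d_le]]; first by rewrite e0.
pose A := `]0, d]%classic : set R; pose B := `[- e, e]%classic : set R.
have mA : measurable A by apply: measurable_itv.
have mB : measurable B by apply: measurable_itv.
have A_le x : A x -> `|x| <= e.
  by rewrite /A /= in_itv /= => /andP[x0 x_le]; rewrite gtr0_norm // (le_trans x_le).
have B_le y : B y -> `|y| <= e by rewrite /B /= in_itv /= -ler_norml.
have mquot : cmeasurable (A `*` B) quotient.
  by apply: cmeasurable_quotient => // [x /A_le|y /B_le] /le_trans ->.
have msqr := measurable_sqnormC mquot; have sqr0 p : 0 <= sqnormC (quotient p) := sqnormC_ge0 _.
have finAB : (\int[mu \x mu]_(p in A `*` B) (sqnormC (quotient p))%:E < +oo)%E.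
  apply: le_lt_trans fin; apply: ge0_subset_integral_EFin => //.
  - by rewrite square_itv; apply: measurableX; apply: measurable_itv.
  - exact: measurableX.
  - by move=> [x y] [/= /A_le x_le /B_le y_le]; split; apply: le_lt_trans e_lt'.
  - exact: measurable_sqnormC (conj mRe mIm).
rewrite (tonelli_rectangle mu mu mA mB msqr sqr0) in finAB.
by split; [exact: (measurable_integral_fst mu mA mB msqr sqr0)|exact: finAB].
Qed.

Lemma L2loc_ratio_not_ge j : L2loc quotient ->
  ~ exists2 c0 : R, 0 < c0 & \forall x \near (0 : R), x != 0 -> c0 / `|x| <= ratio_at x j.
Proof.
move=> /L2loc_fiber_mass_lt_pinfty [e /andP[e0 e_le] mass_fin] [c0 c00 ratio_ge].
have [c1 [c2 [c10 c20 ratio_le]]] := ratio_at_le e0 e_le.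
have [d' d'0 near_d'] := near0_ex_ball (filterI ratio_le ratio_ge).
pose d := Num.min (d' / 2) e; have d0 : 0 < d by rewrite lt_min e0 divr_gt0.
have d_lt' : d < d' by rewrite (@le_lt_trans _ _ (d' / 2)) ?ge_min ?lexx //; lra.
have [|m_mass mass_lt] := mass_fin d; first by rewrite d0 ge_min lexx orbT.
have mass0 x : (0 <= fiber_mass e x)%E by apply: quotient_integral_ge0.
have mA : measurable (`]0, d]%classic : set R) by apply: measurable_itv.
have finA : (mu `]0%R, d]%classic < +oo)%E.
  by rewrite /= lebesgue_measure_itv /= lte_fin d0 -EFinB ltry.
have := @integral_affine_lt_pinfty _ _ _ mu _ _ mA finA m_mass (fun x _ => mass0 x)
  c1 c2 c10 c20 mass_lt.
apply/negP; rewrite -leNgt -(integral_cst_div_pinfty c00 d0).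
apply: ge0_le_integral => //.
- by move=> x; rewrite /= in_itv /= => /andP[x0 _]; rewrite lee_fin divr_ge0 // ltW.
- apply/measurable_EFinP; apply: measurable_funTS.
  by apply: measurable_funM; [apply: measurable_cst|apply: measurable_inv].
- apply: emeasurable_funD; first exact: measurable_cst.
  exact: measurable_funeM.
move=> x; rewrite /= in_itv /= => /andP[x0 x_le]; have x_neq0 : x != 0 by rewrite gt_eqF.
have [|x_ratio_le x_ratio_ge] := near_d' x; first by rewrite gtr0_norm // (le_lt_trans x_le).
apply: le_trans (x_ratio_le x_neq0 j); rewrite lee_fin.
by have := x_ratio_ge x_neq0; rewrite gtr0_norm.
Qed.

Theorem L2loc_quotient_iff : L2loc quotient <-> forall j,
  (Ord (fun x => toC (W j x)) <= Ord (fun x => Q x (toC (a j x))) * 2%:E)%E.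
Proof.
have W_neq0 j : ~ \forall x \near (0 : R), W j x = 0.
  move=> /near0_ex_sym [x x0 [Wx0 _]].
  by have := wronskian_branch_gt0 j (lt0r_neq0 x0); rewrite Wx0 ltxx.
have dichotomy j := double_Ord_dichotomy (order_dichotomy_series2 r_gt0 c_le (a_analytic j) (a0 j))
  (analytic_wronskian_branch j) (W_neq0 j).
split=> [L2 j|Ord_le].
  have [[]|[_ [c0 c00 ratio_ge]]] // := dichotomy j; case: (L2loc_ratio_not_ge L2 (j := j)).
  exists c0 => //; apply: filterS ratio_ge => x x_ge x0.
  by have := x_ge x0; rewrite (gtr0_norm (wronskian_branch_gt0 j x0)).
have /boolp.choice [c1 ratio_le] : forall j, exists c1 : R, 0 <= c1 /\
    \forall x \near (0 : R), x != 0 -> ratio_at x j <= c1.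
  move=> j; have [[_ [c1 c10 f_le]]|[] //] := dichotomy j; exists c1; split=> //.
  apply: filterS f_le => x x_le x0; have Wx_gt0 := wronskian_branch_gt0 j x0.
  by rewrite /branch_ratio ler_pdivrMr // -(gtr0_norm Wx_gt0).
apply: (@L2loc_quotient (\sum_j c1 j)) => j; have [_ ratio_j] := ratio_le j.
apply: filterS ratio_j => x x_le x0; apply: le_trans (x_le x0) _.
by rewrite (bigD1 j) //= lerDl; apply: sumr_ge0 => i _; case: (ratio_le i).
Qed.

End Criterion.

Lemma eval2_Bpoly_deriv_root (R : realType) (M : nat) (L : 'I_M -> nat) (q : 'I_M -> {poly R})
    (t x : R) (a : 'I_M -> R) (j : 'I_M) : branch_roots L q t x a ->
  let P := Ppoly q L in
  eval2 (Bpoly P) (rC x) (rC (a j)) *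
    eval2 ((Apoly P)^`() + (rC t)%:P%:P * (Bpoly P)^`()) (rC x) (rC (a j)) =
  rC (wronskian (fiberP (node L q x))).[a j].
Proof.
move=> roots P; rewrite -![rC _]/(real_complex R _) !eval2_slice slice_Bpoly slice_deriv_pencil.
by rewrite slice_Ppoly !horner_map (deriv_pencil_root roots) -rmorphM (wronskian_root roots).
Qed.

Lemma conv_series2P (R : realType) (c : nat -> nat -> R[i]) : conv_series2 c ->
  exists r K, 0 < r /\ forall m n, normc (c m n) * r ^+ (m + n) <= K.
Proof.
move=> [r [r0 [K c_le]]]; exists r, K; split=> // m n; have := c_le m n.
by rewrite -[rC (_ ^+ _)]/(real_complex R _) -[rC K]/(real_complex R K) -rmorphM lecR.
Qed.

Theorem theorem5p1 (R : realType) (M : nat) (L : 'I_M -> nat)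
  (q : 'I_M -> {poly R})
  (hL : forall j, (0 < L j)%N)
  (hdeg : forall j, (size (q j) <= 2 * L j)%N)
  (hq0 : forall j, (q j).[0] = 0)
  (t : R) :
  let P := Ppoly q L in
  let A := Apoly P in
  let B := Bpoly P in
  let F := A + (rC t)%:P%:P * B in
  let G := A^`() + (rC t)%:P%:P * B^`() in
  let branches (b : 'I_M -> nat -> R) :=
    (forall j, conv_series1 (b j)) /\
    (forall j, eval_series1 (b j) 0 = 0) /\
    (exists e : R, 0 < e /\ forall x : R, `|x| < e -> forall y : R[i],
       eval2 F (rC x) y = \prod_(j < M) (y - rC (eval_series1 (b j) x))) in
  (exists b, branches b) /\
  forall b, branches b ->
  forall c : nat -> nat -> R[i], conv_series2 c ->
    (L2loc (fun p : R * R =>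
       eval_series2 c (rC p.1) (rC p.2) / eval2 P (rC p.1) (rC p.2))
     <->
     forall j : 'I_M,
       (Ord (fun x : R => eval_series2 c (rC x) (rC (eval_series1 (b j) x)))
         * 2%:E
        >= Ord (fun x : R =>
              (eval2 B (rC x) (rC (eval_series1 (b j) x)) *
               eval2 G (rC x) (rC (eval_series1 (b j) x)))%R))%E).
Proof.
move=> P A B F G branches; split.
  have [b [b_conv b0 roots]] := branches_exist t hL hq0; exists b; do 2!split=> //.
  by have [e e0 roots_e] := near0_ex_ball roots; exists e; split=> // x /roots_e /branch_rootsP.
move=> b [b_conv [b0 [e [e0 factors]]]] c /conv_series2P [r [K [r0 c_le]]].
pose a j x := eval_series1 (b j) x.
have a_analytic j : analytic (a j) by exists (b j); apply: germ_eval_series1.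
have roots : \forall x \near (0 : R), branch_roots L q t x (a^~ x).
  by apply: filterS (near0_lt e0) => x /factors /branch_rootsP.
have -> : (fun p : R * R => eval_series2 c (rC p.1) (rC p.2) / eval2 P (rC p.1) (rC p.2)) =
    quotient L q c.
  by apply/funext => p; rewrite -[rC p.1]/(real_complex R _) eval2_slice slice_Ppoly.
have Ord_wronskian j : Ord (fun x => eval2 B (rC x) (rC (a j x)) * eval2 G (rC x) (rC (a j x))) =
    Ord (fun x => rC (wronskian (fiberP (node L q x))).[a j x]).
  by apply: Ord_near; apply: filterS roots => x; apply: eval2_Bpoly_deriv_root.
rewrite (L2loc_quotient_iff hL hq0 a_analytic b0 roots r0 c_le).
by split=> Ord_le j; [rewrite Ord_wronskian|rewrite -Ord_wronskian]; apply: Ord_le.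
Qed.
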